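(* Let $m,n,Q\geq1$ be integers and let $\mathbb{R}^{n\times m}\ni M\mapsto A\,M\in\mathbb{R}^{n\times m}$ be a linear symmetric map. The quadratic integrand associated with $A$ is $Q$-semielliptic if and only if it is quasiconvex, i.e. if and only if the $Q$-integrand $f(a_1,\dots,a_Q,M_1,\dots,M_Q)=\sum_{i=1}^Q\langle A\,M_i,M_i\rangle$ is quasiconvex.
   Context: **$Q$-points and Sobolev maps.** For $P\in\mathbb{R}^n$ let $[\![P]\!]$ be the Dirac mass at $P$. $\mathcal{A}_q(\mathbb{R}^n)=\{\sum_{i=1}^q[\![P_i]\!]:P_i\in\mathbb{R}^n\}$, with metric $\mathcal{G}(\sum_i[\![P_i]\!],\sum_i[\![S_i]\!])=\min_\sigma\sqrt{\sum_i|P_i-S_{\sigma(i)}|^2}$ (minimum over permutations $\sigma$). Let $C_1=[-1/2,1/2]^m$. A measurable $w:C_1\to\mathcal{A}_q(\mathbb{R}^n)$ is in $W^{1,\infty}(C_1,\mathcal{A}_q)$ if there is $\varphi\in L^\infty(C_1;[0,\infty))$ such that, for all $T\in\mathcal{A}_q(\mathbb{R}^n)$, $\mathcal{G}(w,T)\in W^{1,\infty}(C_1)$ and $|D\,\mathcal{G}(w,T)|\leq\varphi$ a.e. Such a map, and likewise any Lipschitz $q$-valued map, $w=\sum_i[\![w_i]\!]$ has an approximate differential $Dw=\sum_i[\![Dw_i]\!]$, $Dw_i(x)\in\mathbb{R}^{n\times m}$: for a.e. $x_0$, $\mathcal{G}\big(w(x),\sum_i[\![w_i(x_0)+Dw_i(x_0)\cdot(x-x_0)]\!]\big)=o(|x-x_0|)$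 as $x\to x_0$ in a set with density one at $x_0$, and $Dw_i(x_0)=Dw_j(x_0)$ if $w_i(x_0)=w_j(x_0)$. **Quadratic integrands and semiellipticity (Mattila).** $\langle\cdot,\cdot\rangle$ is the Euclidean inner product on $\mathbb{R}^{n\times m}$. The quadratic integrand associated with $A$ gives the energy $E(u)=\int\sum_i\langle A\,Du_i,Du_i\rangle$. It is $Q$-semielliptic if $$\int_{\mathbb{R}^m}\sum_{i=1}^Q\langle A\,Df_i,Df_i\rangle\geq0$$ for every Lipschitz $f=\sum_i[\![f_i]\!]:\mathbb{R}^m\to\mathcal{A}_Q(\mathbb{R}^n)$ with compact support (i.e. $f=Q[\![0]\!]$ outside a compact set). **Quasiconvexity.** A measurable $f:(\mathbb{R}^n)^Q\times(\mathbb{R}^{n\times m})^Q\to\mathbb{R}$ is a $Q$-integrand if it is invariant under simultaneous permutation of $(a_1,\dots,a_Q)$ and $(A_1,\dots,A_Q)$. A locally bounded $Q$-integrand $f$ is quasiconvex if the following holds for every affine $Q$-valued function $u(x)=\sum_{j=1}^Jq_j[\![a_j+L_j\cdot x]\!]$ with $a_j\in\mathbb{R}^n$, $a_i\neq a_j$ for $i\neq j$, $L_j\in\mathbb{R}^{n\times m}$, $q_j\geq1$ integers, $\sum_jq_j=Q$: for any maps $w^j\in W^{1,\infty}(C_1,\mathcal{A}_{q_j}(\mathbb{R}^n))$ with $w^j|_{\partial C_1}=q_j[\![a_j+L_j\cdot x]\!]|_{\partial C_1}$, $j=1,\dots,J$, $$f(u(0),Du(0))\leq\int_{C_1}f\big(\underbrace{a_1,\dots,a_1}_{q_1},\dots,\underbrace{a_J,\dots,a_J}_{q_J},Dw^1(x),\dots,Dw^J(x)\big)\,dx,$$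 where $f(u(0),Du(0))$ means $f$ evaluated with each $a_j$ and each $L_j$ repeated $q_j$ times, and $Dw^j(x)$ stands for the list $Dw^j_1(x),\dots,Dw^j_{q_j}(x)$. *)

(* Defs.v *)
From HB Require Import structures.
From mathcomp Require Import all_boot all_order all_algebra all_fingroup.
From mathcomp Require Import generic_quotient.
From mathcomp Require Import all_classical all_reals all_analysis.

Set Implicit Arguments.
Unset Strict Implicit.
Unset Printing Implicit Defensive.

Import Order.TTheory GRing.Theory Num.Theory.
Import numFieldNormedType.Exports.

Local Open Scope classical_set_scope.
Local Open Scope ring_scope.

(* Points of R^m are column vectors 'cV[R]_m.  The library norm on matrices is
   the sup norm, hence the explicit Euclidean one; the two induce the same
   topology. *)

Definition mdot (R : realType) (n m : nat) (M N : 'M[R]_(n, m)) : R :=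
  \sum_i \sum_j M i j * N i j.

Definition enorm (R : realType) (n m : nat) (M : 'M[R]_(n, m)) : R :=
  Num.sqrt (mdot M M).

Definition eball (R : realType) (m : nat) (x : 'cV[R]_m) (r : R) :
  set 'cV[R]_m := [set y | enorm (y - x) < r].

Definition box (R : realType) (m : nat) (a b : 'cV[R]_m) : set 'cV[R]_m :=
  [set x | forall i, a i 0 <= x i 0 <= b i 0].

Definition box_volume (R : realType) (m : nat) (a b : 'cV[R]_m) : R :=
  \prod_i Num.max 0 (b i 0 - a i 0).

(* Lebesgue measure on R^m: the outer measure of X is the infimum of the total
   volumes of the countable (possibly finite) covers of X by closed boxes, and
   the measurable sets are the Caratheodory measurable ones, so that the
   measure is complete. *)

Section lebesgue_outer.
Local Open Scope ereal_scope.
Context (R : realType) (m : nat).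
Implicit Types (X : set 'cV[R]_m) (P : pred nat) (a b : nat -> 'cV[R]_m).

Definition box_cover X P a b : Prop :=
  X `<=` \bigcup_(k in [set k | P k]) box (a k) (b k).

Definition lebesgue_outer (X : set 'cV[R]_m) : \bar R :=
  ereal_inf [set s | exists P a b, box_cover X P a b /\
    s = \sum_(0 <= k <oo | P k) (box_volume (a k) (b k))%:E].

Lemma box_volume_ge0 (a b : 'cV[R]_m) : 0 <= (box_volume a b)%:E.
Proof. by rewrite lee_fin prodr_ge0// => i _; rewrite le_max lexx. Qed.

Lemma lebesgue_outer_ge0 X : 0 <= lebesgue_outer X.
Proof.
apply: le_ereal_inf_tmp => _ [P [a [b [_ ->]]]].
by apply: nneseries_ge0 => k _ _; exact: box_volume_ge0.
Qed.

Lemma lebesgue_outer0 : lebesgue_outer set0 = 0.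
Proof.
apply/eqP; rewrite eq_le lebesgue_outer_ge0 andbT.
apply: ereal_inf_lbound; exists xpred0, (fun=> 0%R), (fun=> 0%R); split=> //.
by rewrite eseries_pred0.
Qed.

Lemma le_lebesgue_outer : {homo lebesgue_outer : X Y / X `<=` Y >-> X <= Y}.
Proof.
move=> X Y XY; apply/ereal_inf_le_tmp => _ [P [a [b [cY ->]]]].
by exists P, a, b; split=> //; exact: subset_trans cY.
Qed.

Lemma lebesgue_outer_sigma_subadditive : sigma_subadditive lebesgue_outer.
Proof.
move=> X; have [[i ioo]|] := pselect (exists i, lebesgue_outer (X i) = +oo).
  rewrite (eseries_pinfty _ _ ioo) ?leey// => n _.
  by rewrite -ltNye (lt_le_trans _ (lebesgue_outer_ge0 _)).
rewrite -forallNE => Xoo; apply/lee_addgt0Pr => _/posnumP[e].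
rewrite (le_trans _ (epsilon_trick _ _ _))//; last first.
  by move=> n; exact: lebesgue_outer_ge0.
pose good n (t : pred nat * ((nat -> 'cV[R]_m) * (nat -> 'cV[R]_m))) :=
  box_cover (X n) t.1 t.2.1 t.2.2 /\
  \sum_(0 <= k <oo | t.1 k) (box_volume (t.2.1 k) (t.2.2 k))%:E
    <= lebesgue_outer (X n) + (e%:num / (2 ^ n.+1)%:R)%:E.
have [G PG] : {G & forall n, good n (G n)}.
  apply: (@choice _ _ good) => n.
  have en : (0 < e%:num / (2 ^ n.+1)%:R :> R)%R by [].
  have fin : lebesgue_outer (X n) \is a fin_num.
    rewrite ge0_fin_numE ?lebesgue_outer_ge0// ltey; exact/eqP/Xoo.
  have [_ [P [a [b [cX ->]]]] /ltW lts] := lb_ereal_inf_adherent en fin.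
  by exists (P, (a, b)).
pose vol (t : nat * nat) : \bar R :=
  if (G t.1).1 t.2 then (box_volume ((G t.1).2.1 t.2) ((G t.1).2.2 t.2))%:E
  else 0.
have vol_ge0 t : 0 <= vol t.
  by rewrite /vol; case: ifP => // _; exact: box_volume_ge0.
apply: (@le_trans _ _ (\esum_(t in setT) vol t)).
  have /card_esym/ppcard_eqP[f] := card_nat2.
  have -> : \esum_(t in setT) vol t =
      \sum_(0 <= k <oo | (G (f k).1).1 (f k).2)
        (box_volume ((G (f k).1).2.1 (f k).2) ((G (f k).1).2.2 (f k).2))%:E.
    rewrite eseries_mkcond (reindex_esum setT setT f)//.
    by rewrite -nneseries_esumT.
  apply: ereal_inf_lbound; exists (fun k => (G (f k).1).1 (f k).2),
    (fun k => (G (f k).1).2.1 (f k).2), (fun k => (G (f k).1).2.2 (f k).2).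
  split=> // x [n _ /(PG n).1[k Pk kx]].
  by exists (f^-1%FUN (n, k)); rewrite /= invK ?inE.
rewrite (_ : esum _ _ = \sum_(0 <= n <oo) \sum_(0 <= k <oo) vol (n, k)).
  apply: lee_nneseries => [n _ _|n _]; first exact: nneseries_ge0.
  by have [_] := PG n; rewrite eseries_mkcond.
rewrite (_ : setT = setT `*`` (fun=> setT)); last first.
  by apply/seteqP; split=> // -[].
rewrite -(@esum_esum _ _ _ setT (fun=> setT) (fun i j => vol (i, j)))//.
rewrite nneseries_esumT; last by move=> n; exact: nneseries_ge0.
by apply: eq_esum => n _; rewrite nneseries_esumT.
Qed.

HB.instance Definition _ := isOuterMeasure.Build R 'cV[R]_m lebesgue_outer
  lebesgue_outer0 lebesgue_outer_ge0 le_lebesgue_outer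
  lebesgue_outer_sigma_subadditive.

End lebesgue_outer.

(* R^m equipped with the sigma-algebra of Lebesgue measurable sets *)
Notation euclid R m := (caratheodory_type (@lebesgue_outer R m)).

Definition leb (R : realType) (m : nat) : set (euclid R m) -> \bar R :=
  @lebesgue_outer R m.
HB.instance Definition _ (R : realType) (m : nat) := isMeasure.Build _ _ _
  (@leb R m) (caratheodory_measure0 _) (@caratheodory_measure_ge0 _ _ _)
  (@caratheodory_measure_sigma_additive _ _ _).
Arguments leb {R m}.

(* A_q(R^n): a Q-point is a list of q points up to permutation. *)

Section qpoints.
Context (R : realType) (q n : nat).

Definition qpoint_rel (P S : q.-tuple 'cV[R]_n) : bool := perm_eq P S.

Lemma qpoint_rel_equiv : equiv_class_of qpoint_rel.
Proof.
split; [exact: perm_refl | exact: perm_sym | exact: perm_trans].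
Qed.

Canonical qpoint_equiv := EquivRelPack qpoint_rel_equiv.

Definition qpoint : Type := {eq_quot qpoint_equiv}%qT.

(* \sum_i [[P_i]] *)
Definition dirac_sum (P : 'I_q -> 'cV[R]_n) : qpoint :=
  (\pi_({eq_quot qpoint_equiv}) [tuple P i | i < q])%qT.

Definition qpoint_pts (T : qpoint) : 'I_q -> 'cV[R]_n :=
  tnth (repr (T : {eq_quot qpoint_equiv}%qT)).

Definition matching_cost (T S : qpoint) (s : 'S_q) : R :=
  Num.sqrt (\sum_i enorm (qpoint_pts T i - qpoint_pts S (s i)) ^+ 2).

(* the metric G; the initial value of the iterated minimum is itself one of
   the costs *)
Definition qdist (T S : qpoint) : R :=
  \big[Num.min/matching_cost T S 1%g]_(s : 'S_q) matching_cost T S s.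

Definition qopen (U : set qpoint) : Prop :=
  forall T, U T -> exists2 r, 0 < r & forall S, qdist T S < r -> U S.

End qpoints.

(* The unit cube C_1 and scalar Sobolev functions on it *)

Definition cube (R : realType) (m : nat) : set 'cV[R]_m :=
  box (const_mx (- 2^-1)) (const_mx 2^-1).
Arguments cube {R m}.

Section scalar_sobolev.
Context (R : realType) (m : nat).
Implicit Types (g phi : 'cV[R]_m -> R) (Dg : 'cV[R]_m -> 'cV[R]_m).

Definition partial (i : 'I_m) phi : 'cV[R]_m -> R :=
  fun x => 'D_(delta_mx i 0) phi x.

Fixpoint of_class_C (k : nat) phi : Prop :=
  continuous phi /\
  if k is k'.+1 then
    forall i : 'I_m, (forall x, derivable phi x (delta_mx i 0)) /\
                     of_class_C k' (partial i phi)
  else True.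

(* phi is in C_c^oo(U) *)
Definition test_function (U : set 'cV[R]_m) phi : Prop :=
  (forall k, of_class_C k phi) /\
  exists K, [/\ compact K, K `<=` U & forall x, ~ K x -> phi x = 0].

Definition Linfty_cube g : Prop :=
  measurable_fun (cube : set (euclid R m)) (g : euclid R m -> R) /\
  exists M : R, \forall x \ae leb, cube x -> `|g x| <= M.

Definition weak_gradient g Dg : Prop :=
  forall phi, test_function (interior cube) phi -> forall i,
    (\int[leb]_(x in (cube : set (euclid R m))) (g x * partial i phi x)%:E =
     - \int[leb]_(x in (cube : set (euclid R m))) (Dg x i 0 * phi x)%:E)%E.

(* g is in W^{1,oo}(C_1), with weak gradient Dg *)
Definition sobolev_real g Dg : Prop :=
  [/\ Linfty_cube g, forall i, Linfty_cube (fun x => Dg x i 0)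
    & weak_gradient g Dg].

End scalar_sobolev.

Section qvalued.
Context (R : realType) (m q n : nat).
Implicit Types (w u : 'cV[R]_m -> qpoint R q n).

(* w is in W^{1,oo}(C_1, A_q); only the values of w on C_1 matter *)
Definition sobolev_q w : Prop :=
  (forall U, qopen U ->
     measurable (cube `&` w @^-1` U : set (euclid R m))) /\
  exists phi : 'cV[R]_m -> R,
    [/\ Linfty_cube phi, forall x, cube x -> 0 <= phi x
      & forall T, exists Dg : 'cV[R]_m -> 'cV[R]_m,
          sobolev_real (fun x => qdist (w x) T) Dg /\
          \forall x \ae leb, cube x -> enorm (Dg x) <= phi x].

(* w = u on the boundary of C_1.  Elements of W^{1,oo} are determined up to
   null sets only, and the boundary is a null set: as usual, the values on the
   boundary are those of the continuous representative. *)
Definition cube_boundary_values w u : Prop :=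
  exists v : 'cV[R]_m -> qpoint R q n,
    [/\ forall x, cube x -> forall e, 0 < e ->
          \forall y \near within cube (nbhs x), qdist (v y) (v x) < e,
        \forall x \ae leb, cube x -> v x = w x
      & forall x, (cube `\` interior cube) x -> v x = u x].

Definition lipschitz_q w : Prop :=
  exists L : R, forall x y, qdist (w x) (w y) <= L * enorm (x - y).

(* w = q[[0]] outside a compact set *)
Definition compactly_supported w : Prop :=
  exists K, compact K /\ forall x, ~ K x -> w x = dirac_sum (fun=> 0).

Definition density_one (E : set 'cV[R]_m) (x : 'cV[R]_m) : Prop :=
  measurable (E : set (euclid R m)) /\
  (fine (leb (E `&` eball x r)) / fine (leb (eball x r))) @[r --> 0^'+]
    --> (1 : R).

(* w = \sum_i [[wi_i]] on D, and \sum_i [[Dwi_i]] is its approximate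
   differential at almost every point of D *)
Definition approx_differential (D : set 'cV[R]_m) w
    (wi : 'I_q -> 'cV[R]_m -> 'cV[R]_n)
    (Dwi : 'I_q -> 'cV[R]_m -> 'M[R]_(n, m)) : Prop :=
  (forall x, D x -> w x = dirac_sum (fun i => wi i x)) /\
  \forall x0 \ae leb, D x0 ->
    (exists E : set 'cV[R]_m,
       [/\ E `<=` D, density_one E x0
         & forall e, 0 < e -> \forall x \near within E (nbhs x0),
             qdist (w x)
                   (dirac_sum (fun i => wi i x0 + Dwi i x0 *m (x - x0)))
               <= e * enorm (x - x0)]) /\
    (forall i j, wi i x0 = wi j x0 -> Dwi i x0 = Dwi j x0).

End qvalued.

Section integrands.
Context (R : realType) (m n Q : nat).

Implicit Type A : 'M[R]_(n, m) -> 'M[R]_(n, m).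

Definition symmetric_map A : Prop :=
  forall M N, mdot (A M) N = mdot M (A N).

(* The energy does not depend on the choice of the approximate differential:
   the latter is unique almost everywhere, up to permutation. *)
Definition semielliptic A : Prop :=
  forall (f : 'cV[R]_m -> qpoint R Q n) fi Dfi,
    lipschitz_q f -> compactly_supported f ->
    approx_differential setT f fi Dfi ->
    (0 <= \int[leb]_(x in [set: euclid R m])
            (\sum_i mdot (A (Dfi i x)) (Dfi i x))%:E)%E.

Definition integrand : Type :=
  ('I_Q -> 'cV[R]_n) -> ('I_Q -> 'M[R]_(n, m)) -> R.

Implicit Type f : integrand.

Definition quadratic_integrand A : integrand :=
  fun _ M => \sum_i mdot (A (M i)) (M i).

(* (R^n)^Q x (R^{n x m})^Q with the product topology *)
Definition arguments : topologicalType :=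
  ({ptws 'I_Q -> 'cV[R]_n} * {ptws 'I_Q -> 'M[R]_(n, m)})%type.

Definition uncurried f (p : arguments) : R := f p.1 p.2.

Definition Q_integrand f : Prop :=
  (forall B : set R, measurable B -> <<s open >> (uncurried f @^-1` B)) /\
  (forall (s : 'S_Q) a M, f (a \o s) (M \o s) = f a M).

Definition locally_bounded f : Prop :=
  forall p : arguments, exists C : R, \forall p' \near nbhs p, `|uncurried f p'| <= C.

(* The Q slots are cut into J consecutive blocks of lengths q_1, .., q_J: slot
   i is slot number tagnat.sig2 i of the block tagnat.sig1 i. *)
Definition quasiconvex f : Prop :=
  [/\ Q_integrand f, locally_bounded f &
  forall (J : nat) (q : 'I_J -> nat) (a : 'I_J -> 'cV[R]_n)
      (L : 'I_J -> 'M[R]_(n, m)) (eQ : Q = (\sum_j q j)%N),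
    (forall j, (1 <= q j)%N) -> injective a ->
  forall (w : forall j, 'cV[R]_m -> qpoint R (q j) n)
      (wi : forall j, 'I_(q j) -> 'cV[R]_m -> 'cV[R]_n)
      (Dwi : forall j, 'I_(q j) -> 'cV[R]_m -> 'M[R]_(n, m)),
    (forall j, sobolev_q (w j)) ->
    (forall j, cube_boundary_values (w j)
                 (fun x => dirac_sum (fun=> a j + L j *m x))) ->
    (forall j, approx_differential cube (w j) (@wi j) (@Dwi j)) ->
  let block i := tagnat.sig1 (cast_ord eQ i) in
  let slot i := tagnat.sig2 (cast_ord eQ i) in
  ((f (fun i => a (block i)) (fun i => L (block i)))%:E <=
   \int[leb]_(x in (cube : set (euclid R m)))
     (f (fun i => a (block i)) (fun i => Dwi (block i) (slot i) x))%:E)%E].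

End integrands.

(* Main.v *)
Require Import Defs.
From mathcomp Require Import all_boot all_order all_algebra all_fingroup.
From mathcomp Require Import generic_quotient.
From mathcomp Require Import all_classical all_reals all_analysis.
From mathcomp Require Import measurable_realfun.
From mathcomp Require Import ring lra.

(** Write u for the affine map with values sum_j q_j [[a_j + L_j x]].

    From quasiconvexity to semiellipticity (quasiconvex_semielliptic), a
    compactly supported Lipschitz map is scaled into the unit cube and competes
    there with u = Q[[0]], whose energy vanishes. It has to be shown that a
    Lipschitz Q-valued map that is differentiable almost everywhere belongs to
    the Sobolev space (lipschitz_sobolev), and that its energy density is
    measurable although its sheets need not be: the density is the limit of
    infima of difference quotients over all matchings of the sheets
    (dq_energy_cvg, measurable_energy).

    Conversely, let w^j be a competitor in the j-th block. Its traces being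
    Lipschitz (trace_lipschitz), subtracting the boundary values a_j + L_j x
    from all sheets and extending by zero gives a compactly supported Lipschitz
    map f with q_j sheets (boundary_extension). A Q-semielliptic form is
    q_j-semielliptic for q_j <= Q, as one sees by adding zero sheets
    (semielliptic_fewer), so that the energy of f is nonnegative. The energy
    density of w^j is

      sum_i <A Df_i, Df_i> + 2 <A L_j, sum_i Df_i> + q_j <A L_j, L_j>,

    and the middle term integrates to zero because the sum of the sheets of f
    is a Lipschitz function with compact support (sum_differential). Hence the
    energy of w^j is at least that of the boundary values, and the inequalities
    for the blocks are added up (block_inequality, semielliptic_quasiconvex).
    The integrand does not depend on the points a_j, which is what uncouples
    the blocks.

    Two steps carry most of the analysis. A function on the cube with bounded
    weak gradient is Lipschitz (tube_estimate, coordinate_lipschitz): the weak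
    gradient is tested against a function whose derivative is the difference of
    two bumps. And the differential of a sheet vanishes at almost every point
    where the sheet meets the origin (zero_sheet_flat), which the definition of
    the approximate differential demands of the map with added zero sheets: the
    exceptional points are isolated along an axis, and infinitely many
    translates of such a set are disjoint. *)

Set Implicit Arguments.
Unset Strict Implicit.
Unset Printing Implicit Defensive.

Import Order.TTheory GRing.Theory Num.Theory.
Import numFieldNormedType.Exports.

Local Open Scope classical_set_scope.
Local Open Scope ring_scope.

(** * Euclidean norm *)

Lemma ler_sum_const (R : realType) (q : nat) (F : 'I_q -> R) c :
  (forall i, F i <= c) -> \sum_i F i <= q%:R * c.
Proof.
move=> Fc; rewrite (@le_trans _ _ (\sum_(i < q) c)) ?ler_sum //.
by rewrite sumr_const card_ord mulr_natl.
Qed.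

Section euclidean_norm.
Context (R : realType) (n m : nat).
Implicit Types M N P : 'M[R]_(n, m).

Lemma mdotC M N : mdot M N = mdot N M.
Proof. by apply: eq_bigr => i _; apply: eq_bigr => j _; rewrite mulrC. Qed.

Lemma mdotDl M N P : mdot (M + N) P = mdot M P + mdot N P.
Proof.
rewrite -big_split; apply: eq_bigr => i _ /=.
by rewrite -big_split; apply: eq_bigr => j _ /=; rewrite mxE mulrDl.
Qed.

Lemma mdotZl (a : R) M N : mdot (a *: M) N = a * mdot M N.
Proof.
rewrite mulr_sumr; apply: eq_bigr => i _.
by rewrite mulr_sumr; apply: eq_bigr => j _; rewrite mxE mulrA.
Qed.

Lemma mdotNl M N : mdot (- M) N = - mdot M N.
Proof. by rewrite -scaleN1r mdotZl mulN1r. Qed.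

Lemma mdotBl M N P : mdot (M - N) P = mdot M P - mdot N P.
Proof. by rewrite mdotDl mdotNl. Qed.

Lemma mdotDr M N P : mdot M (N + P) = mdot M N + mdot M P.
Proof. by rewrite mdotC mdotDl !(mdotC M). Qed.

Lemma mdotZr (a : R) M N : mdot M (a *: N) = a * mdot M N.
Proof. by rewrite mdotC mdotZl mdotC. Qed.

Lemma mdotNr M N : mdot M (- N) = - mdot M N.
Proof. by rewrite mdotC mdotNl mdotC. Qed.

Lemma mdotBr M N P : mdot M (N - P) = mdot M N - mdot M P.
Proof. by rewrite mdotDr mdotNr. Qed.

Lemma mdot_ge0 M : 0 <= mdot M M.
Proof. by apply: sumr_ge0 => i _; apply: sumr_ge0 => j _; rewrite -expr2 sqr_ge0. Qed.

Lemma enorm_ge0 M : 0 <= enorm M. Proof. exact: sqrtr_ge0. Qed.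

Lemma sqr_enorm M : enorm M ^+ 2 = mdot M M.
Proof. by rewrite sqr_sqrtr // mdot_ge0. Qed.

Lemma enorm_entry M i j : `|M i j| <= enorm M.
Proof.
rewrite -(@ler_pXn2r _ 2) ?nnegrE ?enorm_ge0 // sqr_enorm real_normK ?num_real //.
rewrite /mdot (bigD1 i) //= (bigD1 j) //= -expr2 -addrA lerDl addr_ge0 //.
  by apply: sumr_ge0 => k _; rewrite -expr2 sqr_ge0.
apply: sumr_ge0 => k _; apply: sumr_ge0 => l _; by rewrite -expr2 sqr_ge0.
Qed.

Lemma enorm0 : enorm (0 : 'M[R]_(n, m)) = 0.
Proof. by rewrite /enorm -(scale0r 0) mdotZl mul0r sqrtr0. Qed.

Lemma enorm_eq0 M : enorm M = 0 -> M = 0.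
Proof.
move=> M0; apply/matrixP => i j; rewrite mxE; apply/eqP.
by rewrite -normr_eq0 eq_le normr_ge0 andbT -M0 enorm_entry.
Qed.

Lemma enormZ (a : R) M : enorm (a *: M) = `|a| * enorm M.
Proof. by rewrite /enorm mdotZl mdotZr mulrA -expr2 sqrtrM ?sqr_ge0 // sqrtr_sqr. Qed.

Lemma enormN M : enorm (- M) = enorm M.
Proof. by rewrite -scaleN1r enormZ normrN1 mul1r. Qed.

Lemma enorm_distC M N : enorm (M - N) = enorm (N - M).
Proof. by rewrite -enormN opprB. Qed.

Lemma cauchy_schwarz M N : mdot M N <= enorm M * enorm N.
Proof.
have [M0|M0] := eqVneq (enorm M) 0.
  by rewrite (enorm_eq0 M0) enorm0 mul0r -(scale0r 0) mdotZl mul0r.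
have [N0|N0] := eqVneq (enorm N) 0.
  by rewrite (enorm_eq0 N0) enorm0 mulr0 -(scale0r 0) mdotZr mul0r.
have := mdot_ge0 (enorm N *: M - enorm M *: N).
rewrite mdotBl !mdotBr !mdotZl !mdotZr -!sqr_enorm (mdotC N M).
have ab : 0 < enorm M * enorm N by rewrite mulr_gt0 // lt_neqAle eq_sym ?M0 ?N0 enorm_ge0.
set a := enorm M in ab *; set b := enorm N in ab *; set c := mdot M N => H.
have : 0 <= (a * b) * (a * b - c) by lra.
by rewrite pmulr_rge0 // subr_ge0.
Qed.

Lemma abs_mdot_le M N : `|mdot M N| <= enorm M * enorm N.
Proof.
rewrite ler_norml cauchy_schwarz andbT lerNl -mdotNl.
by rewrite (le_trans (cauchy_schwarz _ _)) // enormN.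
Qed.

Lemma enormD M N : enorm (M + N) <= enorm M + enorm N.
Proof.
rewrite -(@ler_pXn2r _ 2) ?nnegrE ?addr_ge0 ?enorm_ge0 //.
rewrite sqr_enorm mdotDl !mdotDr (mdotC N M) sqrrD -!sqr_enorm.
have := cauchy_schwarz M N; lra.
Qed.

Lemma enormB M N : enorm (M - N) <= enorm M + enorm N.
Proof. by rewrite -(enormN N) enormD. Qed.

Lemma enorm_dist_triangle M N P : enorm (M - P) <= enorm (M - N) + enorm (N - P).
Proof. by rewrite (le_trans _ (enormD _ _)) // addrA subrK. Qed.

Lemma enorm_sum (I : Type) (r : seq I) (Q : pred I) (F : I -> 'M[R]_(n, m)) :
  enorm (\sum_(i <- r | Q i) F i) <= \sum_(i <- r | Q i) enorm (F i).
Proof.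
elim/big_ind2 : _ => //; first by rewrite enorm0.
by move=> x a y b xa yb; rewrite (le_trans (enormD _ _)) // lerD.
Qed.

Lemma enorm_le_sum M : enorm M <= \sum_i \sum_j `|M i j|.
Proof.
rewrite -(@ler_pXn2r _ 2) ?nnegrE ?enorm_ge0 //; last first.
  by apply: sumr_ge0 => i _; apply: sumr_ge0.
have e i j : M i j * M i j = `|M i j| * `|M i j| by rewrite -!expr2 real_normK ?num_real.
rewrite sqr_enorm expr2 mulr_suml; apply: ler_sum => i _.
rewrite mulr_suml; apply: ler_sum => j _; rewrite e ler_wpM2l //.
rewrite (bigD1 i) //= (bigD1 j) //= -addrA lerDl addr_ge0 //; first exact: sumr_ge0.
by apply: sumr_ge0 => k _; apply: sumr_ge0.
Qed.

Lemma le_mx_norm_enorm M : `|M| <= enorm M.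
Proof.
rewrite -[leLHS]/(mx_norm M) mx_normrE; apply: bigmax_le; first exact: enorm_ge0.
by move=> i _; exact: enorm_entry.
Qed.

Lemma mx_norm_entry M i j : `|M i j| <= `|M|.
Proof.
rewrite -[leRHS]/(mx_norm M) mx_normrE.
by apply: (@le_bigmax _ _ _ 0 (fun ij => `|M ij.1 ij.2|) (i, j)).
Qed.

Lemma enorm_le_mx_norm M : enorm M <= (n * m)%:R * `|M|.
Proof.
rewrite (le_trans (enorm_le_sum M)) // (@le_trans _ _ (\sum_(i < n) \sum_(j < m) `|M|)) //.
  by apply: ler_sum => i _; apply: ler_sum => j _; exact: mx_norm_entry.
by rewrite !sumr_const !card_ord mulr_natl -mulrnA mulnC.
Qed.

Lemma nbhs_eballP M (A : set 'M[R]_(n, m)) :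
  nbhs M A <-> exists2 r, 0 < r & forall N, enorm (N - M) < r -> A N.
Proof.
split=> [/nbhs_ballP[r /= r0 MA]|[r r0 MA]].
  exists r => // N Nr; apply: MA; rewrite -ball_normE /ball_/=.
  by rewrite (le_lt_trans (le_mx_norm_enorm _)) // enorm_distC.
apply/nbhs_ballP; exists (r / (n * m).+1%:R) => /=; first by rewrite divr_gt0.
move=> N; rewrite -ball_normE /ball_/= ltr_pdivlMr // => Nr; apply: MA.
rewrite enorm_distC (le_lt_trans (enorm_le_mx_norm _)) // (le_lt_trans _ Nr) //.
by rewrite mulrC ler_wpM2l // ler_nat.
Qed.

End euclidean_norm.

Lemma enorm_mulmx (R : realType) (n m p : nat) (M : 'M[R]_(n, m)) (x : 'M[R]_(m, p)) :
  enorm (M *m x) <= (n * p)%:R * (m%:R * (enorm M * enorm x)).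
Proof.
apply: (le_trans (enorm_le_mx_norm _)); apply: ler_wpM2l => //.
rewrite -[leLHS]/(mx_norm (M *m x)) mx_normrE; apply: bigmax_le.
  by rewrite !mulr_ge0 ?enorm_ge0.
move=> [i j] _; rewrite mxE (le_trans (ler_norm_sum _ _ _)) //.
apply: ler_sum_const => k.
by rewrite normrM ler_pM ?enorm_entry.
Qed.

Section family_norm.
Context (R : realType) (q n : nat).
Implicit Types P S : 'I_q -> 'cV[R]_n.

(** The Euclidean norm of a q-tuple of vectors, viewed as a single matrix. *)
Definition fnorm P : R := enorm (\matrix_(k, i) P i k 0).

Lemma sqr_fnorm P : fnorm P ^+ 2 = \sum_i enorm (P i) ^+ 2.
Proof.
rewrite /fnorm sqr_enorm /mdot exchange_big; apply: eq_bigr => i _.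
rewrite sqr_enorm /mdot; apply: eq_bigr => k _.
by rewrite big_ord_recl big_ord0 addr0 !mxE.
Qed.

Lemma fnormE P : fnorm P = Num.sqrt (\sum_i enorm (P i) ^+ 2).
Proof. by rewrite -sqr_fnorm sqrtr_sqr ger0_norm // enorm_ge0. Qed.

Lemma fnorm_ge0 P : 0 <= fnorm P. Proof. exact: enorm_ge0. Qed.

Lemma fnorm0 : fnorm (fun=> 0) = 0.
Proof. by rewrite /fnorm -[RHS](@enorm0 R n q); congr enorm; apply/matrixP => i j; rewrite !mxE. Qed.

Lemma fnormD P S : fnorm (fun i => P i + S i) <= fnorm P + fnorm S.
Proof.
rewrite (le_trans _ (enormD _ _)) // /fnorm le_eqVlt; apply/orP; left; apply/eqP.
by congr enorm; apply/matrixP => i j; rewrite !mxE.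
Qed.

Lemma fnorm_distC P S : fnorm (fun i => P i - S i) = fnorm (fun i => S i - P i).
Proof. by rewrite !fnormE; congr Num.sqrt; apply: eq_bigr => i _; rewrite enorm_distC. Qed.

Lemma fnorm_dist_triangle P S U :
  fnorm (fun i => P i - U i) <= fnorm (fun i => P i - S i) + fnorm (fun i => S i - U i).
Proof.
rewrite (le_trans _ (fnormD _ _)) // le_eqVlt; apply/orP; left; apply/eqP.
by congr fnorm; apply/funext => i; rewrite addrA subrK.
Qed.

Lemma fnorm_perm P (s : 'S_q) : fnorm (P \o s) = fnorm P.
Proof.
rewrite !fnormE; congr Num.sqrt.
by rewrite [RHS](reindex_inj (@perm_inj _ s)).
Qed.

Lemma enorm_le_fnorm P i : enorm (P i) <= fnorm P.
Proof.
rewrite -(@ler_pXn2r _ 2) ?nnegrE ?enorm_ge0 ?fnorm_ge0 // sqr_fnorm.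
by rewrite (bigD1 i) //= lerDl; apply: sumr_ge0 => j _; rewrite exprn_ge0 // enorm_ge0.
Qed.

Lemma fnorm_le_sum P : fnorm P <= \sum_i enorm (P i).
Proof.
rewrite -(@ler_pXn2r _ 2) ?nnegrE ?fnorm_ge0 //; last first.
  by apply: sumr_ge0 => i _; exact: enorm_ge0.
rewrite sqr_fnorm expr2 mulr_suml; apply: ler_sum => i _.
rewrite expr2 ler_wpM2l ?enorm_ge0 // (bigD1 i) //= lerDl.
by apply: sumr_ge0 => j _; exact: enorm_ge0.
Qed.

Lemma fnorm_le_const P c : (forall i, enorm (P i) <= c) -> fnorm P <= q%:R * c.
Proof.
move=> Pc; by rewrite (le_trans (fnorm_le_sum P)) //; exact: ler_sum_const.
Qed.

End family_norm.

(** * The metric space of Q-points *)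

Section qpoints_metric.
Context (R : realType) (q n : nat).
Implicit Types (P S : 'I_q -> 'cV[R]_n) (T U : qpoint R q n).

Lemma dirac_sumP P S : dirac_sum P = dirac_sum S <-> exists s : 'S_q, forall i, P i = S (s i).
Proof.
have E (A B : q.-tuple 'cV[R]_n) : (\pi_({eq_quot (qpoint_equiv R q n)}) A =
    \pi_({eq_quot (qpoint_equiv R q n)}) B)%qT <-> perm_eq A B.
  by split=> [/eqmodP|H]; last exact/eqmodP.
rewrite /dirac_sum E; split=> [/tuple_permP[s /= H]|[s Ps]].
  exists s => i; have {}H : [tuple P i | i < q] = [tuple tnth [tuple S i | i < q] (s i) | i < q].
    exact: val_inj.
  have := congr1 (fun t => tnth t i) H.
  by rewrite !tnth_mktuple.
apply/tuple_permP; exists s; congr tval; apply: eq_from_tnth => i.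
by rewrite !tnth_mktuple.
Qed.

Lemma qpoint_ptsK T : dirac_sum (qpoint_pts T) = T.
Proof.
rewrite /dirac_sum /qpoint_pts (_ : [tuple _ | i < q] = repr T) ?reprK //.
by apply: eq_from_tnth => i; rewrite tnth_mktuple.
Qed.

Lemma qpoint_pts_dirac P : exists s : 'S_q, forall i, qpoint_pts (dirac_sum P) i = P (s i).
Proof. by apply/dirac_sumP; rewrite qpoint_ptsK. Qed.

Lemma dirac_sum_perm P (s : 'S_q) : dirac_sum (P \o s) = dirac_sum P.
Proof. by apply/dirac_sumP; exists s. Qed.

Lemma matching_costE T U (s : 'S_q) :
  matching_cost T U s = fnorm (fun i => qpoint_pts T i - qpoint_pts U (s i)).
Proof. by rewrite /matching_cost fnormE. Qed.

Lemma qdist_le_cost T U s : qdist T U <= matching_cost T U s.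
Proof. by rewrite /qdist; apply: bigmin_le_cond. Qed.

Lemma qdist_attained T U : exists s, qdist T U = matching_cost T U s.
Proof.
rewrite /qdist.
elim/big_ind : _ => [|x y [s ->] [t ->]|s _]; [by exists 1%g| |by exists s].
by rewrite minEle; case: ifP => _; [exists s|exists t].
Qed.

Lemma qdist_dirac_le P S : qdist (dirac_sum P) (dirac_sum S) <= fnorm (fun i => P i - S i).
Proof.
have [s Ps] := qpoint_pts_dirac P; have [t St] := qpoint_pts_dirac S.
rewrite (le_trans (qdist_le_cost _ _ (s * t^-1)%g)) // matching_costE.
rewrite (_ : (fun i => _) = (fun i => P i - S i) \o s) ?fnorm_perm //.
by apply/funext => i /=; rewrite Ps St permM permKV.
Qed.

(** An optimal matching transports the labelling P of one Q-point to a
    labelling of the other, and the distance becomes the norm of a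
    difference. *)
Lemma qdist_label P U : exists2 S, U = dirac_sum S &
  qdist (dirac_sum P) U = fnorm (fun i => P i - S i).
Proof.
have [s Ps] := qpoint_pts_dirac P; have [t E] := qdist_attained (dirac_sum P) U.
exists (qpoint_pts U \o (s^-1 * t)%g).
  by rewrite dirac_sum_perm qpoint_ptsK.
rewrite E matching_costE -[RHS](fnorm_perm _ s); congr fnorm.
by apply/funext => i /=; rewrite Ps permM permK.
Qed.

Lemma qdist_ge0 T U : 0 <= qdist T U.
Proof. by have [s ->] := qdist_attained T U; rewrite matching_costE fnorm_ge0. Qed.

Lemma qdistxx T : qdist T T = 0.
Proof.
apply/eqP; rewrite eq_le qdist_ge0 andbT -[T]qpoint_ptsK.
rewrite (le_trans (qdist_dirac_le _ _)) //.
by rewrite (_ : (fun i => _) = fun=> 0) ?fnorm0 //; apply/funext => i; rewrite subrr.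
Qed.

Lemma qdistC T U : qdist T U = qdist U T.
Proof.
suff H (A B : qpoint R q n) : qdist A B <= qdist B A by apply/eqP; rewrite eq_le !H.
rewrite -[B]qpoint_ptsK.
have [S -> ->] := qdist_label (qpoint_pts B) A.
by rewrite fnorm_distC qdist_dirac_le.
Qed.

Lemma qdist_triangle T U (V : qpoint R q n) : qdist T V <= qdist T U + qdist U V.
Proof.
rewrite -[T]qpoint_ptsK.
have [S -> ->] := qdist_label (qpoint_pts T) U.
have [S' -> ->] := qdist_label S V.
exact: le_trans (qdist_dirac_le _ _) (fnorm_dist_triangle _ _ _).
Qed.

Lemma qdist0_eq T U : qdist T U = 0 -> T = U.
Proof.
rewrite -[T]qpoint_ptsK; have [S -> ->] := qdist_label (qpoint_pts T) U => H.
congr dirac_sum; apply/funext => i; apply/eqP; rewrite -subr_eq0; apply/eqP/enorm_eq0.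
apply/eqP; rewrite eq_le enorm_ge0 andbT -H.
exact: (enorm_le_fnorm (fun i => qpoint_pts T i - S i)).
Qed.

Lemma qdist_lipl T U (V : qpoint R q n) : `|qdist T V - qdist U V| <= qdist T U.
Proof.
have H1 := qdist_triangle T U V; have H2 := qdist_triangle U T V.
rewrite (qdistC U T) in H2; rewrite ler_norml; apply/andP; split; lra.
Qed.

End qpoints_metric.

(** * Lebesgue measure of boxes *)

Section box_volumes.
Context (R : realType).

Definition vtail m (a : 'cV[R]_m.+1) : 'cV[R]_m := \col_i a (lift ord0 i) 0.
Definition vcons m (t : R) (y : 'cV[R]_m) : 'cV[R]_m.+1 :=
  \col_i (if unlift ord0 i is Some j then y j 0 else t).

Lemma box_vcons m (a b : 'cV[R]_m.+1) t y :
  box a b (vcons t y) <-> a ord0 0 <= t <= b ord0 0 /\ box (vtail a) (vtail b) y.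
Proof.
split=> [H|[H0 H] i].
  split; first by have := H ord0; rewrite mxE unlift_none.
  by move=> i; have := H (lift ord0 i); rewrite !mxE liftK.
by rewrite mxE; case: unliftP => [j|] -> //; have := H j; rewrite !mxE.
Qed.

Lemma box_volume_vtail m (a b : 'cV[R]_m.+1) :
  box_volume a b = Num.max 0 (b ord0 0 - a ord0 0) * box_volume (vtail a) (vtail b).
Proof.
rewrite /box_volume big_ord_recl; congr (_ * _).
by apply: eq_bigr => i _; rewrite !mxE.
Qed.

Lemma box_volume_nneg m (a b : 'cV[R]_m) : 0 <= box_volume a b.
Proof. by rewrite prodr_ge0 // => i _; rewrite le_max lexx. Qed.

Lemma lebesgue_itvcc (a b : R) :
  lebesgue_measure (`[a, b]%classic : set R) = (Num.max 0 (b - a))%:E.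
Proof.
rewrite lebesgue_measure_itv /= lte_fin; case: ltP => ab.
  by rewrite -EFinB max_r // subr_ge0 ltW.
by rewrite max_l // subr_le0.
Qed.

Local Open Scope ereal_scope.

(** Countable subadditivity of the volume, by induction on the dimension:
    the slices of the cover at height t cover the slice of the box, and the
    resulting inequality is integrated in t with one-dimensional Lebesgue
    measure. *)
Lemma box_volume_le_cover m (a b : 'cV[R]_m) (P : pred nat) (ak bk : nat -> 'cV[R]_m) :
  box_cover (box a b) P ak bk ->
  (box_volume a b)%:E <= \sum_(0 <= k <oo | P k) (box_volume (ak k) (bk k))%:E.
Proof.
elim: m => [|m IH] in a b P ak bk *; move=> cov.
  have [|k /= Pk _] := cov 0%R; first by move=> [].
  apply: le_trans (nneseries_lim_ge k.+1 _); last first.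
    by move=> j _ _; rewrite lee_fin box_volume_nneg.
  rewrite big_mkcond big_nat_recr//= Pk /box_volume !big_ord0 leeDr//.
  by apply: sume_ge0 => j _; case: ifP => // _; rewrite lee_fin big_ord0.
pose I : set R := `[a ord0 0%R, b ord0 0%R]%classic.
pose Ik k : set R := `[ak k ord0 0%R, bk k ord0 0%R]%classic.
pose v k := if P k then box_volume (vtail (ak k)) (vtail (bk k)) else 0%R.
have v0 k : (0 <= v k)%R by rewrite /v; case: ifP => // _; exact: box_volume_nneg.
have intE (c : R) (x y : R) : (0 <= c)%R ->
    \int[lebesgue_measure]_t (c * \1_(`[x, y]%classic : set R) t)%:E =
    (c * Num.max 0 (y - x))%:E.
  move=> c0; under eq_integral do rewrite EFinM.
  rewrite ge0_integralZl_EFin//; last first.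
    by apply/measurable_EFinP; apply: measurable_indic; exact: measurable_itv.
  by rewrite integral_indic// setIT EFinM; congr (_ * _)%E; exact: lebesgue_itvcc.
rewrite box_volume_vtail EFinM muleC -EFinM -intE ?box_volume_nneg//.
have -> : \sum_(0 <= k <oo | P k) (box_volume (ak k) (bk k))%:E =
    \int[lebesgue_measure]_t (\sum_(0 <= k <oo) (v k * \1_(Ik k) t)%:E).
  rewrite integral_nneseries//; last 2 first.
  - move=> k; apply/measurable_EFinP; apply: measurable_funM => //.
    by apply: measurable_indic; exact: measurable_itv.
  - by move=> k x _; rewrite lee_fin mulr_ge0.
  rewrite eseries_mkcond; apply: eq_eseriesr => k _; rewrite intE//.
  by rewrite /v box_volume_vtail; case: ifP => _; rewrite ?mul0r// mulrC.
apply: ge0_le_integral => //.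
- by move=> t _; rewrite lee_fin mulr_ge0// box_volume_nneg.
- by apply/measurable_EFinP; apply: measurable_funM.
- have H : measurable_fun setT (fun t : measurableTypeR R =>
      \sum_(0 <= k <oo | k \in xpredT) (v k * \1_(Ik k) t)%:E).
    apply: ge0_emeasurable_sum => [k x _ _|k _]; first by rewrite lee_fin mulr_ge0.
    apply/measurable_EFinP; apply: measurable_funM => //.
    by apply: measurable_indic; exact: measurable_itv.
  exact: H.
move=> t _; rewrite indicE; case: (boolP (t \in _)) => It; last first.
  by rewrite mulr0; apply: nneseries_ge0 => k _ _; rewrite lee_fin mulr_ge0.
rewrite mulr1 (le_trans (IH _ _ (fun k => P k && (t \in Ik k)) (fun k => vtail (ak k)) (fun k => vtail (bk k)) _))//.
  move=> y yab; have [|k /= Pk] := cov (vcons t y).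
    by apply/box_vcons; split=> //; move: It; rewrite inE /= in_itv.
  move=> /box_vcons[tk yk]; exists k => //=; rewrite Pk /=.
  by rewrite inE /Ik /= in_itv.
rewrite eseries_mkcond; apply: lee_nneseries => k _.
  by case: ifP => // _ _; rewrite lee_fin box_volume_nneg.
rewrite indicE /v; case: (P k) => /=; last by rewrite mul0r.
by case: (t \in _); rewrite ?mulr1 ?mulr0.
Qed.

Lemma lebesgue_outer_box m (a b : 'cV[R]_m) :
  lebesgue_outer (box a b) = (box_volume a b)%:E.
Proof.
apply/eqP; rewrite eq_le; apply/andP; split; last first.
  by apply: le_ereal_inf_tmp => _ [P [ak [bk [cov ->]]]]; exact: box_volume_le_cover.
apply: ereal_inf_lbound; exists (pred1 0%N), (fun=> a), (fun=> b); split.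
  by move=> x abx; exists 0%N.
rewrite eseries_mkcond nneseries_recl//=; last by move=> k; case: ifP => // _; rewrite lee_fin box_volume_nneg.
rewrite eseries0 ?adde0// => k k0 _.
by case: ifP k0 => // /eqP ->.
Qed.

End box_volumes.

(** * Measurability of open sets *)

Section measurable_open.
Context (R : realType) (m : nat).
Notation E := (euclid R m).
Implicit Types (a b x : 'cV[R]_m).

(** A coordinate half-space cuts every box of a cover into two boxes of the
    same total volume. *)
Lemma measurable_halfspace (i : 'I_m) (c : R) :
  measurable ([set x : 'cV[R]_m | x i 0 <= c] : set E).
Proof.
apply: (@le_caratheodory_measurable _ _ (@lebesgue_outer R m)) => X.
apply: le_ereal_inf_tmp => _ [P [a [b [cov ->]]]].
pose b' k : 'cV[R]_m := \col_j (if j == i then Num.min (b k j 0) c else b k j 0).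
pose a' k : 'cV[R]_m := \col_j (if j == i then Num.max (a k j 0) c else a k j 0).
apply: (@le_trans _ _ (\sum_(0 <= k <oo | P k) (box_volume (a k) (b' k))%:E +
                       \sum_(0 <= k <oo | P k) (box_volume (a' k) (b k))%:E))%E.
  apply: leeD; apply: ereal_inf_lbound.
    exists P, a, b'; split=> // x [Xx xc]; have [k Pk xk] := cov _ Xx.
    exists k => // j; rewrite !mxE; have := xk j; case: eqP => // -> /andP[-> /= ?].
    by rewrite le_min; apply/andP.
  exists P, a', b; split=> // x [Xx xc]; have [k Pk xk] := cov _ Xx.
  exists k => // j; rewrite !mxE; have := xk j; case: eqP => // -> /andP[? ->] /=.
  by rewrite andbT ge_max; apply/andP; split=> //; rewrite ltW // ltNge; exact/negP.
rewrite -nneseriesD; last 2 first.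
- by move=> k _ _; exact: box_volume_ge0.
- by move=> k _ _; exact: box_volume_ge0.
apply: lee_nneseries => [k _ _|k _].
  by rewrite -EFinD lee_fin addr_ge0 // box_volume_nneg.
rewrite -EFinD lee_fin /box_volume (bigD1 i) //= [X in _ + X](bigD1 i) //= [X in _ <= X](bigD1 i) //=.
rewrite !mxE !eqxx.
rewrite [X in _ * X + _](_ : _ = \prod_(j < m | j != i) Num.max 0 (b k j 0 - a k j 0)); last first.
  by apply: eq_bigr => j /negPf ji; rewrite !mxE ji.
rewrite [X in _ + _ * X](_ : _ = \prod_(j < m | j != i) Num.max 0 (b k j 0 - a k j 0)); last first.
  by apply: eq_bigr => j /negPf ji; rewrite !mxE ji.
rewrite -mulrDl ler_wpM2r //; first by apply: prodr_ge0 => j _; rewrite le_max lexx.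
by rewrite /Num.max /Num.min; do !case: ifPn; rewrite -?leNgt => *; lra.
Qed.

Lemma measurable_halfspace_ge (i : 'I_m) (c : R) :
  measurable ([set x : 'cV[R]_m | c <= x i 0] : set E).
Proof.
rewrite (_ : [set x | _] = \bigcap_k ~` ([set x : 'cV[R]_m | x i 0 <= c - k.+1%:R^-1] : set E)).
  by apply: bigcapT_measurable => k; apply: measurableC; exact: measurable_halfspace.
apply/seteqP; split=> x /= cx.
  by move=> k _; apply/negP; rewrite -ltNge; rewrite (lt_le_trans _ cx) // ltrBlDr ltrDl invr_gt0.
apply/ler_addgt0Pr => e e0.
have [k ke] : exists k, k.+1%:R^-1 < e.
  exists (Num.truncn e^-1); rewrite invf_plt ?posrE //; exact: truncnS_gt.
have /negP := cx k I; rewrite -ltNge => H.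
by move: ke H; set u := _^-1; lra.
Qed.

Lemma measurable_box a b : measurable (box a b : set E).
Proof.
suff H (s : seq 'I_m) : measurable
    ([set x : 'cV[R]_m | forall i, i \in s -> a i 0 <= x i 0 <= b i 0] : set E).
  rewrite (_ : box a b =
      [set x : 'cV[R]_m | forall i, i \in enum 'I_m -> a i 0 <= x i 0 <= b i 0]) //.
  by apply/seteqP; split=> x /= xab i; [move=> _|]; apply: xab; rewrite ?mem_enum.
elim: s => [|j s IH].
  by rewrite (_ : [set x | _] = setT) //; apply/seteqP; split.
rewrite (_ : [set x | _] = [set x : 'cV[R]_m | a j 0 <= x j 0] `&`
   [set x : 'cV[R]_m | x j 0 <= b j 0] `&`
   [set x : 'cV[R]_m | forall i, i \in s -> a i 0 <= x i 0 <= b i 0]).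
  apply: measurableI => //; apply: measurableI.
    exact: measurable_halfspace_ge.
  exact: measurable_halfspace.
apply/seteqP; split=> x /=.
  move=> H; have /andP[? ?] := H j (mem_head _ _); split=> // i si.
  by apply: H; rewrite inE si orbT.
by move=> [[H1 H2] H] i; rewrite inE => /orP[/eqP ->|/H //]; rewrite H1 H2.
Qed.

(** An open set is the countable union of the boxes with rational corners
    that it contains. *)
Lemma measurable_open (U : set 'cV[R]_m) : open U -> measurable (U : set E).
Proof.
move=> oU.
pose rbox (p : 'cV[rat]_m * 'cV[rat]_m) : set 'cV[R]_m := box (map_mx ratr p.1) (map_mx ratr p.2).
rewrite (_ : U = \bigcup_p (if `[< rbox p `<=` U >] then rbox p else set0)).
  apply: countable_bigcupT_measurable; first exact: countableP.
  by move=> p; case: ifP => // _; exact: measurable_box.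
apply/seteqP; split=> x; last first.
  by move=> [p _]; case: ifPn => // /asboolP; exact.
move=> Ux; have /nbhs_ballP[e /= e0 eU] : nbhs x U by exact: open_nbhs_nbhs.
have P (i : 'I_m) : exists p : rat * rat, [/\ x i 0 - e < ratr p.1, ratr p.1 <= x i 0,
   x i 0 <= ratr p.2 & ratr p.2 < x i 0 + e].
  have [|p] := @rat_in_itvoo R (x i 0 - e) (x i 0); first by lra.
  rewrite in_itv /= => /andP[p1 p2].
  have [|r] := @rat_in_itvoo R (x i 0) (x i 0 + e); first by lra.
  rewrite in_itv /= => /andP[r1 r2].
  by exists (p, r); split => //=; exact: ltW.
have [p Hp] := choice P.
exists (\col_i (p i).1, \col_i (p i).2) => //; case: ifPn => [_|/asboolP[]].
  by move=> i /=; rewrite !mxE; have [_ -> -> _] := Hp i.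
move=> y Hy; apply: eU; split=> // i j; rewrite /ball /= ord1.
have := Hy i; rewrite /= !mxE; have [p1 p2 p3 p4] := Hp i => /andP[y1 y2].
by rewrite ltr_norml; apply/andP; split; lra.
Qed.

Lemma measurable_closed (U : set 'cV[R]_m) : closed U -> measurable (U : set E).
Proof.
move=> cU; rewrite -[U]setCK; apply: measurableC; apply: measurable_open.
by rewrite openC.
Qed.

Lemma measurable_fun_continuous (D : set 'cV[R]_m) (f : 'cV[R]_m -> R) :
  continuous f -> measurable_fun (D : set E) (f : E -> R).
Proof.
move=> cf mD.
apply: (measurability _ (RGenInftyO.measurableE R)) => // _ [_ [x ->] <-].
apply: measurableI => //; apply: measurable_open.
by apply: open_comp => // y _; exact: cf.
Qed.

Lemma measurable_fun_lt_open (f : 'cV[R]_m -> R) :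
  (forall c, open [set x | f x < c]) -> measurable_fun setT (f : E -> R).
Proof.
move=> fo mD.
apply: (measurability _ (RGenInftyO.measurableE R)) => // _ [_ [c ->] <-].
rewrite setTI; apply: measurable_open.
by rewrite (_ : _ @^-1` _ = [set x | f x < c]) //; apply/seteqP; split=> x /=; rewrite in_itv.
Qed.

End measurable_open.

(** * Lebesgue measure: completeness, cubes and affine changes of variables *)

(* The filter of the sets of full measure, in the two forms in which it
   occurs as a filter. *)
#[export] Instance leb_ae_filter (R : realType) (m : nat) :
  Filter (nbhs (almost_everywhere (@leb R m))).
Proof. exact: (@ae_filter_ringOfSetsType _ (euclid R m) R (@leb R m)). Qed.

#[export] Instance leb_ae_filter' (R : realType) (m : nat) :
  Filter (almost_everywhere (@leb R m)).
Proof. exact: leb_ae_filter. Qed.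

Section lebesgue.
Context (R : realType) (m : nat).
Notation E := (euclid R m).
Implicit Types (a b x z : 'cV[R]_m) (X Y : set 'cV[R]_m).

Lemma leb_complete : measure_is_complete (@leb R m).
Proof. exact: measure_is_complete_caratheodory. Qed.

Lemma leb_box a b : leb (box a b : set E) = (box_volume a b)%:E.
Proof. exact: lebesgue_outer_box. Qed.

Lemma measurable_cube : measurable (cube : set E).
Proof. exact: measurable_box. Qed.

Lemma leb_cube : leb (cube : set E) = 1%E.
Proof.
rewrite leb_box /box_volume big1 // => i _.
rewrite !mxE opprK (_ : 2^-1 + 2^-1 = 1 :> R) ?max_r //; lra.
Qed.

(** Sets of measure zero have only measurable subsets, Lebesgue measure being
    complete. *)
Lemma ae_measurable (D : set 'cV[R]_m) (f g : 'cV[R]_m -> R) :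
  (\forall x \ae leb, D x -> f x = g x) ->
  measurable_fun (D : set E) (f : E -> R) -> measurable_fun (D : set E) (g : E -> R).
Proof.
move=> fg mf; apply/measurable_EFinP.
apply: (@ae_measurable_fun _ _ _ _ leb_complete _ (EFin \o (f : E -> R))).
  by apply: filterS fg => x fgx Dx /=; rewrite fgx.
exact/measurable_EFinP.
Qed.

Lemma measurable_ae_limit (D : set 'cV[R]_m) (h : nat -> 'cV[R]_m -> R) (g : 'cV[R]_m -> R) :
  measurable (D : set E) ->
  (forall k, measurable_fun (D : set E) (h k : E -> R)) ->
  (\forall x \ae leb, D x -> h ^~ x @ \oo --> g x) ->
  measurable_fun (D : set E) (g : E -> R).
Proof.
move=> mD mh [N [mN N0 NH]].
apply: (@ae_measurable _ (fun x => if x \in N then 0 else g x)).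
  exists N; split=> // x /= /not_implyP[Dx]; case: ifPn => // xN.
  by move: xN; rewrite inE.
apply: (@measurable_fun_cvg _ E R D (fun k (x : E) => if x \in N then 0 else h k x)).
  move=> k; apply: measurable_fun_if => //.
  - apply: (@measurable_fun_bool _ _ _ _ true) => //.
    rewrite (_ : _ @^-1` _ = N); first exact: measurableI.
    by apply/seteqP; split=> x /=; [move/set_mem|move/mem_set].
  - by apply: measurable_funS (mh k) => //; exact: subIsetl.
move=> x Dx; case: ifPn => [|xN]; first by move=> _; exact: cvg_cst.
apply: contrapT => H; move/negP : xN; apply; rewrite inE; apply: NH => /= H'.
exact/H/H'.
Qed.

Definition affine (c : R) z : 'cV[R]_m -> 'cV[R]_m := fun x => c *: x + z.

Lemma affineK c z : 0 < c -> cancel (affine c z) (affine c^-1 (- (c^-1 *: z))).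
Proof.
by move=> c0 x; rewrite /affine scalerDr scalerA mulVf ?gt_eqF // scale1r addrK.
Qed.

Lemma affineVK c z : 0 < c -> cancel (affine c^-1 (- (c^-1 *: z))) (affine c z).
Proof.
by move=> c0 x; rewrite /affine scalerBr !scalerA mulfV ?gt_eqF // !scale1r subrK.
Qed.

Lemma affine_box c z a b : 0 < c ->
  affine c z @^-1` box a b = box (c^-1 *: (a - z)) (c^-1 *: (b - z)).
Proof.
move=> c0; apply/seteqP; split=> x H i; have := H i; rewrite !mxE => /andP[H1 H2];
  apply/andP; split.
- by rewrite ler_pdivrMl // lerBlDr.
- by rewrite ler_pdivlMl // lerBrDr.
- by rewrite -lerBlDr -ler_pdivrMl.
- by rewrite -lerBrDr -ler_pdivlMl.
Qed.

Lemma affine_box_volume c z a b : 0 < c ->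
  box_volume (c^-1 *: (a - z)) (c^-1 *: (b - z)) = (c ^+ m)^-1 * box_volume a b.
Proof.
move=> c0; rewrite /box_volume -exprVn.
have -> : c^-1 ^+ m = \prod_(i < m) c^-1 by rewrite prodr_const card_ord.
rewrite -big_split /=.
apply: eq_bigr => i _; rewrite !mxE -mulrBr opprB addrA subrK.
by rewrite maxr_pMr ?mulr0 // invr_ge0 ltW.
Qed.

(** The preimages of the boxes of a cover are boxes whose volumes are divided
    by c ^+ m. *)
Lemma lebesgue_outer_affine_le c z X : 0 < c ->
  (((c ^+ m)%:E * lebesgue_outer (affine c z @^-1` X)) <= lebesgue_outer X)%E.
Proof.
move=> c0; apply: le_ereal_inf_tmp => _ [P [a [b [cov ->]]]].
have cm : 0 < c ^+ m by rewrite exprn_gt0.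
have -> : (\sum_(0 <= k <oo | P k) (box_volume (a k) (b k))%:E = (c ^+ m)%:E *
    \sum_(0 <= k <oo | P k) (box_volume (c^-1 *: (a k - z)) (c^-1 *: (b k - z)))%:E)%E.
  rewrite -nneseriesZl ?lee_fin ?ltW //; last by move=> k _; exact: box_volume_ge0.
  apply: eq_eseriesr => k _.
  by rewrite affine_box_volume // -EFinM mulrA mulfV ?mul1r // gt_eqF.
apply: lee_wpmul2l; first by rewrite lee_fin ltW.
apply: ereal_inf_lbound; exists P, (fun k => c^-1 *: (a k - z)), (fun k => c^-1 *: (b k - z)).
split=> // x /cov[k Pk xk]; exists k => //=.
by rewrite -(affine_box _ _ _ c0).
Qed.

Lemma lebesgue_outer_affine c z X : 0 < c ->
  lebesgue_outer (affine c z @^-1` X) = (((c ^+ m)^-1)%:E * lebesgue_outer X)%E.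
Proof.
move=> c0; have cm : 0 < c ^+ m by rewrite exprn_gt0.
have ci : 0 < c^-1 by rewrite invr_gt0.
have H1 := lebesgue_outer_affine_le z X c0.
have := lebesgue_outer_affine_le (- (c^-1 *: z)) (affine c z @^-1` X) ci.
rewrite (_ : _ @^-1` _ = X); last first.
  by apply/seteqP; split=> x /=; rewrite affineVK.
rewrite exprVn => H2; apply/eqP; rewrite eq_le H2 andbT.
have := @lee_wpmul2l _ ((c ^+ m)^-1)%:E _ _ _ H1; rewrite muleA -EFinM mulVf ?gt_eqF // mul1e.
by apply; rewrite lee_fin invr_ge0 ltW.
Qed.

Lemma measurable_affine c z X : 0 < c ->
  measurable (X : set E) -> measurable (affine c z @^-1` X : set E).
Proof.
move=> c0 mX; apply: (@le_caratheodory_measurable _ _ (@lebesgue_outer R m)) => Y.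
change (lebesgue_outer (Y `&` affine c z @^-1` X) +
  lebesgue_outer (Y `&` ~` (affine c z @^-1` X)) <= lebesgue_outer Y)%E.
pose Y' := affine c^-1 (- (c^-1 *: z)) @^-1` Y.
have YE : Y = affine c z @^-1` Y'.
  by apply/seteqP; split=> x; rewrite /Y' /=; rewrite affineK.
rewrite YE preimage_setC -!preimage_setI !(lebesgue_outer_affine _ _ c0).
rewrite -ge0_muleDr; try exact: lebesgue_outer_ge0.
apply: lee_wpmul2l; first by rewrite lee_fin invr_ge0 exprn_ge0 // ltW.
by rewrite [leRHS](mX Y').
Qed.

Lemma measurable_fun_affine c z : 0 < c ->
  measurable_fun [set: E] (affine c z : E -> E).
Proof. by move=> c0 _ B mB; rewrite setTI; exact: measurable_affine. Qed.

Lemma ge0_integral_affine c z (f : 'cV[R]_m -> \bar R) : 0 < c ->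
  measurable_fun [set: E] (f : E -> \bar R) -> (forall x, 0 <= f x)%E ->
  (\int[leb]_(x in [set: E]) f (affine c z x) =
   ((c ^+ m)^-1)%:E * \int[leb]_(x in [set: E]) f x)%E.
Proof.
move=> c0 mf f0; have cm : 0 <= (c ^+ m)^-1 by rewrite invr_ge0 exprn_ge0 // ltW.
have mA := measurable_fun_affine z c0.
have := ge0_integral_pushforward mA (@leb R m) (D := setT) measurableT mf.
rewrite preimage_setT => <-; last by move=> x _.
have := ge0_integral_mscale (@leb R m) measurableT (NngNum cm) mf (fun x _ => f0 x).
move=> <-; apply: eq_measure_integral => A mA' _.
exact: lebesgue_outer_affine.
Qed.

Lemma ae_affine c z (P : 'cV[R]_m -> Prop) : 0 < c ->
  (\forall x \ae leb, P x) -> \forall x \ae leb, P (affine c z x).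
Proof.
move=> c0 [N [mN N0 NP]]; exists (affine c z @^-1` N); split.
- exact: measurable_affine.
- by have := lebesgue_outer_affine z N c0; rewrite [X in (_ * X)%E]N0 mule0.
- by move=> x /= Px; exact: NP.
Qed.

Lemma integral_translate z (f : 'cV[R]_m -> \bar R) :
  measurable_fun [set: E] (f : E -> \bar R) ->
  (\int[leb]_(x in [set: E]) f ((x : 'cV[R]_m) + z)%R = \int[leb]_(x in [set: E]) f x)%E.
Proof.
move=> mf; rewrite [LHS]integralE [RHS]integralE.
have H (g : 'cV[R]_m -> \bar R) : measurable_fun [set: E] (g : E -> \bar R) ->
    (forall x, 0 <= g x)%E ->
    (\int[leb]_(x in [set: E]) g ((x : 'cV[R]_m) + z)%R = \int[leb]_(x in [set: E]) g x)%E.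
  move=> mg g0; have := ge0_integral_affine z ltr01 mg g0.
  by rewrite expr1n invr1 mul1e /affine; under eq_integral do rewrite scale1r.
rewrite -(H _ (measurable_funepos mf)) // -(H _ (measurable_funeneg mf)) //.
by congr (_ - _)%E; apply: eq_integral => x _; rewrite ?funeposE ?funenegE.
Qed.

Lemma integral_scale c (f : 'cV[R]_m -> \bar R) : 0 < c ->
  leb.-integrable [set: E] (f : E -> \bar R) ->
  (\int[leb]_(x in [set: E]) f (c *: (x : 'cV[R]_m))%R =
   ((c ^+ m)^-1)%:E * \int[leb]_(x in [set: E]) f x)%E.
Proof.
move=> c0 intf; have mf := measurable_int _ intf.
have H (g : 'cV[R]_m -> \bar R) : measurable_fun [set: E] (g : E -> \bar R) ->
    (forall x, 0 <= g x)%E ->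
    (\int[leb]_(x in [set: E]) g (c *: (x : 'cV[R]_m))%R =
     ((c ^+ m)^-1)%:E * \int[leb]_(x in [set: E]) g x)%E.
  move=> mg g0; rewrite -(ge0_integral_affine 0 c0 mg g0).
  by rewrite /affine; under [in RHS]eq_integral do rewrite addr0.
rewrite [LHS]integralE [in RHS]integralE muleBr //; last first.
  by rewrite fin_num_adde_defr // integrable_pos_fin_num.
rewrite -(H _ (measurable_funepos mf)) // -(H _ (measurable_funeneg mf)) //.
by congr (_ - _)%E; apply: eq_integral => x _; rewrite ?funeposE ?funenegE.
Qed.

Lemma integrable_bounded_box a b C (f : 'cV[R]_m -> R) :
  measurable_fun [set: E] (f : E -> R) ->
  (forall x, `|f x| <= C) -> (forall x, ~ box a b x -> f x = 0) ->
  leb.-integrable [set: E] (EFin \o (f : E -> R)).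
Proof.
move=> mf fC f0.
have : leb.-integrable (box a b : set E) (EFin \o (f : E -> R)).
  apply: measurable_bounded_integrable.
  - exact: measurable_box.
  - by rewrite [X in (X < _)%E](leb_box a b) ltry.
  - exact: measurable_funTS.
  - by exists C; split; rewrite ?num_real // => x Cx y _; exact: le_trans (fC y) (ltW Cx).
move/(integrable_mkcond _ (measurable_box a b)); congr integrable.
apply/funext => x; rewrite patchE; case: ifPn => // /negP; rewrite inE => H.
by rewrite /= f0.
Qed.

End lebesgue.

(** * Density points and differentiability of Lipschitz Q-valued maps *)

Section balls.
Context (R : realType) (m : nat).
Notation E := (euclid R m).
Implicit Types x y : 'cV[R]_m.

Lemma open_eball x r : open (eball x r).
Proof.
rewrite openE => y yr; apply/nbhs_eballP; exists (r - enorm (y - x)).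
  by rewrite subr_gt0.
move=> z zr; rewrite /eball /= (le_lt_trans (enorm_dist_triangle z y x)) //; lra.
Qed.

Lemma measurable_eball x r : measurable (eball x r : set E).
Proof. exact/measurable_open/open_eball. Qed.

Definition centered_box x (r : R) : set 'cV[R]_m := box (x - const_mx r) (x + const_mx r).

Lemma leb_centered_box x r : 0 <= r -> leb (centered_box x r : set E) = ((2 * r) ^+ m)%:E.
Proof.
move=> r0; rewrite /centered_box leb_box /box_volume; congr EFin.
rewrite (eq_bigr (fun=> 2 * r)); first by rewrite prodr_const card_ord.
move=> i _; rewrite !mxE (_ : _ - _ = 2 * r); last by ring.
by rewrite max_r // mulr_ge0.
Qed.

Lemma centered_box_sub x r : 0 < r -> centered_box x (r / m.+1%:R) `<=` eball x r.
Proof.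
move=> r0 y yx; rewrite /eball /= (le_lt_trans (enorm_le_sum _)) //.
apply: (@le_lt_trans _ _ (m%:R * (r / m.+1%:R))).
  apply: ler_sum_const => i; rewrite big_ord_recl big_ord0 addr0.
  have := yx i; rewrite !mxE ler_norml; set u := r / _ => /andP[? ?].
  by apply/andP; split; lra.
by rewrite mulrCA gtr_pMr // ltr_pdivrMr // mul1r ltr_nat.
Qed.

Lemma eball_sub x r : eball x r `<=` centered_box x r.
Proof.
move=> y yx i; have := enorm_entry (y - x) i 0; rewrite !mxE ler_norml => /andP[? ?].
by move: yx; rewrite /eball /= => ?; apply/andP; split; lra.
Qed.

Lemma leb_eball_le x r : 0 <= r -> (leb (eball x r : set E) <= ((2 * r) ^+ m)%:E)%E.
Proof. by move=> r0; rewrite -(leb_centered_box x) //; exact/le_lebesgue_outer/eball_sub. Qed.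

Lemma leb_eball_ge x r : 0 < r ->
  (((2 * (r / m.+1%:R)) ^+ m)%:E <= leb (eball x r : set E))%E.
Proof.
move=> r0; rewrite -(leb_centered_box x); last by rewrite divr_ge0 // ltW.
exact/le_lebesgue_outer/centered_box_sub.
Qed.

Lemma leb_eball_fin x r : leb (eball x r : set E) \is a fin_num.
Proof.
have [r0|r0] := leP 0 r.
  rewrite ge0_fin_numE; last exact: lebesgue_outer_ge0.
  exact: le_lt_trans (leb_eball_le x r0) (ltry _).
rewrite (_ : eball x r = set0) ?[leb _]lebesgue_outer0 //.
apply/seteqP; split=> y //; rewrite /eball /= => yr.
by have := enorm_ge0 (y - x); lra.
Qed.

(** A set of density one at x0 meets every ball of radius proportional to the
    distance of its center to x0: such a ball would otherwise take up a fixed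
    fraction of a ball around x0. *)
Lemma density_one_close (D : set 'cV[R]_m) x0 (e : R) : density_one D x0 -> 0 < e <= 1 ->
  \forall x \near x0, x != x0 -> exists2 y, D y & enorm (y - x) < e * enorm (x - x0).
Proof.
move=> [mD dD] /andP[e0 e1].
pose d := (e / (2 * m.+1%:R)) ^+ m.
have d0 : 0 < d by rewrite exprn_gt0 // divr_gt0 // mulr_gt0.
have : \forall r \near 0^'+,
    1 - d < fine (leb (D `&` eball x0 r : set E)) / fine (leb (eball x0 r : set E)).
  by apply: (cvgr_gt _ dD); lra.
move=> /nbhs_ballP[t /= t0 Ht].
apply/nbhs_eballP; exists (t / 2); first by rewrite divr_gt0.
move=> x; set r := enorm (x - x0) => rt xx0.
have r0 : 0 < r.
  rewrite lt_neqAle enorm_ge0 andbT eq_sym; apply: contra_neq xx0 => /enorm_eq0/eqP.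
  by rewrite subr_eq0 => /eqP.
have er0 : 0 < e * r by rewrite mulr_gt0.
apply: contrapT => nD.
(* If the ball of radius e r around x misses D, then D leaves out at least
   the fraction d of the ball of radius 2 r around x0. *)
have sub : eball x (e * r) `<=` eball x0 (2 * r).
  move=> y; rewrite /eball /= => yx.
  rewrite (le_lt_trans (enorm_dist_triangle y x x0)) // -/r.
  have : e * r <= r by rewrite ler_piMl // ltW.
  by move: yx; lra.
have dis : (D `&` eball x0 (2 * r)) `&` eball x (e * r) = set0.
  apply/seteqP; split=> y // -[[Dy _]] yx; apply: nD; exists y => //.
have mDB : measurable (D `&` eball x0 (2 * r) : set E).
  by apply: measurableI => //; exact: measurable_eball.
have := @measureU _ _ _ (@leb R m) _ _ mDB (measurable_eball x (e * r)) dis.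
have : (leb ((D `&` eball x0 (2 * r)) `|` eball x (e * r) : set E) <=
    leb (eball x0 (2 * r) : set E))%E.
  by apply: le_lebesgue_outer => y [[_ //]|]; exact: sub.
have /Ht : ball 0 t (2 * r).
  by rewrite -ball_normE /ball_ /= sub0r normrN gtr0_norm ?mulr_gt0 //; lra.
have r20 : 0 < 2 * r by rewrite mulr_gt0.
move=> /(_ r20) ratio subm addm.
have fin1 : leb (D `&` eball x0 (2 * r) : set E) \is a fin_num.
  rewrite ge0_fin_numE; last exact: lebesgue_outer_ge0.
  apply: le_lt_trans (ltry (fine (leb (eball x0 (2 * r) : set E)))).
  by rewrite fineK ?leb_eball_fin //; apply: le_lebesgue_outer; exact: subIsetr.
have {subm addm} : fine (leb (D `&` eball x0 (2 * r) : set E)) +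
    fine (leb (eball x (e * r) : set E)) <= fine (leb (eball x0 (2 * r) : set E)).
  rewrite -lee_fin EFinD !fineK ?leb_eball_fin //.
  by rewrite (le_trans _ subm) // -[X in (X <= _)%E]addm.
have : (2 * (e * r / m.+1%:R)) ^+ m <= fine (leb (eball x (e * r) : set E)).
  by rewrite -lee_fin fineK ?leb_eball_fin // leb_eball_ge.
have c1 : fine (leb (eball x0 (2 * r) : set E)) <= (2 * (2 * r)) ^+ m.
  by rewrite -lee_fin fineK ?leb_eball_fin // leb_eball_le // ltW.
have c0 : 0 < fine (leb (eball x0 (2 * r) : set E)).
  rewrite (@lt_le_trans _ _ ((2 * (2 * r / m.+1%:R)) ^+ m)) //.
    by rewrite exprn_gt0 // mulr_gt0 // divr_gt0.
  by rewrite -lee_fin fineK ?leb_eball_fin // leb_eball_ge.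
have -> : (2 * (e * r / m.+1%:R)) ^+ m = d * (2 * (2 * r)) ^+ m.
  by rewrite /d -exprMn; congr (_ ^+ _); field.
have := ler_wpM2l (ltW d0) c1; move: ratio; rewrite ltr_pdivlMr //.
set a := fine _; set b := fine _; set c := fine _; set u := (_ ^+ m).
by rewrite mulrBl mul1r; lra.
Qed.

End balls.

Section differentiability.
Context (R : realType) (m q n : nat).
Notation E := (euclid R m).
Implicit Types (f : 'cV[R]_m -> qpoint R q n) (P : 'I_q -> 'cV[R]_n) (D : 'I_q -> 'M[R]_(n, m)).
Implicit Types (x y : 'cV[R]_m).

(** Differentiability in the classical sense: the affine approximation holds
    on a full neighbourhood, not only on a set of density one. *)
Definition qdiff_at f P D x0 : Prop :=
  [/\ f x0 = dirac_sum P,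
      forall e, 0 < e -> \forall x \near x0,
        qdist (f x) (dirac_sum (fun i => P i + D i *m (x - x0))) <= e * enorm (x - x0)
    & forall i j, P i = P j -> D i = D j].

Lemma lipschitz_q_gt0 f : lipschitz_q f ->
  exists2 K, 0 < K & forall x y, qdist (f x) (f y) <= K * enorm (x - y).
Proof.
move=> [L fL]; exists (`|L| + 1); first by rewrite ltr_wpDl.
move=> x y; rewrite (le_trans (fL x y)) // ler_wpM2r ?enorm_ge0 //.
by rewrite (le_trans (ler_norm _)) // lerDl.
Qed.

Lemma fnorm_mulmx_le D : exists2 B, 0 < B &
  forall x, fnorm (fun i => D i *m x) <= B * enorm x.
Proof.
exists (1 + \sum_i ((n * 1)%:R * (m%:R * enorm (D i)))).
  by rewrite ltr_wpDr // sumr_ge0 // => i _; rewrite !mulr_ge0 ?enorm_ge0.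
move=> x; rewrite (le_trans (fnorm_le_sum _)) // mulrDl mul1r mulr_suml.
rewrite ler_wpDl ?enorm_ge0 //; apply: ler_sum => i _.
by rewrite (le_trans (enorm_mulmx _ _)) // !mulrA.
Qed.

(** By density_one_close a point x near x0 has a point y of F at distance at
    most t |x - x0|. Replacing y by x changes the value of f by at most K t
    |x - x0| and that of the affine map by at most B t |x - x0|, where t may
    be taken small with e. *)
Lemma density_one_qdiff f P D x0 (F : set 'cV[R]_m) : lipschitz_q f ->
  density_one F x0 -> f x0 = dirac_sum P -> (forall i j, P i = P j -> D i = D j) ->
  (forall e, 0 < e -> \forall x \near within F (nbhs x0),
      qdist (f x) (dirac_sum (fun i => P i + D i *m (x - x0))) <= e * enorm (x - x0)) ->
  qdiff_at f P D x0.
Proof.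
move=> /lipschitz_q_gt0[K K0 fK] dF fx0 PD H; split=> // e e0.
have [B B0 DB] := fnorm_mulmx_le D.
pose t := Num.min 1 (e / (2 * (K + B))).
have KB0 : 0 < K + B by rewrite addr_gt0.
have t0 : 0 < t by rewrite lt_min ltr01 divr_gt0 // mulr_gt0.
have t1 : t <= 1 by rewrite ge_min lexx.
have te : (K + B) * t <= e / 2.
  rewrite mulrC -ler_pdivlMr // (@le_trans _ _ (e / (2 * (K + B)))) //.
    by rewrite ge_min lexx orbT.
  by rewrite le_eqVlt; apply/orP; left; apply/eqP; field; rewrite gt_eqF.
have e4 : 0 < e / 4 by rewrite divr_gt0.
have tt : 0 < t <= 1 by rewrite t0 t1.
have /nbhs_eballP[r1 r10 H1] := H _ e4.
have /nbhs_eballP[r2 r20 H2] := density_one_close dF tt.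
apply/nbhs_eballP; exists (Num.min (r1 / 2) r2).
  by rewrite lt_min divr_gt0.
move=> x; rewrite lt_min => /andP[xr1 xr2].
have [->|xx0] := eqVneq x x0.
  rewrite fx0 subrr enorm0 mulr0 (_ : (fun i => _) = P) ?qdistxx //.
  by apply/funext => i; rewrite mulmx0 addr0.
have [y Fy yx] := H2 _ xr2 xx0.
set r := enorm (x - x0) in xr1 xr2 yx *.
have r0 : 0 <= r by exact: enorm_ge0.
have yx0 : enorm (y - x0) <= 2 * r.
  rewrite (le_trans (enorm_dist_triangle y x x0)) // -/r.
  have : t * r <= r by rewrite ler_piMl.
  by move: yx; lra.
have yr1 : enorm (y - x0) < r1 by lra.
have {H1} /(_ Fy) H1 := H1 _ yr1.
rewrite (le_trans (qdist_triangle _ (f y) _)) //.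
have h1 : qdist (f x) (f y) <= K * (t * r).
  by rewrite (le_trans (fK x y)) // ler_pM2l // enorm_distC ltW.
have h2 : qdist (f y) (dirac_sum (fun i => P i + D i *m (y - x0))) <= e / 4 * (2 * r).
  by rewrite (le_trans H1) // ler_pM2l.
have h3 : qdist (dirac_sum (fun i => P i + D i *m (y - x0)))
   (dirac_sum (fun i => P i + D i *m (x - x0))) <= B * (t * r).
  rewrite (le_trans (qdist_dirac_le _ _)) //.
  rewrite (_ : (fun i => _) = (fun i => D i *m (y - x))); last first.
    apply/funext => i; rewrite opprD addrACA subrr add0r -mulmxBr.
    by rewrite opprB addrA subrK.
  by rewrite (le_trans (DB _)) // ler_pM2l // ltW.
have h4 := qdist_triangle (f y) (dirac_sum (fun i => P i + D i *m (y - x0)))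
  (dirac_sum (fun i => P i + D i *m (x - x0))).
have : (K + B) * t * r <= e / 2 * r by rewrite ler_wpM2r.
lra.
Qed.

Lemma approx_differential_qdiff f fi Dfi : lipschitz_q f ->
  approx_differential setT f fi Dfi ->
  \forall x \ae leb, qdiff_at f (fi^~ x) (Dfi^~ x) x.
Proof.
move=> lf [ff H]; apply: filterS H => x /(_ I)[[F [_ dF HF]] PD].
exact: density_one_qdiff lf dF (ff _ I) PD HF.
Qed.

Lemma leb_setI_null (A F G : set 'cV[R]_m) : leb (F `\` G : set E) = 0%E ->
  leb ((F `&` G) `&` A : set E) = leb (F `&` A : set E).
Proof.
move=> FG0; apply/eqP; rewrite eq_le; apply/andP; split.
  by apply: le_lebesgue_outer => x [[]].
rewrite -[leRHS]adde0 -FG0; apply: (le_trans _ (outer_measureU2 _ _ _)).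
apply: le_lebesgue_outer => x [Fx Ax].
by have [Gx|Gx] := pselect (G x); [left|right].
Qed.

Lemma density_one_setI (F G : set 'cV[R]_m) x0 : measurable (G : set E) ->
  leb (F `\` G : set E) = 0%E -> density_one F x0 -> density_one (F `&` G) x0.
Proof.
move=> mG FG0 [mF dF]; split; first exact: measurableI.
rewrite (_ : (fun r => _) = (fun r => fine (leb (F `&` eball x0 r : set E)) /
  fine (leb (eball x0 r : set E)))) //.
by apply/funext => r; rewrite leb_setI_null.
Qed.

Lemma density_one_interior (F : set 'cV[R]_m) x0 : measurable (F : set E) ->
  nbhs x0 F -> density_one F x0.
Proof.
move=> mF /nbhs_eballP[r r0 Fr]; split=> //; apply: cvg_near_cst.
apply/nbhs_ballP; exists r => //= s; rewrite -ball_normE /ball_ /= sub0r normrN => sr s0.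
rewrite gtr0_norm // in sr.
rewrite (_ : F `&` eball x0 s = eball x0 s); last first.
  by apply/seteqP; split=> [y [] //|y ys]; split=> //; apply: Fr; exact: lt_trans ys sr.
rewrite divff // gt_eqF // (@lt_le_trans _ _ ((2 * (s / m.+1%:R)) ^+ m)) //.
  by rewrite exprn_gt0 // mulr_gt0 // divr_gt0.
by rewrite -lee_fin fineK ?leb_eball_fin // leb_eball_ge.
Qed.

(** A point of the interior of F is a point of density one of F. *)
Lemma qdiff_approx_differential (F : set 'cV[R]_m) f fi Dfi : measurable (F : set E) ->
  (forall x, F x -> f x = dirac_sum (fi^~ x)) ->
  (\forall x \ae leb, F x -> nbhs x F) ->
  (\forall x \ae leb, F x -> qdiff_at f (fi^~ x) (Dfi^~ x) x) ->
  approx_differential F f fi Dfi.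
Proof.
move=> mF ff int H; split=> //; apply: filterS2 int H => x int H Fx.
have [_ Hx PD] := H Fx; split=> //; exists F; split=> //.
  exact: density_one_interior (int Fx).
by move=> e e0; exact: cvg_within (Hx e e0).
Qed.

End differentiability.

(** * Measurability of the energy density *)

Section difference_quotients.
Context (R : realType) (m q n : nat).
Notation E := (euclid R m).
Implicit Types (f : 'cV[R]_m -> qpoint R q n).
Implicit Types (x y : 'cV[R]_m) (quad : 'M[R]_(n, m) -> R).

Definition step (N : nat) (k : 'I_m) : 'cV[R]_m := N.+1%:R^-1 *: delta_mx k 0.

Lemma mulmx_delta (M : 'M[R]_(n, m)) k a : (M *m delta_mx k 0 : 'cV[R]_n) a 0 = M a k.
Proof.
rewrite mxE (bigD1 k) //= mxE !eqxx mulr1 big1 ?addr0 // => j jk.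
by rewrite mxE (negPf jk) mulr0.
Qed.

Lemma enorm_delta (k : 'I_m) : enorm (delta_mx k 0 : 'cV[R]_m) = 1.
Proof.
rewrite /enorm /mdot (bigD1 k) //= big_ord_recl big_ord0 mxE !eqxx mulr1 addr0.
rewrite big1 ?addr0 ?sqrtr1 // => j jk.
by rewrite big_ord_recl big_ord0 mxE (negPf jk) mulr0 addr0.
Qed.

Lemma enorm_step N k : enorm (step N k) = N.+1%:R^-1.
Proof. by rewrite enormZ enorm_delta mulr1 ger0_norm // invr_ge0. Qed.

Lemma natSinv_near (e : R) : 0 < e -> \forall N \near \oo, N.+1%:R^-1 < e.
Proof. by move=> e0; have := near_infty_natSinv_lt (PosNum e0). Qed.

Lemma step_near x (k : 'I_m) (A : 'cV[R]_m -> Prop) : (\forall y \near x, A y) ->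
  \forall N \near \oo, A (x + step N k).
Proof.
move=> /nbhs_eballP[r r0 H]; apply: filterS (natSinv_near r0) => N Nr.
by apply: H; rewrite addrAC subrr add0r enorm_step.
Qed.

Lemma enorm_le_entries (M : 'M[R]_(n, m)) c : (forall a k, `|M a k| <= c) ->
  enorm M <= n%:R * (m%:R * c).
Proof.
move=> Mc; rewrite (le_trans (enorm_le_sum M)) //; apply: ler_sum_const => a.
exact: ler_sum_const.
Qed.

(** Difference quotients of the sheets along the coordinate directions, for a
    labelling P0 of the values at x and labellings P k at x + step N k. *)
Definition dqmx N (P0 : 'I_q -> 'cV[R]_n) (P : 'I_m -> 'I_q -> 'cV[R]_n) i : 'M[R]_(n, m) :=
  \matrix_(a, k) (N.+1%:R * (P k i a 0 - P0 i a 0)).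

Definition step_labels f N x (P : 'I_m -> 'I_q -> 'cV[R]_n) : Prop :=
  forall k, f (x + step N k) = dirac_sum (P k).

Definition dq_values quad f N x : set R :=
  [set s | exists P0 P, [/\ f x = dirac_sum P0, step_labels f N x P
                          & s = \sum_i quad (dqmx N P0 P i)]].

(** The least value of the quadratic expression over all ways of matching the
    sheets at x with the sheets at the neighbouring points. *)
Definition dq_energy quad f N x : R := inf (dq_values quad f N x).

Lemma dq_values_nonempty quad f N x : dq_values quad f N x !=set0.
Proof.
exists (\sum_i quad (dqmx N (qpoint_pts (f x)) (fun k => qpoint_pts (f (x + step N k))) i)).
exists (qpoint_pts (f x)), (fun k => qpoint_pts (f (x + step N k))).
by split=> // [|k]; rewrite qpoint_ptsK.
Qed.

Section quadratic.
Variable (quad : 'M[R]_(n, m) -> R).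
Hypothesis quad_cont : continuous quad.
Hypothesis quad_coercive : forall M, mdot M M <= quad M.

Lemma quad_ge0 M : 0 <= quad M.
Proof. exact: le_trans (mdot_ge0 M) (quad_coercive M). Qed.

Lemma dq_values_lbound f N x : lbound (dq_values quad f N x) 0.
Proof.
by move=> s [P0 [P [_ _ ->]]]; apply: sumr_ge0 => i _; exact: quad_ge0.
Qed.

Lemma dq_energy_le f N x P0 P : f x = dirac_sum P0 -> step_labels f N x P ->
  dq_energy quad f N x <= \sum_i quad (dqmx N P0 P i).
Proof.
move=> f0 fP; apply: ge_inf; first by exists 0; exact: dq_values_lbound.
by exists P0, P.
Qed.

Lemma quad_near x M eta C : 0 < eta -> 0 <= C -> \forall y \near x,
  forall M', enorm (M' - M) <= C * enorm (y - x) -> quad M' < quad M + eta.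
Proof.
move=> eta0 C0; have /nbhs_eballP[d d0 Hd] : nbhs M [set M' | quad M' < quad M + eta].
  have h : quad M < quad M + eta by rewrite ltrDl.
  exact: (cvgr_lt (quad M) (@quad_cont M) _ h).
apply/nbhs_eballP; exists (d / (C + 1)); first by rewrite divr_gt0 // ltr_wpDl.
move=> y; rewrite ltr_pdivlMr; last by rewrite ltr_wpDl.
move=> yd M' M'C; apply: Hd; rewrite (le_lt_trans M'C) // (le_lt_trans _ yd) //.
by rewrite mulrC ler_wpM2l ?enorm_ge0 // lerDl.
Qed.

(** Matchings of the sheets at x extend by continuity to the points near x,
    so that the infimum over all matchings is upper semicontinuous. *)
Lemma open_dq_energy_lt f N c : lipschitz_q f -> open [set x | dq_energy quad f N x < c].
Proof.
move=> /lipschitz_q_gt0[K K0 fK]; rewrite openE => x /= xc.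
have [_ [P0 [P [f0 fP ->]]] sc] : exists2 s, dq_values quad f N x s & s < c.
  have [s Hs sc] := inf_lt (dq_values_nonempty quad f N x) xc.
  by exists s.
set s := \sum_i _ in sc.
pose eta := (c - s) / q.+1%:R.
have eta0 : 0 < eta by rewrite divr_gt0 // subr_gt0.
pose C := n%:R * (m%:R * (N.+1%:R * (2 * K))).
have C0 : 0 <= C by rewrite !mulr_ge0 // ltW.
have near_q := @filter_forall _ _ _ (nbhs x) (nbhs_filter x) (fun i => quad_near x (dqmx N P0 P i) eta0 C0).
move/nbhs_eballP : near_q => [d d0 Hd]; apply/nbhs_eballP; exists d => // y /Hd Hy /=.
have [S0 fS0 dS0] := qdist_label P0 (f y).
have /choice[S HS] : forall k, exists S, f (y + step N k) = dirac_sum S /\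
    qdist (dirac_sum (P k)) (f (y + step N k)) = fnorm (fun i => P k i - S i).
  by move=> k; have [S ? ?] := qdist_label (P k) (f (y + step N k)); exists S.
rewrite (le_lt_trans (dq_energy_le fS0 (fun k => (HS k).1))) //.
have H i : quad (dqmx N S0 S i) <= quad (dqmx N P0 P i) + eta.
  apply/ltW/Hy.
  rewrite /C -!mulrA; apply: enorm_le_entries => a k; rewrite !mxE -mulrBr normrM normr_nat.
  rewrite ler_pM2l ?ltr0n //.
  have h1 : `|P0 i a 0 - S0 i a 0| <= K * enorm (y - x).
    have := enorm_entry (P0 i - S0 i) a 0; rewrite !mxE => /le_trans; apply.
    rewrite (le_trans (enorm_le_fnorm (fun i => P0 i - S0 i) i)) // -dS0 -f0.
    by rewrite (le_trans (fK _ _)) // enorm_distC.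
  have h2 : `|P k i a 0 - S k i a 0| <= K * enorm (y - x).
    have := enorm_entry (P k i - S k i) a 0; rewrite !mxE => /le_trans; apply.
    rewrite (le_trans (enorm_le_fnorm (fun i => P k i - S k i) i)) // -(HS k).2 -fP.
    by rewrite (le_trans (fK _ _)) // enorm_distC opprD addrACA subrr addr0.
  rewrite (_ : _ - _ = (P0 i a 0 - S0 i a 0) - (P k i a 0 - S k i a 0)); last by ring.
  rewrite (le_trans (ler_normB _ _)) //; lra.
apply: (@le_lt_trans _ _ (\sum_i (quad (dqmx N P0 P i) + eta))); first exact: ler_sum.
rewrite big_split /= -/s sumr_const card_ord -mulr_natl.
have : q%:R * eta < c - s; last lra.
rewrite /eta mulrCA gtr_pMr ?subr_gt0 //.
by rewrite ltr_pdivrMr // mul1r ltr_nat.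
Qed.

Lemma measurable_dq_energy f N : lipschitz_q f ->
  measurable_fun [set: E] (dq_energy quad f N : E -> R).
Proof. by move=> lf; apply: measurable_fun_lt_open => c; exact: open_dq_energy_lt. Qed.

End quadratic.

(** The labels at x + step N k that are closest to the affine approximation
    have difference quotients close to D. *)
Lemma step_labels_near f P D x : qdiff_at f P D x -> forall eta, 0 < eta ->
  \forall N \near \oo, exists S, step_labels f N x S /\
    forall i, enorm (dqmx N P S i - D i) <= eta.
Proof.
move=> [fx H _] eta eta0.
pose e := eta / (n * m).+1%:R; have e0 : 0 < e by rewrite divr_gt0.
have : \forall N \near \oo, forall k, qdist (f (x + step N k))
    (dirac_sum (fun i => P i + D i *m (x + step N k - x))) <= e * enorm (x + step N k - x).
  by apply: filter_forall => k; exact: (step_near (A := fun y => _) k (H e e0)).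
apply: filterS => N HN.
have /choice[S HS] : forall k, exists S, f (x + step N k) = dirac_sum S /\
    fnorm (fun i => P i + D i *m step N k - S i) <= e * N.+1%:R^-1.
  move=> k; have := HN k; rewrite addrAC subrr add0r enorm_step qdistC => Hk.
  have [S fS dS] := qdist_label (fun i => P i + D i *m step N k) (f (x + step N k)).
  by exists S; rewrite -dS.
exists S; split=> [k|i]; first by have [] := HS k.
have : forall a k, `|(dqmx N P S i - D i) a k| <= e.
  move=> a k; have [_ /(le_trans (enorm_le_fnorm _ i))] := HS k.
  have : (D i *m step N k : 'cV[R]_n) a 0 = N.+1%:R^-1 * D i a k.
    by rewrite -scalemxAr mxE mulmx_delta.
  move: (D i *m step N k) => v va /(le_trans (enorm_entry _ a 0)); rewrite !mxE va.
  rewrite ler_pdivlMr // => He.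
  rewrite (_ : _ - _ = - (N.+1%:R * (P i a 0 + N.+1%:R^-1 * D i a k - S k i a 0))).
    by rewrite normrN normrM normr_nat mulrC.
  have : N.+1%:R != 0 :> R by rewrite pnatr_eq0.
  by move: (N.+1%:R) => u u0; field.
move=> /enorm_le_entries/le_trans; apply.
rewrite mulrA -natrM /e mulrCA ger_pMr // ler_pdivrMr // mul1r ler_nat.
exact: leqnSn.
Qed.

(** Bounded difference quotients can only match sheets that meet at x, and
    sheets that meet at x have the same differential. *)
Lemma bounded_dq_near f P D x : qdiff_at f P D x -> forall L eta, 0 < eta ->
  \forall N \near \oo, forall S, step_labels f N x S ->
    (forall i, enorm (dqmx N P S i) <= L) ->
    forall i, enorm (dqmx N P S i - D i) <= eta.
Proof.
move=> df L eta eta0; have [_ _ PD] := df.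
pose e := eta / (n * m).+1%:R; have e0 : 0 < e by rewrite divr_gt0.
pose C := n%:R * (L + e + \sum_i enorm (D i)).
(* For small steps, distinct values P i and P j are too far apart to be
   matched by difference quotients bounded by L. *)
have : \forall N \near \oo, forall i j, enorm (P i - P j) <= C * N.+1%:R^-1 -> P i = P j.
  apply: filter_forall => i; apply: filter_forall => j.
  have [->|Pij] := eqVneq (P i) (P j); first exact: filterE.
  have d0 : 0 < enorm (P i - P j).
    rewrite lt_neqAle enorm_ge0 andbT eq_sym; apply: contra_neq Pij => /enorm_eq0/eqP.
    by rewrite subr_eq0 => /eqP.
  have C1 : 0 < `|C| + 1 by rewrite ltr_wpDl.
  have dC : 0 < enorm (P i - P j) / (`|C| + 1) by rewrite divr_gt0.
  apply: filterS (natSinv_near dC) => N.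
  rewrite ltr_pdivlMr // => Nd; rewrite leNgt => /negP[]; rewrite (le_lt_trans _ Nd) //.
  rewrite mulrC ler_wpM2l ?invr_ge0 //.
  by rewrite (le_trans (ler_norm _)) // lerDl.
apply: filterS2 (step_labels_near df e0) => N [T [fT HT]] Hsep S fS SL i.
have Ni0 : 0 < N.+1%:R^-1 :> R by rewrite invr_gt0.
have : forall a k, `|(dqmx N P S i - D i) a k| <= e.
  move=> a k; have /dirac_sumP[s Ss] : dirac_sum (S k) = dirac_sum (T k).
    by rewrite -fS -fT.
  have Pis : P i = P (s i).
    apply: Hsep; rewrite (le_trans (enorm_le_sum _)) // /C -mulrA.
    apply: ler_sum_const => b; rewrite big_ord_recl big_ord0 addr0 !mxE.
    rewrite ler_pdivlMr // mulrC -[X in X * _]normr_nat -normrM.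
    have h1 : `|N.+1%:R * (S k i b 0 - P i b 0)| <= L.
      by have := le_trans (enorm_entry _ b k) (SL i); rewrite mxE.
    have h2 := le_trans (enorm_entry _ b k) (HT (s i)).
    rewrite !mxE -Ss in h2.
    have h3 : `|D (s i) b k| <= \sum_i enorm (D i).
      rewrite (le_trans (enorm_entry _ _ _)) // (bigD1 (s i)) //= lerDl.
      by apply: sumr_ge0 => j _; exact: enorm_ge0.
    move: h1 h2 h3; rewrite !ler_norml => /andP[? ?] /andP[? ?] /andP[? ?].
    by apply/andP; split; lra.
  have := le_trans (enorm_entry _ a k) (HT (s i)).
  by rewrite !mxE -Ss -Pis (PD _ _ Pis).
move=> /enorm_le_entries/le_trans; apply.
rewrite mulrA -natrM /e mulrCA ger_pMr // ler_pdivrMr // mul1r ler_nat.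
exact: leqnSn.
Qed.

End difference_quotients.

Section energy_limit.
Context (R : realType) (m q n : nat).
Notation E := (euclid R m).
Implicit Types (f : 'cV[R]_m -> qpoint R q n).

Lemma dqmx_perm N (P0 : 'I_q -> 'cV[R]_n) P (s : 'S_q) i :
  dqmx N (P0 \o s) P i = dqmx N P0 (fun k => P k \o (s^-1)%g) (s i) :> 'M[R]_(n, m).
Proof. by apply/matrixP => a k; rewrite !mxE /= permK. Qed.

Section quadratic.
Variable (quad : 'M[R]_(n, m) -> R).
Hypothesis quad_cont : continuous quad.
Hypothesis quad_coercive : forall M, mdot M M <= quad M.

(** A matching that is nearly optimal has bounded difference quotients
    because quad is coercive, so that bounded_dq_near applies to it. *)
Lemma dq_energy_cvg f (P : 'I_q -> 'cV[R]_n) (D : 'I_q -> 'M[R]_(n, m)) x : qdiff_at f P D x ->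
  (fun N => dq_energy quad f N x) @ \oo --> \sum_i quad (D i).
Proof.
move=> df; have [fx _ _] := df.
set l := \sum_i _; have l0 : 0 <= l by apply: sumr_ge0 => i _; exact: quad_ge0.
apply/cvgrPdist_le => e e0.
pose L := 1 + l + \sum_i enorm (D i).
pose eta := e / q.+1%:R; have eta0 : 0 < eta by rewrite divr_gt0.
have : \forall N \near \oo, forall i, forall S, step_labels f N x S ->
    (forall i, enorm (dqmx N P S i) <= L) ->
    `|quad (dqmx N P S i) - quad (D i)| <= eta.
  apply: filter_forall => i.
  have /nbhs_eballP[d d0 Hd] : nbhs (D i) [set M | `|quad (D i) - quad M| <= eta].
    by have /cvgrPdist_le := @quad_cont (D i); exact.
  have d20 : 0 < d / 2 by rewrite divr_gt0.
  apply: filterS (bounded_dq_near df L d20) => N HN S fS SL.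
  rewrite distrC; apply: Hd; rewrite (le_lt_trans (HN S fS SL i)) //.
  by rewrite gtr_pMr // invf_lt1 // ltr1n.
apply: filterS2 (step_labels_near df ltr01) => N [S [fS SD]] H.
have sum_eta : \sum_(i < q) eta <= e.
  rewrite sumr_const card_ord -mulr_natl /eta mulrCA ger_pMr //.
  by rewrite ler_pdivrMr // mul1r ler_nat.
have close T : step_labels f N x T -> (forall i, enorm (dqmx N P T i) <= L) ->
    `|\sum_i quad (dqmx N P T i) - l| <= e.
  move=> fT TL; rewrite /l -sumrB (le_trans (ler_norm_sum _ _ _)) //.
  by rewrite (le_trans _ sum_eta) //; apply: ler_sum => i _; exact: H.
have upper : dq_energy quad f N x <= l + e.
  rewrite (le_trans (dq_energy_le quad_coercive fx fS)) //.
  have /close/(_ _) := fS; rewrite ler_norml => /(_ _)/andP[|_].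
    move=> i; rewrite -[X in enorm X](subrK (D i)) (le_trans (enormD _ _)) //.
    rewrite /L -addrA lerD ?SD // ler_wpDl // (bigD1 i) //= lerDl.
    by apply: sumr_ge0 => j _; exact: enorm_ge0.
  by rewrite lerBlDl addrC.
have lower : l - e <= dq_energy quad f N x.
  apply: lb_le_inf; first exact: dq_values_nonempty.
  move=> _ [Q0 [Q [f0 fQ ->]]].
  have /dirac_sumP[s Qs] : dirac_sum Q0 = dirac_sum P by rewrite -fx -f0.
  have {Qs} -> : Q0 = P \o s by exact/funext.
  rewrite (eq_bigr _ (fun i _ => congr1 quad (dqmx_perm _ _ _ s i))).
  rewrite -(reindex_inj (@perm_inj _ s) (P := xpredT)
    (F := fun i => quad (dqmx N P (fun k => Q k \o (s^-1)%g) i))) /=.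
  set T := fun k => Q k \o _.
  have fT : step_labels f N x T by move=> k; rewrite fQ dirac_sum_perm.
  (* A matching T whose sum is at least l satisfies the lower bound; any
     other one has difference quotients bounded by L, by coercivity. *)
  have [ls|sl] := leP l (\sum_i quad (dqmx N P T i)); first by rewrite (le_trans _ ls) // gerBl ltW.
  have /close/(_ _) := fT; rewrite ler_norml => /(_ _)/andP[|+ _]; last by rewrite lerBrDl addrC.
  move=> i; have : enorm (dqmx N P T i) ^+ 2 <= l.
    rewrite sqr_enorm (le_trans (quad_coercive _)) // (le_trans _ (ltW sl)) //.
    rewrite (bigD1 i) //= lerDl; apply: sumr_ge0 => j _; exact: quad_ge0.
  have Dn : 0 <= \sum_i enorm (D i) by apply: sumr_ge0 => j _; exact: enorm_ge0.
  rewrite /L; set z := enorm _ => zl.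
  have [z1|z1] := leP z 1; first lra.
  have : z <= z ^+ 2 by rewrite expr2 ler_peMl // ?enorm_ge0 // ltW.
  lra.
rewrite distrC ler_norml; apply/andP; split; lra.
Qed.

(** The functions dq_energy involve no labelling of the sheets, whose
    measurability is not known; they converge to the sum. *)
Lemma measurable_sum_quad f (P : 'I_q -> 'cV[R]_m -> 'cV[R]_n)
    (D : 'I_q -> 'cV[R]_m -> 'M[R]_(n, m)) : lipschitz_q f ->
  (\forall x \ae leb, qdiff_at f (P^~ x) (D^~ x) x) ->
  measurable_fun [set: E] ((fun x => \sum_i quad (D i x)) : E -> R).
Proof.
move=> lf df; have mN N := measurable_dq_energy quad_cont quad_coercive N lf.
apply: (measurable_ae_limit measurableT mN).
by apply: filterS df => x dfx _; exact: dq_energy_cvg dfx.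
Qed.

End quadratic.

Lemma linear_bounded (A : {linear 'M[R]_(n, m) -> 'M[R]_(n, m)}) :
  exists2 C, 0 < C & forall M, enorm (A M) <= C * enorm M.
Proof.
pose S := \sum_i \sum_j enorm (A (delta_mx i j)).
have S0 : 0 <= S by apply: sumr_ge0 => i _; apply: sumr_ge0 => j _; exact: enorm_ge0.
exists (1 + S); first by rewrite ltr_wpDr.
move=> M; rewrite mulrDl mul1r ler_wpDl ?enorm_ge0 //.
rewrite {1}(matrix_sum_delta M) linear_sum /S mulr_suml (le_trans (enorm_sum _ _ _)) //.
apply: ler_sum => i _; rewrite linear_sum mulr_suml (le_trans (enorm_sum _ _ _)) //.
apply: ler_sum => j _; rewrite linearZ enormZ mulrC ler_wpM2l ?enorm_ge0 //.
exact: enorm_entry.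
Qed.

Lemma quadratic_form_le (A : {linear 'M[R]_(n, m) -> 'M[R]_(n, m)}) :
  exists2 C, 0 < C & forall M, `|mdot (A M) M| <= C * mdot M M.
Proof.
have [C C0 AC] := linear_bounded A; exists C => // M.
rewrite (le_trans (abs_mdot_le _ _)) // -sqr_enorm expr2 mulrA.
by rewrite ler_wpM2r ?enorm_ge0.
Qed.

Lemma continuous_quadratic_form (A : {linear 'M[R]_(n, m) -> 'M[R]_(n, m)}) :
  continuous (fun M => mdot (A M) M : R).
Proof.
move=> M; have [C C0 AC] := linear_bounded A.
have FF := nbhs_filter M.
apply/cvgrPdist_le => e e0; apply/nbhs_eballP.
pose B := C * (2 * enorm M + 1) + 1.
have CM : 0 <= C * (2 * enorm M + 1).
  by apply: mulr_ge0; [exact: ltW|have := enorm_ge0 M; lra].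
have B0 : 0 < B by rewrite ltr_wpDl.
exists (Num.min 1 (e / B)); first by rewrite lt_min ltr01 divr_gt0.
move=> M'; rewrite lt_min ltr_pdivlMr // => /andP[d1 de].
rewrite distrC (_ : _ - _ = mdot (A (M' - M)) M' + mdot (A M) (M' - M)); last first.
  by rewrite linearB mdotBl mdotBr /=; ring.
rewrite (le_trans (ler_normD _ _)) //.
have h1 := le_trans (abs_mdot_le (A (M' - M)) M') (ler_wpM2r (enorm_ge0 _) (AC _)).
have h2 := le_trans (abs_mdot_le (A M) (M' - M)) (ler_wpM2r (enorm_ge0 _) (AC _)).
have h3 : enorm M' <= enorm M + 1.
  by rewrite -[X in enorm X](subrK M) (le_trans (enormD _ _)) // addrC lerD2l ltW.
set d := enorm (M' - M) in h1 h2 d1 de *.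
have d0 : 0 <= d by exact: enorm_ge0.
have h4 : C * d * enorm M' <= C * d * (enorm M + 1).
  by rewrite ler_wpM2l // mulr_ge0 // ltW.
have : d * (C * (2 * enorm M + 1)) <= e.
  by rewrite (le_trans _ (ltW de)) // ler_wpM2l // lerDl.
lra.
Qed.

(** The form becomes coercive when a large multiple of the squared norm is
    added to it. *)
Lemma measurable_energy (A : {linear 'M[R]_(n, m) -> 'M[R]_(n, m)}) f
    (P : 'I_q -> 'cV[R]_m -> 'cV[R]_n) (D : 'I_q -> 'cV[R]_m -> 'M[R]_(n, m)) :
  lipschitz_q f -> (\forall x \ae leb, qdiff_at f (P^~ x) (D^~ x) x) ->
  measurable_fun [set: E] ((fun x => \sum_i mdot (A (D i x)) (D i x)) : E -> R).
Proof.
move=> lf df; have [C C0 AC] := quadratic_form_le A.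
pose quad (M : 'M[R]_(n, m)) := mdot (A M) M + (C + 1) * mdot M M.
have cm : continuous (fun M : 'M[R]_(n, m) => mdot M M).
  by move=> M; exact: (@continuous_quadratic_form idfun).
have cq : continuous quad.
  move=> M; exact: (cvgD (@continuous_quadratic_form A M) (cvgM (cvg_cst (C + 1)) (cm M))).
have qc M : mdot M M <= quad M.
  by have := AC M; rewrite ler_norml /quad => /andP[? _]; lra.
have mq := measurable_sum_quad cq qc lf df.
have mm := measurable_sum_quad cm (fun M => lexx _) lf df.
rewrite (_ : (fun x => _) = (fun x => \sum_i quad (D i x) -
    (C + 1) * (\sum_i mdot (D i x) (D i x)))); last first.
  by apply/funext => x; rewrite mulr_sumr -sumrB; apply: eq_bigr => i _; rewrite addrK.
exact: (measurable_funB mq (measurable_funM (measurable_cst (C + 1)) mm)).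
Qed.

(** Matching optimally in each coordinate direction separately gives
    difference quotients whose squares sum up to at most K ^+ 2 per
    direction. *)
Lemma sum_mdot_bounded f (K : R) : 0 < K ->
  (forall x y, qdist (f x) (f y) <= K * enorm (x - y)) ->
  forall x (P : 'I_q -> 'cV[R]_n) (D : 'I_q -> 'M[R]_(n, m)), qdiff_at f P D x ->
  \sum_i mdot (D i) (D i) <= m%:R * K ^+ 2.
Proof.
move=> K0 fK x P D df; have [fx _ _] := df.
have cm : continuous (fun M : 'M[R]_(n, m) => mdot M M).
  by move=> M; exact: (@continuous_quadratic_form idfun).
have cv := dq_energy_cvg cm (fun M => lexx _) df.
rewrite -(cvg_lim _ cv) //; apply: limr_le; first by apply/cvg_ex; eexists; exact: cv.
apply: nearW => N.
have /choice[S HS] : forall k, exists S, f (x + step R N k) = dirac_sum S /\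
    fnorm (fun i => P i - S i) <= K * N.+1%:R^-1.
  move=> k; have [S fS dS] := qdist_label P (f (x + step R N k)).
  exists S; split=> //; rewrite -dS -fx (le_trans (fK _ _)) //.
  by rewrite opprD addrA subrr sub0r enormN enorm_step.
rewrite (le_trans (dq_energy_le _ fx (fun k => (HS k).1))) //.
rewrite (_ : \sum_i _ = \sum_(k < m) (N.+1%:R * fnorm (fun i => P i - S k i)) ^+ 2); last first.
  under [RHS]eq_bigr do rewrite exprMn sqr_fnorm mulr_sumr.
  rewrite [RHS]exchange_big /=; apply: eq_bigr => i _.
  rewrite [LHS]exchange_big /=; apply: eq_bigr => k _.
  rewrite sqr_enorm mulr_sumr; apply: eq_bigr => a _.
  by rewrite big_ord_recl big_ord0 !mxE; ring.
apply: ler_sum_const => k.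
have NK : N.+1%:R * fnorm (fun i => P i - S k i) <= K.
  by rewrite mulrC -ler_pdivlMr ?ltr0n // (HS k).2.
by rewrite lerXn2r ?nnegrE //; [rewrite mulr_ge0 // fnorm_ge0|exact: ltW].
Qed.

Lemma energy_bounded (A : {linear 'M[R]_(n, m) -> 'M[R]_(n, m)}) f
    (P : 'I_q -> 'cV[R]_m -> 'cV[R]_n) (D : 'I_q -> 'cV[R]_m -> 'M[R]_(n, m)) :
  lipschitz_q f -> (\forall x \ae leb, qdiff_at f (P^~ x) (D^~ x) x) ->
  exists C, \forall x \ae leb, `|\sum_i mdot (A (D i x)) (D i x)| <= C.
Proof.
move=> /lipschitz_q_gt0[K K0 fK] df; have [C C0 AC] := quadratic_form_le A.
exists (C * (m%:R * K ^+ 2)); apply: filterS df => x dfx.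
rewrite (le_trans (ler_norm_sum _ _ _)) //.
rewrite (le_trans (ler_sum _ (fun i _ => AC (D i x)))) // -mulr_sumr ler_pM2l //.
exact: (sum_mdot_bounded K0 fK dfx).
Qed.

(** The barycentre of the sheets, up to the factor q. *)
Definition sheet_sum f (a : 'I_n) x : R := \sum_i qpoint_pts (f x) i a 0.

Lemma sheet_sumE f a x P : f x = dirac_sum P -> sheet_sum f a x = \sum_i P i a 0.
Proof.
rewrite /sheet_sum => ->; have [s sP] := qpoint_pts_dirac P.
rewrite [RHS](reindex_inj (@perm_inj _ s)) /=.
by apply: eq_bigr => i _; rewrite sP.
Qed.

Lemma sheet_sum_lip f a x y : `|sheet_sum f a x - sheet_sum f a y| <= q%:R * qdist (f x) (f y).
Proof.
have [S fS dS] := qdist_label (qpoint_pts (f x)) (f y).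
rewrite (sheet_sumE _ fS) /sheet_sum -sumrB (le_trans (ler_norm_sum _ _ _)) //.
apply: ler_sum_const => i; rewrite -{2}[f x]qpoint_ptsK dS.
have := enorm_entry (qpoint_pts (f x) i - S i) a 0; rewrite !mxE => /le_trans; apply.
exact: (enorm_le_fnorm (fun i => _ - _)).
Qed.

Lemma sheet_sum_dq_cvg f P D x a k : qdiff_at f P D x ->
  (fun N => N.+1%:R * (sheet_sum f a (x + step R N k) - sheet_sum f a x)) @ \oo
     --> \sum_i D i a k.
Proof.
move=> df; have [fx _ _] := df; apply/cvgrPdist_le => e e0.
pose eta := e / q.+1%:R; have eta0 : 0 < eta by rewrite divr_gt0.
apply: filterS (step_labels_near df eta0) => N [S [fS SD]].
rewrite (sheet_sumE _ (fS k)) (sheet_sumE _ fx) -sumrB mulr_sumr distrC -sumrB.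
rewrite (le_trans (ler_norm_sum _ _ _)) // (@le_trans _ _ (q%:R * eta)) //.
  apply: ler_sum_const => i; have := le_trans (enorm_entry _ a k) (SD i).
  by rewrite !mxE.
rewrite /eta mulrCA ger_pMr // ler_pdivrMr // mul1r ler_nat.
exact: leqnSn.
Qed.

End energy_limit.

(** * Integration by parts *)

Section integration_by_parts.
Context (R : realType) (m : nat).
Notation E := (euclid R m).
Implicit Types (x : 'cV[R]_m).

Lemma integrable_box_cst (a b : 'cV[R]_m) (C : R) :
  leb.-integrable [set: E] ((fun x => (C * \1_(box a b : set E) x)%:E) : E -> \bar R).
Proof.
apply: (@integrable_bounded_box _ _ a b `|C| (fun x => C * \1_(box a b) x)).
- apply: measurable_funM => //; apply: measurable_indic; exact: measurable_box.
- by move=> x; rewrite normrM indicE; case: (_ \in _); rewrite ?normr1 ?normr0 ?mulr1 ?mulr0.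
- by move=> x nx; rewrite indicE memNset // mulr0.
Qed.

(** Dominated convergence for sequences dominated by a constant on a box. *)
Lemma bounded_box_convergence (a b : 'cV[R]_m) (C : R) (u : nat -> 'cV[R]_m -> R) (v : 'cV[R]_m -> R) :
  (forall N, measurable_fun [set: E] (u N : E -> R)) ->
  (forall N x, `|u N x| <= C) -> (forall N x, ~ box a b x -> u N x = 0) ->
  (\forall x \ae leb, u ^~ x @ \oo --> v x) ->
  (\int[leb]_(x in [set: E]) (u N x)%:E)%E @[N --> \oo] -->
    (\int[leb]_(x in [set: E]) (v x)%:E)%E.
Proof.
move=> mu uC u0 uv.
have mv : measurable_fun [set: E] (v : E -> R).
  by apply: (@measurable_ae_limit _ _ _ u) => //; apply: filterS uv.
have [|||||_ _ //] := @dominated_convergence _ E R leb setT measurableT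
  (fun N x => (u N x)%:E) (fun x => (v x)%:E) (fun x => (C * \1_(box a b : set E) x)%:E).
- by move=> N; exact/measurable_EFinP.
- exact/measurable_EFinP.
- by apply: filterS uv => x ux _; apply: cvg_EFin => //; exact: nearW.
- exact: integrable_box_cst.
- apply: aeW => x N _; rewrite abse_EFin lee_fin indicE.
  case: (boolP (x \in _)) => [_|/negP]; first by rewrite mulr1.
  by rewrite inE => nx; rewrite u0 // normr0 mulr0.
Qed.

(** Translation invariance gives the identity for difference quotients, and
    dominated convergence for their limits. *)
Lemma integral_dq_parts (k : 'I_m) (a b : 'cV[R]_m) (L Mg Mp : R) (g phi d dphi : 'cV[R]_m -> R) :
  continuous g -> continuous phi ->
  (forall x, `|g x| <= Mg) -> (forall x, `|phi x| <= Mp) ->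
  (forall N x, `|N.+1%:R * (g (x + step R N k) - g x)| <= L) ->
  (forall N x, `|N.+1%:R * (phi x - phi (x - step R N k))| <= L) ->
  (forall N x, ~ box a b x ->
     [/\ g x * phi x = 0, g (x + step R N k) * phi x = 0 & g x * phi (x - step R N k) = 0]) ->
  (\forall x \ae leb, (fun N => N.+1%:R * (g (x + step R N k) - g x)) @ \oo --> d x) ->
  (forall x, (fun N => N.+1%:R * (phi x - phi (x - step R N k))) @ \oo --> dphi x) ->
  (\int[leb]_(x in [set: E]) (d x * phi x)%:E = \int[leb]_(x in [set: E]) (- (g x * dphi x))%:E)%E.
Proof.
move=> cg cphi gM pM gL pL supp gd pd.
have L0 : 0 <= L by exact: le_trans (normr_ge0 _) (gL 0%N 0).
have Mg0 : 0 <= Mg by exact: le_trans (normr_ge0 _) (gM 0).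
have Mp0 : 0 <= Mp by exact: le_trans (normr_ge0 _) (pM 0).
have shift_cont (f : 'cV[R]_m -> R) z : continuous f -> continuous (fun x => f (x + z)).
  move=> cf x B /(cf (x + z)) /nbhs_eballP[r r0 H]; apply/nbhs_eballP; exists r => // y yr.
  by apply: H; rewrite opprD addrACA subrr addr0.
have mg z : measurable_fun [set: E] ((fun x => g (x + z)) : E -> R).
  by apply: measurable_fun_continuous; exact: shift_cont.
have mp z : measurable_fun [set: E] ((fun x => phi (x + z)) : E -> R).
  by apply: measurable_fun_continuous; exact: shift_cont.
have mg0 : measurable_fun [set: E] (g : E -> R) by exact: measurable_fun_continuous.
have mp0 : measurable_fun [set: E] (phi : E -> R) by exact: measurable_fun_continuous.
have mc N : measurable_fun [set: E] (cst N.+1%:R : E -> R) by [].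
pose u N x := N.+1%:R * (g (x + step R N k) - g x) * phi x.
pose v N x := - (g x * (N.+1%:R * (phi x - phi (x - step R N k)))).
have cu : (\int[leb]_(x in [set: E]) (u N x)%:E)%E @[N --> \oo] -->
    (\int[leb]_(x in [set: E]) (d x * phi x)%:E)%E.
  apply: (@bounded_box_convergence a b (L * Mp)).
  - move=> N; exact: (measurable_funM (measurable_funM (mc N)
      (measurable_funB (mg (step R N k)) mg0)) mp0).
  - by move=> N x; rewrite normrM ler_pM.
  - by move=> N x /(supp N)[h1 h2 _]; rewrite /u -mulrA mulrBl h1 h2 subrr mulr0.
  - by apply: filterS gd => x gdx; apply: cvgM => //; exact: cvg_cst.
have cv : (\int[leb]_(x in [set: E]) (v N x)%:E)%E @[N --> \oo] -->
    (\int[leb]_(x in [set: E]) (- (g x * dphi x))%:E)%E.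
  apply: (@bounded_box_convergence a b (Mg * L)).
  - move=> N; exact: (measurable_funN (measurable_funM mg0 (measurable_funM
      (mc N) (measurable_funB mp0 (mp (- step R N k)))))).
  - by move=> N x; rewrite normrN normrM ler_pM.
  - move=> N x /(supp N)[h1 _ h2].
    by rewrite /v mulrCA mulrBr h1 h2 subrr mulr0 oppr0.
  - by apply: aeW => x; apply: cvgN; apply: cvgM; [exact: cvg_cst|exact: pd].
have uv N : (\int[leb]_(x in [set: E]) (u N x)%:E = \int[leb]_(x in [set: E]) (v N x)%:E)%E.
  have i1 : leb.-integrable [set: E] ((fun x => (N.+1%:R * (g x * phi x))%:E) : E -> \bar R).
    apply: (@integrable_bounded_box _ _ a b (N.+1%:R * (Mg * Mp)) (fun x => N.+1%:R * (g x * phi x))).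
    - exact: (measurable_funM (mc N) (measurable_funM mg0 mp0)).
    - by move=> x; rewrite normrM normr_nat ler_wpM2l // normrM ler_pM.
    - by move=> x /(supp N)[-> _ _]; rewrite mulr0.
  have i2 : leb.-integrable [set: E] ((fun x => (N.+1%:R * (g (x + step R N k) * phi x))%:E) : E -> \bar R).
    apply: (@integrable_bounded_box _ _ a b (N.+1%:R * (Mg * Mp))
      (fun x => N.+1%:R * (g (x + step R N k) * phi x))).
    - exact: (measurable_funM (mc N) (measurable_funM (mg (step R N k)) mp0)).
    - by move=> x; rewrite normrM normr_nat ler_wpM2l // normrM ler_pM.
    - by move=> x /(supp N)[_ -> _]; rewrite mulr0.
  have i3 : leb.-integrable [set: E] ((fun x => (N.+1%:R * (g x * phi (x - step R N k)))%:E) : E -> \bar R).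
    apply: (@integrable_bounded_box _ _ a b (N.+1%:R * (Mg * Mp))
      (fun x => N.+1%:R * (g x * phi (x - step R N k)))).
    - exact: (measurable_funM (mc N) (measurable_funM mg0 (mp (- step R N k)))).
    - by move=> x; rewrite normrM normr_nat ler_wpM2l // normrM ler_pM.
    - by move=> x /(supp N)[_ _ ->]; rewrite mulr0.
  transitivity (\int[leb]_(x in [set: E]) (N.+1%:R * (g ((x : 'cV[R]_m) + step R N k)%R * phi x))%:E -
      \int[leb]_(x in [set: E]) (N.+1%:R * (g x * phi x))%:E)%E.
    rewrite -integralB //; apply: eq_integral => x _.
    by rewrite -EFinB /u; congr EFin; ring.
  transitivity (\int[leb]_(x in [set: E]) (N.+1%:R * (g x * phi ((x : 'cV[R]_m) - step R N k)%R))%:E -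
      \int[leb]_(x in [set: E]) (N.+1%:R * (g x * phi x))%:E)%E; last first.
    rewrite -integralB //; apply: eq_integral => x _.
    by rewrite -EFinB /v; congr EFin; ring.
  congr (_ - _)%E.
  rewrite -(@integral_translate _ _ (step R N k) (fun x => (N.+1%:R * (g x * phi (x - step R N k)))%:E)).
    by apply: eq_integral => x _; rewrite addrK.
  exact: measurable_int i3.
apply: (cvg_unique _ cu); first exact: ereal_hausdorff.
by rewrite (_ : (fun N => _) = (fun N => \int[leb]_(x in [set: E]) (v N x)%:E)%E) //; apply/funext.
Qed.

End integration_by_parts.

(** * Distance functions of differentiable Q-valued maps *)

Section eventual_limits.
Context (R : realType).
Implicit Types (u v : nat -> R).

(** Sequences that converge in the extended half-line. *)
Definition cvg_or_pinfty u : Prop :=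
  (exists l : R, u @ \oo --> l) \/ (forall A, \forall N \near \oo, A <= u N).

Lemma cvg_or_pinfty_min u v : cvg_or_pinfty u -> cvg_or_pinfty v ->
  cvg_or_pinfty (fun N => Num.min (u N) (v N)).
Proof.
have one_inf (u1 v1 : nat -> R) (l : R) : u1 @ \oo --> l -> (forall A, \forall N \near \oo, A <= v1 N) ->
    exists l : R, (fun N => Num.min (u1 N) (v1 N)) @ \oo --> l.
  move=> u1l v1A; exists l; apply: (cvg_trans _ u1l); apply: near_eq_cvg.
  have lt_l : l < l + 1 by rewrite ltrDl.
  apply: filterS2 (v1A (l + 1)) (cvgr_lt _ u1l _ lt_l) => N h1 h2.
  by rewrite min_l // ltW // (lt_le_trans h2).
move=> [[l ul]|uA] [[l' vl]|vA].
- left; exists (Num.min l l').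
  rewrite minr_absE (_ : (fun N => _) = (fun N => (u N + v N - `|u N - v N|) / 2)).
    apply: cvgM; last exact: cvg_cst.
    by apply: cvgB; [exact: cvgD|apply: cvg_norm; exact: cvgB].
  by apply/funext => N; rewrite minr_absE.
- by left; exact: one_inf ul vA.
- left; have [l'' H] := one_inf _ _ _ vl uA; exists l''.
  by under eq_fun do rewrite minC.
- right=> A; apply: filterS2 (uA A) (vA A) => N h1 h2.
  by rewrite le_min h1.
Qed.

Lemma cvg_or_pinfty_bigmin (I : finType) (u0 : nat -> R) (w : I -> nat -> R) :
  cvg_or_pinfty u0 -> (forall i, cvg_or_pinfty (w i)) ->
  cvg_or_pinfty (fun N => \big[Num.min/u0 N]_(i : I) w i N).
Proof.
move=> Hu Hw; elim: (index_enum I) => [|i s IH].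
  by under eq_fun do rewrite big_nil.
by under eq_fun do rewrite big_cons; exact: cvg_or_pinfty_min.
Qed.

End eventual_limits.

Section norm_quotients.
Context (R : realType).

(** By convexity the difference quotients of a norm along a half-line are
    monotone. *)
Lemma enorm_dq_cvg (n m : nat) (a b : 'M[R]_(n, m)) :
  exists l : R, (fun N => N.+1%:R * (enorm (a + N.+1%:R^-1 *: b) - enorm a)) @ \oo --> l.
Proof.
apply/cvg_ex; apply: nonincreasing_is_cvgn.
  apply/nonincreasing_seqP => N.
  set s := N.+1%:R^-1 : R; set t := N.+2%:R^-1 : R.
  have s0 : 0 < s by rewrite invr_gt0.
  have t0 : 0 < t by rewrite invr_gt0.
  have ts : t / s <= 1 by rewrite ler_pdivrMr // mul1r lef_pV2 ?posrE // ler_nat.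
  have e : a + t *: b = (1 - t / s) *: a + (t / s) *: (a + s *: b).
    rewrite scalerDr scalerA divfK ?gt_eqF // addrA -scalerDl.
    by rewrite subrK scale1r.
  have := enormD ((1 - t / s) *: a) ((t / s) *: (a + s *: b)).
  rewrite -e !enormZ (ger0_norm (x := 1 - _)) ?subr_ge0 // (ger0_norm (x := t / s)); last first.
    by rewrite divr_ge0 // ltW.
  move=> H; rewrite -[N.+2%:R]invrK -/t -[N.+1%:R]invrK -/s ler_pdivrMl //.
  rewrite mulrA; move: H; set x := enorm _; set y := enorm _; set z := enorm _.
  lra.
exists (- enorm b) => _ [N _ <-].
rewrite -ler_pdivrMl ?ltr0n // mulrN.
have := enormB (a + N.+1%:R^-1 *: b) (N.+1%:R^-1 *: b).
rewrite addrK enormZ ger0_norm ?invr_ge0 //; set x := enorm _; set y := _ * _; lra.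
Qed.

Lemma fnorm_dq_cvg (n q : nat) (a b : 'I_q -> 'cV[R]_n) :
  exists l : R, (fun N => N.+1%:R * (fnorm (fun i => a i + N.+1%:R^-1 *: b i) - fnorm a)) @ \oo --> l.
Proof.
have [l Hl] := enorm_dq_cvg (\matrix_(k, i) a i k 0) (\matrix_(k, i) b i k 0).
exists l; rewrite (_ : (fun N => _) = (fun N => N.+1%:R * (enorm (\matrix_(k, i) a i k 0 +
  N.+1%:R^-1 *: \matrix_(k, i) b i k 0) - enorm (\matrix_(k, i) a i k 0)))) //.
apply/funext => N; rewrite /fnorm; congr (_ * (enorm _ - _)).
by apply/matrixP => k i; rewrite !mxE.
Qed.

End norm_quotients.

Section distance_function.
Context (R : realType) (m q n : nat).
Notation E := (euclid R m).
Implicit Types (f : 'cV[R]_m -> qpoint R q n).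

Lemma qdist_le_matching (P : 'I_q -> 'cV[R]_n) T (s : 'S_q) :
  qdist (dirac_sum P) T <= fnorm (fun i => P i - qpoint_pts T (s i)).
Proof.
rewrite -[T in leLHS]qpoint_ptsK -(dirac_sum_perm (qpoint_pts T) s).
exact: (qdist_dirac_le P (qpoint_pts T \o s)).
Qed.

(** Up to an error that is small compared with the step, f may be replaced by
    its affine approximation, whose distance to T is a minimum of norms over
    the matchings. The quotients of an optimal matching converge, those of
    the others tend to infinity. *)
Lemma qdist_dq_cvg f P D x k (T : qpoint R q n) (K : R) : qdiff_at f P D x ->
  (forall x y, qdist (f x) (f y) <= K * enorm (x - y)) ->
  exists l : R, (fun N => N.+1%:R * (qdist (f (x + step R N k)) T - qdist (f x) T)) @ \oo --> l.
Proof.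
move=> [fx Hf _] fK.
pose lin N := dirac_sum (fun i => P i + D i *m step R N k).
have near_lin : (fun N => N.+1%:R * (qdist (f (x + step R N k)) T - qdist (lin N) T)) @ \oo --> (0 : R).
  apply/cvgrPdist_le => e e0; have := step_near k (Hf e e0); apply: filterS => N.
  rewrite addrAC subrr add0r enorm_step sub0r normrN normrM normr_nat => HN.
  rewrite -ler_pdivlMl ?ltr0n // mulrC.
  by rewrite (le_trans _ HN) // qdist_lipl.
suff [l Hl] : exists l : R, (fun N => N.+1%:R * (qdist (lin N) T - qdist (f x) T)) @ \oo --> l.
  exists l; rewrite -[l]add0r.
  rewrite (_ : (fun N => _) = (fun N => N.+1%:R * (qdist (f (x + step R N k)) T - qdist (lin N) T) +
     N.+1%:R * (qdist (lin N) T - qdist (f x) T))); first exact: cvgD.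
  by apply/funext => N; ring.
pose c (s : 'S_q) N := fnorm (fun i => P i - qpoint_pts T (s i) + N.+1%:R^-1 *: (D i *m delta_mx k 0)).
pose w s N := N.+1%:R * (c s N - qdist (f x) T).
have wP s : cvg_or_pinfty (w s).
  have [l Hl] := fnorm_dq_cvg (fun i => P i - qpoint_pts T (s i)) (fun i => D i *m delta_mx k 0).
  have : qdist (f x) T <= fnorm (fun i => P i - qpoint_pts T (s i)).
    rewrite fx; exact: qdist_le_matching.
  rewrite le_eqVlt => /orP[/eqP e|lt0].
    by left; exists l; rewrite /w e.
  right=> A; set c0 := fnorm _ in Hl lt0.
  have ll : l - 1 < l by rewrite ltrBlDr ltrDl.
  have d0 : 0 < (c0 - qdist (f x) T) / (`|A - l + 1| + 1).
    by rewrite divr_gt0 ?subr_gt0 // ltr_wpDl.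
  apply: filterS2 (cvgr_gt _ Hl _ ll) (natSinv_near d0) => N h1.
  rewrite ltr_pdivlMr; last by rewrite ltr_wpDl.
  rewrite -ltr_pdivlMl ?invr_gt0 // invrK => h2.
  have -> : w s N = N.+1%:R * (c s N - c0) + N.+1%:R * (c0 - qdist (f x) T).
    by rewrite /w; ring.
  move: h1 h2 (ler_norm (A - l + 1)); rewrite -/(c s N).
  set u := _ * (c s N - c0); set v := _ * (c0 - _); lra.
have wE N : N.+1%:R * (qdist (lin N) T - qdist (f x) T) =
    \big[Num.min/w 1%g N]_(s : 'S_q) w s N.
  have cE s : c s N = fnorm (fun i => P i + D i *m step R N k - qpoint_pts T (s i)).
    by rewrite /c; congr fnorm; apply/funext => i; rewrite -scalemxAr addrAC.
  apply/eqP; rewrite eq_le; apply/andP; split.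
    apply: le_bigmin => [|s _]; rewrite ler_pM2l ?ltr0n // lerB // cE;
      exact: qdist_le_matching.
  have [S TS ->] := qdist_label (fun i => P i + D i *m step R N k) T.
  have /dirac_sumP[s Ss] : dirac_sum S = dirac_sum (qpoint_pts T) by rewrite -TS qpoint_ptsK.
  apply: (@le_trans _ _ (w s N)); first by apply: bigmin_le_cond.
  rewrite /w cE le_eqVlt; apply/orP; left; apply/eqP; congr (_ * (fnorm _ - _)).
  by apply/funext => i; rewrite Ss.
have : cvg_or_pinfty (fun N => N.+1%:R * (qdist (lin N) T - qdist (f x) T)).
  under eq_fun do rewrite wE.
  exact: cvg_or_pinfty_bigmin.
move=> [//|/(_ (K + 2)) HA].
have lt01' : -1 < 0 :> R by rewrite ltrN10.
have [N [h1 h2]] := filter_ex (filterI HA (cvgr_gt _ near_lin _ lt01')).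
have h3 : N.+1%:R * (qdist (f (x + step R N k)) T - qdist (f x) T) <= K.
  rewrite -ler_pdivlMl ?ltr0n // mulrC (le_trans (ler_norm _)) // (le_trans (qdist_lipl _ _ _)) //.
  by rewrite (le_trans (fK _ _)) // addrAC subrr add0r enorm_step.
move: h1 h2 h3 => /=; set u := qdist _ _; set v := qdist (lin N) T; set z := qdist _ _; lra.
Qed.

End distance_function.

(** * Lipschitz Q-valued maps are Sobolev maps *)

Lemma enorm_trmx (R : realType) (n m : nat) (M : 'M[R]_(n, m)) : enorm M^T = enorm M.
Proof.
rewrite /enorm /mdot exchange_big /=; congr Num.sqrt.
by apply: eq_bigr => i _; apply: eq_bigr => j _; rewrite mxE.
Qed.

Section compact_sets.
Context (R : realType) (m : nat).

Lemma compact_enorm_bounded (K : set 'cV[R]_m) : compact K ->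
  exists2 r, 0 < r & forall x, K x -> enorm x <= r.
Proof.
move=> /compact_bounded[M [_ MK]].
exists (1 + (m * 1)%:R * (`|M| + 1)); first by rewrite ltr_pwDl // mulr_ge0 // addr_ge0.
move=> x Kx; rewrite (le_trans (enorm_le_mx_norm x)) // ler_wpDl // ler_wpM2l //.
by apply: MK => //; rewrite (le_lt_trans (ler_norm M)) // ltrDl.
Qed.

Lemma closed_box (a b : 'cV[R]_m) : closed (box a b).
Proof.
rewrite (_ : box a b = \bigcap_(i in [set: 'I_m]) ((fun x : 'cV[R]_m => x i 0) @^-1` `[a i 0, b i 0])).
  apply: closed_bigI => i _; apply: preimage_closed; last exact: itv_closed.
  by move=> x _; exact: coord_continuous.
apply/seteqP; split=> x H i; first by move=> _; rewrite /= in_itv /=; exact: H.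
by have := H i I; rewrite /= in_itv.
Qed.

Lemma compact_box (a b : 'cV[R]_m) : compact (box a b).
Proof.
pose A (i : 'I_m) : set R := `[a i 0, b i 0]%classic.
have cA : compact [set v : 'rV[R]_m | forall i, A i (v ord0 i)].
  by apply: rV_compact => i; exact: segment_compact.
rewrite (_ : box a b = trmx @` [set v : 'rV[R]_m | forall i, A i (v ord0 i)]).
  apply: continuous_compact => //; apply: continuous_subspaceT => v B /nbhs_eballP[r r0 H].
  apply/nbhs_eballP; exists r => // w wr; apply: H.
  by rewrite -linearB /= enorm_trmx.
apply/seteqP; split=> [x xab|_ [v vA <-] i].
  exists x^T; last by rewrite trmxK.
  by move=> i; rewrite mxE /A /= in_itv /=; exact: xab.
by have := vA i; rewrite /A /= in_itv /= mxE.
Qed.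

Definition open_cube : set 'cV[R]_m := [set x | forall i, `|x i 0| < 2^-1].

Lemma cubeP (x : 'cV[R]_m) : cube x <-> forall i, `|x i 0| <= 2^-1.
Proof.
by split=> H i; have := H i; rewrite !mxE ler_norml.
Qed.

Lemma interior_cube : interior cube = open_cube.
Proof.
apply/seteqP; split=> x.
  move=> /nbhs_eballP[r r0 H] i.
  have H2 e : `|e| < r -> `|x i 0 + e| <= 2^-1.
    move=> er; have /cubeP/(_ i) : cube (x + e *: delta_mx i 0).
      by apply: H; rewrite addrAC subrr add0r enormZ enorm_delta mulr1.
    by rewrite !mxE !eqxx mulr1.
  have r2 : `|r / 2| < r by rewrite ger0_norm ?divr_ge0 // ?ltW //; lra.
  have r2' : `|- (r / 2)| < r by rewrite normrN.
  have := H2 _ r2; have := H2 _ r2'; rewrite !ler_norml ltr_norml => /andP[? ?] /andP[? ?].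
  by apply/andP; split; lra.
move=> xo.
pose r := \big[Num.min/1]_i (2^-1 - `|x i 0|).
have r0 : 0 < r by apply/bigmin_gtP; split=> // i _; rewrite subr_gt0.
apply/nbhs_eballP; exists r => // y yr; apply/cubeP => i.
have h1 := enorm_entry (y - x) i 0.
have h2 : r <= 2^-1 - `|x i 0| by apply: bigmin_le_cond.
have h3 := ler_normD (y i 0 - x i 0) (x i 0); rewrite subrK in h3.
rewrite !mxE in h1; lra.
Qed.

End compact_sets.

Section test_functions.
Context (R : realType) (m : nat).
Notation E := (euclid R m).
Implicit Types (phi : 'cV[R]_m -> R) (x : 'cV[R]_m).

Lemma is_derive_line phi k x t : derivable phi (x + t *: delta_mx k 0) (delta_mx k 0) ->
  is_derive t (1 : R) (fun t => phi (x + t *: delta_mx k 0) : R) (partial k phi (x + t *: delta_mx k 0)).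
Proof.
move=> dphi.
have e : (fun h : R => h^-1 *: (((fun t => phi (x + t *: delta_mx k 0)) \o shift t) (h *: (1 : R)) -
      phi (x + t *: delta_mx k 0))) =
   (fun h : R => h^-1 *: ((phi \o shift (x + t *: delta_mx k 0)) (h *: delta_mx k 0) -
      phi (x + t *: delta_mx k 0))).
  apply/funext => h /=; congr (_ *: (phi _ - _)).
  by rewrite /shift /= scalerDl [h *: 1]mulr1 addrCA.
split; first by rewrite /derivable e.
by rewrite /derive e.
Qed.

Lemma continuous_line phi x (e : 'cV[R]_m) : continuous phi ->
  continuous (fun t : R => phi (x + t *: e)).
Proof.
move=> cphi t B /(cphi (x + t *: e)) /nbhs_eballP[r r0 H].
apply/nbhs_ballP; exists (r / (enorm e + 1)) => /=.
  by rewrite divr_gt0 // ltr_wpDl // enorm_ge0.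
move=> s; rewrite -ball_normE /ball_ /= ltr_pdivlMr; last by rewrite ltr_wpDl // enorm_ge0.
move=> st; apply: H; rewrite opprD addrACA subrr add0r -scalerBl enormZ distrC.
by rewrite (le_lt_trans _ st) // ler_wpM2l // lerDl.
Qed.

Lemma partial_mvt phi k M x t : continuous phi ->
  (forall x, derivable phi x (delta_mx k 0)) -> (forall x, `|partial k phi x| <= M) ->
  0 <= t -> `|phi (x + t *: delta_mx k 0) - phi x| <= M * t.
Proof.
move=> cphi dphi pM; rewrite le_eqVlt => /orP[/eqP <-|t0].
  by rewrite scale0r addr0 subrr normr0 mulr0.
have [|c _] := @MVT _ (fun t => phi (x + t *: delta_mx k 0) : R)
    (fun t => partial k phi (x + t *: delta_mx k 0)) 0 t t0 (fun s _ => is_derive_line (dphi _)) _.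
  by apply: continuous_subspaceT; exact: continuous_line.
rewrite scale0r addr0 subr0 => ->; rewrite normrM (gtr0_norm t0).
by rewrite ler_wpM2r // ltW.
Qed.

Lemma partial_dq_cvg phi k x : derivable phi x (delta_mx k 0) ->
  (fun N => N.+1%:R * (phi x - phi (x - step R N k))) @ \oo --> partial k phi x.
Proof.
move=> dphi; have cv : h^-1 *: (phi (h *: delta_mx k 0 + x) - phi x) @[h --> (0:R)^'] --> partial k phi x.
  exact: dphi.
have : (fun N => - N.+1%:R^-1 : R) @ \oo --> (0 : R)^'.
  move=> A /nbhs_ballP[r /= r0 H]; apply: filterS (natSinv_near r0) => N Nr.
  apply: H; last by rewrite oppr_eq0 invr_eq0 pnatr_eq0.
  by rewrite -ball_normE /ball_ /= sub0r opprK ger0_norm.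
move=> /cvg_comp/(_ cv); apply: cvg_trans; apply: near_eq_cvg; apply: nearW => N /=.
have -> : - N.+1%:R^-1 *: delta_mx k 0 + x = x - step R N k.
  by rewrite scaleNr addrC.
by rewrite invrN invrK /GRing.scale /=; ring.
Qed.

Section cube_test.
Variable (phi : 'cV[R]_m -> R).
Hypothesis tphi : test_function (interior cube) phi.

Lemma test_continuous : continuous phi.
Proof. by have [/(_ 0%N)[]] := tphi. Qed.

Lemma test_derivable k x : derivable phi x (delta_mx k 0).
Proof. by have [/(_ 1%N)[_ /(_ k)[]]] := tphi. Qed.

Lemma test_partial_continuous k : continuous (partial k phi).
Proof. by have [/(_ 1%N)[_ /(_ k)[_ []]]] := tphi. Qed.

Lemma test_eq0 x : ~ cube x -> phi x = 0.
Proof.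
have [_ [K [_ Kc K0]]] := tphi; move=> nx; apply: K0 => /Kc.
by move=> /nbhs_singleton.
Qed.

Lemma partial_eq0 k x : ~ cube x -> partial k phi x = 0.
Proof.
move=> nx; have /nbhs_eballP[r r0 H] : nbhs x (~` cube).
  by apply: open_nbhs_nbhs; split=> //; rewrite openC; exact: closed_box.
have z y : enorm (y - x) < r -> phi y = 0 by move=> /H; exact: test_eq0.
have := partial_dq_cvg (@test_derivable k x).
move/cvg_lim => <- //; apply/cvg_lim => //.
apply: (@cvg_trans _ ((fun=> 0 : R) @ \oo)); last exact: cvg_cst.
apply: near_eq_cvg; apply: filterS (natSinv_near r0) => N Nr.
rewrite !z ?subrr ?enorm0 ?mulr0 //.
by rewrite addrAC subrr add0r enormN enorm_step.
Qed.

Lemma cube_bounded (h : 'cV[R]_m -> R) : continuous h -> (forall x, ~ cube x -> h x = 0) ->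
  exists2 M, 0 < M & forall x, `|h x| <= M.
Proof.
move=> ch h0; have : compact (h @` cube).
  by apply: continuous_compact; [exact: continuous_subspaceT|exact: compact_box].
move=> /compact_bounded[M [_ HM]]; exists (`|M| + 1); first by rewrite ltr_wpDl.
move=> x; have [cx|cx] := pselect (cube x); last by rewrite h0 // normr0 addr_ge0.
by apply: HM; [rewrite (le_lt_trans (ler_norm M)) // ltrDl|exists x].
Qed.

End cube_test.
End test_functions.

Section lipschitz_sobolev.
Context (R : realType) (m q n : nat).
Notation E := (euclid R m).
Implicit Types (f : 'cV[R]_m -> qpoint R q n).

Lemma lipschitz_qdist_continuous f T : lipschitz_q f -> continuous (fun x => qdist (f x) T).
Proof.
move=> /lipschitz_q_gt0[K K0 fK] x; have FF := nbhs_filter x.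
apply/cvgrPdist_le => e e0; apply/nbhs_eballP; exists (e / K); first by rewrite divr_gt0.
move=> y; rewrite ltr_pdivlMr // => yx.
rewrite (le_trans (qdist_lipl _ _ _)) // (le_trans (fK _ _)) // enorm_distC mulrC.
exact: ltW.
Qed.

Lemma compactly_supported_qdist_bounded f T : lipschitz_q f -> compactly_supported f ->
  exists M, forall x, `|qdist (f x) T| <= M.
Proof.
move=> /lipschitz_q_gt0[K K0 fK] [B [cB fB]]; have [r r0 Br] := compact_enorm_bounded cB.
exists (qdist (dirac_sum (fun=> 0)) T + (qdist (f 0) T + K * r)) => x.
rewrite ger0_norm ?qdist_ge0 //; have [Bx|/fB ->] := pselect (B x); last first.
  by rewrite lerDl addr_ge0 ?qdist_ge0 // mulr_ge0 // ltW.
rewrite ler_wpDl ?qdist_ge0 // (le_trans (qdist_triangle _ (f 0) _)) // addrC lerD2l.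
by rewrite (le_trans (fK _ _)) // subr0 ler_pM2l // Br.
Qed.

Lemma integral_cubeE (h : 'cV[R]_m -> \bar R) : (forall x, ~ cube x -> h x = 0%E) ->
  (\int[leb]_(x in (cube : set E)) h x = \int[leb]_(x in [set: E]) h x)%E.
Proof.
move=> h0; rewrite integral_mkcond; apply: eq_integral => x _; rewrite patchE.
by case: ifPn => // /negP; rewrite inE => /h0.
Qed.

Definition big_box (x : 'cV[R]_m) : Prop := box (const_mx (-2)) (const_mx 2) x.

Lemma cube_big_box (x z : 'cV[R]_m) : enorm z <= 1 -> cube (x - z) -> big_box x.
Proof.
move=> z1 /cubeP H i; have := H i; have := le_trans (enorm_entry z i 0) z1.
by rewrite !mxE !ler_norml => /andP[? ?] /andP[? ?]; apply/andP; split; lra.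
Qed.

Lemma enorm_step_le1 N (k : 'I_m) : enorm (step R N k) <= 1.
Proof. by rewrite enorm_step invf_le1 ?ler1n // ltr0n. Qed.

(** At the points where f is differentiable, the distance of f to T has
    one-sided partial derivatives, and by discrete integration by parts these
    form its weak gradient. *)
Lemma lipschitz_sobolev f P D : lipschitz_q f -> compactly_supported f ->
  (\forall x \ae leb, qdiff_at f (P^~ x) (D^~ x) x) -> sobolev_q f.
Proof.
move=> lf sf df; have [K K0 fK] := lipschitz_q_gt0 lf; split=> [U oU|].
  apply: measurableI; first exact: measurable_cube.
  apply: measurable_open; rewrite openE => x /= Ufx.
  have [r r0 rU] := oU _ Ufx; apply/nbhs_eballP; exists (r / K); first by rewrite divr_gt0.
  move=> y; rewrite ltr_pdivlMr // => yx; apply: rU.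
  by rewrite (le_lt_trans (fK _ _)) // enorm_distC mulrC.
exists (fun=> m%:R * K); split.
- split; first exact: measurable_cst.
  by exists (m%:R * K); apply: aeW => x _; rewrite ger0_norm // mulr_ge0 // ltW.
- by move=> x _; rewrite mulr_ge0 // ltW.
move=> T.
pose g x := qdist (f x) T.
pose dq k x N := N.+1%:R * (g (x + step R N k) - g x).
pose Dg x : 'cV[R]_m := \col_k limn (dq k x).
have cg : continuous g by exact: lipschitz_qdist_continuous.
have dqK k x N : `|dq k x N| <= K.
  rewrite normrM normr_nat -ler_pdivlMl ?ltr0n // mulrC (le_trans (qdist_lipl _ _ _)) //.
  by rewrite (le_trans (fK _ _)) // addrAC subrr add0r enorm_step.
have dqcv : \forall x \ae leb, forall k, dq k x @ \oo --> Dg x k 0.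
  apply: filterS df => x dfx k; have [l Hl] := qdist_dq_cvg k T dfx fK.
  by rewrite mxE (cvg_lim _ Hl).
have Dgk k : \forall x \ae leb, `|Dg x k 0| <= K.
  apply: filterS dqcv => x /(_ k) H; rewrite -(cvg_lim _ (cvg_norm H)) //.
  apply: limr_le; last by apply: nearW => N; exact: dqK.
  by apply/cvg_ex; eexists; exact: cvg_norm H.
have mg z : measurable_fun [set: E] ((fun x => g (x + z)) : E -> R).
  apply: measurable_fun_continuous => x B /(cg (x + z)) /nbhs_eballP[r r0 H].
  apply/nbhs_eballP; exists r => // y yr.
  by apply: H; rewrite opprD addrACA subrr addr0.
have mg0 : measurable_fun [set: E] (g : E -> R) by exact: measurable_fun_continuous.
have mDg k : measurable_fun [set: E] ((fun x => Dg x k 0) : E -> R).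
  have mdq N : measurable_fun [set: E] ((fun x => dq k x N) : E -> R).
    have mc : measurable_fun [set: E] (cst N.+1%:R : E -> R) by [].
    exact: (measurable_funM mc (measurable_funB (mg (step R N k)) mg0)).
  have lim_dq : \forall x \ae leb, [set: E] x -> (fun N => dq k x N) @ \oo --> Dg x k 0.
    by apply: filterS dqcv => x H _; exact: H.
  exact: (measurable_ae_limit measurableT mdq lim_dq).
have [Mg gM] := compactly_supported_qdist_bounded T lf sf.
exists Dg; split; last first.
  have : \forall x \ae leb, forall k, `|Dg x k 0| <= K by apply: filter_forall.
  apply: filterS => x H _; rewrite (le_trans (enorm_le_sum _)) //.
  by apply: ler_sum_const => k; rewrite big_ord_recl big_ord0 addr0.
split.
- split; first exact: measurable_funTS.
  by exists Mg; apply: aeW => x _; exact: gM.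
- move=> k; split; first exact: measurable_funTS.
  by exists K; apply: filterS (Dgk k) => x Hx _.
move=> phi tphi k.
have cphi := test_continuous tphi.
have dphi x : derivable phi x (delta_mx k 0) by exact: (@test_derivable _ _ _ tphi).
have [Mp Mp0 pM] := cube_bounded cphi (@test_eq0 _ _ _ tphi).
have [Md Md0 dM] := cube_bounded (@test_partial_continuous _ _ _ tphi k) (@partial_eq0 _ _ _ tphi k).
rewrite !integral_cubeE; try by move=> x nx; rewrite ?(partial_eq0 tphi) ?(test_eq0 tphi) // mulr0.
have vanish x N : ~ big_box x -> phi x = 0 /\ phi (x - step R N k) = 0.
  move=> nx; split; apply: (test_eq0 tphi) => cx; apply: nx.
    by apply: (@cube_big_box x 0); rewrite ?enorm0 // subr0.
  by apply: cube_big_box cx; exact: enorm_step_le1.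
have pd N x : `|N.+1%:R * (phi x - phi (x - step R N k))| <= Num.max K Md.
  have Ni : 0 <= N.+1%:R^-1 :> R by rewrite invr_ge0.
  have := partial_mvt (x - step R N k) cphi dphi dM Ni; rewrite subrK => H.
  rewrite normrM normr_nat -ler_pdivlMl ?ltr0n // mulrC (le_trans H) //.
  by rewrite ler_wpM2r // le_max lexx orbT.
have gd N x : `|N.+1%:R * (g (x + step R N k) - g x)| <= Num.max K Md.
  by rewrite (le_trans (dqK k x N)) // le_max lexx.
have -> := @integral_dq_parts _ _ k (const_mx (-2)) (const_mx 2) _ _ _ _ _
  (fun x => Dg x k 0) (partial k phi) cg cphi gM pM gd pd.
- under [X in (- X)%E]eq_integral do rewrite EFinN.
  rewrite integralN ?oppeK //.
  have : leb.-integrable [set: E] (EFin \o ((fun x => g x * partial k phi x) : E -> R)).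
    apply: (@integrable_bounded_box _ _ (const_mx (-2)) (const_mx 2) (Mg * Md)).
    - have mp : measurable_fun [set: E] (partial k phi : E -> R).
        exact: (measurable_fun_continuous (@test_partial_continuous _ _ _ tphi k)).
      exact: (measurable_funM mg0 mp).
    - by move=> x; rewrite normrM; apply: ler_pM => //; exact: gM.
    - move=> x nx; rewrite (partial_eq0 tphi) ?mulr0 // => cx; apply: nx.
      by apply: (@cube_big_box x 0); rewrite ?enorm0 // subr0.
  by move=> H; rewrite fin_num_adde_defr //; exact: integrable_pos_fin_num.
- by move=> N x /(vanish x N)[-> ->]; rewrite !mulr0.
- by apply: filterS dqcv => x; exact.
- by move=> x; exact: partial_dq_cvg.
Qed.

End lipschitz_sobolev.

(** * Energies as integrals *)

Lemma sum_blocks (V : nmodType) (J Q : nat) (q : 'I_J -> nat) (eQ : Q = (\sum_j q j)%N)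
    (F : forall j, 'I_(q j) -> V) :
  \sum_(i < Q) F (tagnat.sig1 (cast_ord eQ i)) (tagnat.sig2 (cast_ord eQ i)) =
  \sum_j \sum_(k < q j) F j k.
Proof.
rewrite sig_big_dep /= (reindex (@tagnat.sig _ q)) /=; last exact/onW_bij/tagnat.sig_bij.
rewrite [RHS](reindex (cast_ord eQ)) //; apply: onW_bij.
by exists (cast_ord (esym eQ)); [exact: cast_ordK|exact: cast_ordKV].
Qed.

Section energies.
Context (R : realType) (m q n : nat).
Notation E := (euclid R m).
Implicit Types (f : 'cV[R]_m -> qpoint R q n).

Lemma ae_bounded_box_integrable (a b : 'cV[R]_m) C (h : 'cV[R]_m -> R) :
  measurable_fun [set: E] (h : E -> R) ->
  (\forall x \ae leb, `|h x| <= C) -> (\forall x \ae leb, ~ box a b x -> h x = 0) ->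
  leb.-integrable [set: E] (EFin \o (h : E -> R)).
Proof.
move=> mh hC h0.
pose h' x := if `[< box a b x /\ `|h x| <= C >] then h x else 0.
have hh' : \forall x \ae leb, h x = h' x.
  apply: filterS2 hC h0 => x hxC hx0; rewrite /h'; case: ifPn => // /asboolPn H.
  by apply: hx0 => bx; apply: H.
have mh' : measurable_fun [set: E] (h' : E -> R).
  by apply: ae_measurable mh; apply: filterS hh' => x hx _.
have ih' : leb.-integrable [set: E] (EFin \o (h' : E -> R)).
  apply: (@integrable_bounded_box _ _ a b `|C|) => // x; rewrite /h'.
    case: ifPn => [/asboolP[_ hxC]|_]; last by rewrite normr0.
    by rewrite (le_trans hxC) // ler_norm.
  by move=> nx; case: ifPn => // /asboolP[].
have meh : measurable_fun [set: E] (EFin \o (h : E -> R)) by exact/measurable_EFinP.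
have meh' : measurable_fun [set: E] (EFin \o (h' : E -> R)) by exact/measurable_EFinP.
have ma : measurable_fun [set: E] (abse \o (EFin \o (h : E -> R))).
  exact: (measurableT_comp (@abse_measurable R setT) meh).
have ma' : measurable_fun [set: E] (abse \o (EFin \o (h' : E -> R))).
  exact: (measurableT_comp (@abse_measurable R setT) meh').
have hha : \forall x \ae leb, [set: E] x ->
    (abse \o (EFin \o (h : E -> R))) x = (abse \o (EFin \o (h' : E -> R))) x.
  by apply: filterS hh' => x hx _ /=; rewrite hx.
apply/integrableP; split=> //.
move/integrableP : ih' => [_]; apply: le_lt_trans.
have -> // := @ge0_ae_eq_integral _ E R leb setT _ _ measurableT ma ma'
  (fun x _ => abse_ge0 _) (fun x _ => abse_ge0 _) hha.
Qed.

Lemma integral_cube_ae (h : 'cV[R]_m -> R) :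
  measurable_fun [set: E] (h : E -> R) ->
  (\forall x \ae leb, ~ cube x -> h x = 0) ->
  (\int[leb]_(x in (cube : set E)) (h x)%:E = \int[leb]_(x in [set: E]) (h x)%:E)%E.
Proof.
move=> mh h0; rewrite integral_mkcond.
have meh : measurable_fun [set: E] (EFin \o (h : E -> R)) by exact/measurable_EFinP.
have mr : measurable_fun [set: E] ((EFin \o (h : E -> R)) \_ cube).
  by apply: ((measurable_restrictT _ (@measurable_cube R m)).1); exact: measurable_funTS.
apply: (@ae_eq_integral _ E R leb setT _ _ measurableT mr meh).
apply: filterS h0 => x hx _; rewrite patchE; case: ifPn => // /negP; rewrite inE => nx.
by rewrite /= hx.
Qed.

Lemma dirac_sum_cst (P : 'I_q -> 'cV[R]_n) (c : 'cV[R]_n) :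
  dirac_sum P = dirac_sum (fun=> c) -> forall i, P i = c.
Proof. by move=> /dirac_sumP[s Ps] i; rewrite Ps. Qed.

(** The difference quotients of f in x vanish for small steps. *)
Lemma qdiff_locally_const f (P : 'I_q -> 'cV[R]_n) (D : 'I_q -> 'M[R]_(n, m)) x :
  qdiff_at f P D x -> (\forall y \near x, f y = dirac_sum (fun=> 0)) ->
  \sum_i mdot (D i) (D i) = 0.
Proof.
move=> df fy; have [fx _ _] := df.
have cm : continuous (fun M : 'M[R]_(n, m) => mdot M M).
  by move=> M; exact: (@continuous_quadratic_form _ _ _ idfun).
have cv := dq_energy_cvg cm (fun M => lexx _) df.
rewrite -(cvg_lim _ cv) //; apply/cvg_lim => //.
apply: (@cvg_trans _ ((fun=> 0 : R) @ \oo)); last exact: cvg_cst.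
apply: near_eq_cvg.
have fN : \forall N \near \oo, forall k, f (x + step R N k) = dirac_sum (fun=> 0).
  by apply: filter_forall => k; exact: (step_near (A := fun y => f y = _) k fy).
apply: filterS fN => N fN.
apply/eqP; rewrite eq_le; apply/andP; split.
  apply: lb_le_inf; first exact: dq_values_nonempty.
  exact: (dq_values_lbound (fun M => lexx _)).
have fx0 : f x = dirac_sum (fun=> 0) by exact: nbhs_singleton fy.
rewrite (le_trans (dq_energy_le (fun M => lexx _) fx0 fN)) //.
rewrite big1 // => i _; rewrite (_ : dqmx _ _ _ _ = 0).
  by rewrite -sqr_enorm enorm0 expr0n.
by apply/matrixP => a k; rewrite !mxE subrr mulr0.
Qed.

Lemma energy_eq0 (A : {linear 'M[R]_(n, m) -> 'M[R]_(n, m)}) (D : 'I_q -> 'M[R]_(n, m)) :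
  \sum_i mdot (D i) (D i) = 0 -> \sum_i mdot (A (D i)) (D i) = 0.
Proof.
move=> D0; have [C C0 AC] := quadratic_form_le A.
apply/eqP; rewrite -normr_eq0 eq_le normr_ge0 andbT (le_trans (ler_norm_sum _ _ _)) //.
by rewrite (le_trans (ler_sum _ (fun i _ => AC (D i)))) // -mulr_sumr D0 mulr0.
Qed.

Lemma energy_supp (A : {linear 'M[R]_(n, m) -> 'M[R]_(n, m)}) f (a b : 'cV[R]_m)
    (P : 'I_q -> 'cV[R]_m -> 'cV[R]_n) (D : 'I_q -> 'cV[R]_m -> 'M[R]_(n, m)) :
  (forall x, ~ box a b x -> f x = dirac_sum (fun=> 0)) ->
  (\forall x \ae leb, qdiff_at f (P^~ x) (D^~ x) x) ->
  \forall x \ae leb, ~ box a b x -> \sum_i mdot (A (D i x)) (D i x) = 0.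
Proof.
move=> f0; apply: filterS => x dfx nx; apply: energy_eq0; apply: (qdiff_locally_const dfx).
have : nbhs x (~` box a b).
  by apply: open_nbhs_nbhs; split=> //; rewrite openC; exact: closed_box.
by apply: filterS => y; exact: f0.
Qed.

Lemma energy_integrable (A : {linear 'M[R]_(n, m) -> 'M[R]_(n, m)}) f (a b : 'cV[R]_m)
    (P : 'I_q -> 'cV[R]_m -> 'cV[R]_n) (D : 'I_q -> 'cV[R]_m -> 'M[R]_(n, m)) :
  lipschitz_q f -> (forall x, ~ box a b x -> f x = dirac_sum (fun=> 0)) ->
  (\forall x \ae leb, qdiff_at f (P^~ x) (D^~ x) x) ->
  leb.-integrable [set: E]
    (EFin \o ((fun x => \sum_i mdot (A (D i x)) (D i x)) : E -> R)).
Proof.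
move=> lf f0 df; have [C HC] := energy_bounded A lf df.
exact: (ae_bounded_box_integrable (measurable_energy A lf df) HC (energy_supp A f0 df)).
Qed.

(** The boundary of the cube is contained in finitely many degenerate boxes. *)
Lemma ae_interior_cube : \forall x \ae (@leb R m), cube x -> interior cube x.
Proof.
pose sg (s : bool) : R := if s then 2^-1 else - 2^-1.
pose face (p : bool * 'I_m) : set 'cV[R]_m :=
  box (\col_j (if j == p.2 then sg p.1 else - 2^-1)) (\col_j (if j == p.2 then sg p.1 else 2^-1)).
have face0 : \forall x \ae (@leb R m), forall p, ~ face p x.
  apply: filter_forall => p; exists (face p); split; first exact: measurable_box.
    by rewrite [LHS]leb_box /box_volume (bigD1 p.2) //= !mxE eqxx subrr maxxx mul0r.
  by move=> x /contrapT.
apply: filterS face0 => x Hx /cubeP cx; rewrite interior_cube => i.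
rewrite lt_neqAle cx andbT; apply/negP => /eqP e.
apply: (Hx (0 <= x i 0, i)) => j; rewrite !mxE /=.
case: eqP => [->|_]; last by have := cx j; rewrite ler_norml.
rewrite /sg; move: e; case: (leP 0 (x i 0)) => x0; first by rewrite ger0_norm // => ->; rewrite lexx.
by rewrite ltr0_norm // => <-; rewrite opprK lexx.
Qed.

End energies.

(** * Quasiconvexity implies semiellipticity *)

Section rescaling.
Context (R : realType) (m q n : nat).
Notation E := (euclid R m).
Implicit Types (f : 'cV[R]_m -> qpoint R q n).

Lemma lipschitz_rescale f c : lipschitz_q f -> lipschitz_q (fun x => f (c *: x)).
Proof.
move=> /lipschitz_q_gt0[K K0 fK]; exists (K * `|c|) => x y.
by rewrite (le_trans (fK _ _)) // -scalerBr enormZ mulrA.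
Qed.

Lemma qdiff_rescale f (P : 'I_q -> 'cV[R]_n) (D : 'I_q -> 'M[R]_(n, m)) c x : 0 < c ->
  qdiff_at f P D (c *: x) -> qdiff_at (fun x => f (c *: x)) P (fun i => c *: D i) x.
Proof.
move=> c0 [fx H PD]; split=> // [e e0|i j Pij]; last by rewrite (PD _ _ Pij).
have ec : 0 < e / c by rewrite divr_gt0.
have /nbhs_eballP[r r0 Hr] := H _ ec.
apply/nbhs_eballP; exists (r / c); first by rewrite divr_gt0.
move=> y; rewrite ltr_pdivlMr // mulrC => yx.
have n1 : enorm (c *: y - c *: x) = c * enorm (y - x).
  by rewrite -scalerBr enormZ gtr0_norm.
have yr : enorm (c *: y - c *: x) < r by rewrite n1.
have n2 : e / c * enorm (c *: y - c *: x) = e * enorm (y - x).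
  by rewrite n1 mulrA divfK // gt_eqF.
have lin : (fun i => P i + (c *: D i) *m (y - x)) =
    (fun i => P i + D i *m (c *: y - c *: x)).
  by apply/funext => i; rewrite -scalerBr -scalemxAl -scalemxAr.
by have := Hr _ yr; rewrite n2 lin.
Qed.

End rescaling.

Section quasiconvex_semielliptic.
Context (R : realType) (m n Q : nat).
Notation E := (euclid R m).
Variable A : {linear 'M[R]_(n, m) -> 'M[R]_(n, m)}.

(** A compactly supported map is scaled so that its support lies in the open
    cube, where it competes with the constant map of value Q[[0]] and zero
    energy. Scaling multiplies the energy by a positive number. *)
Lemma quasiconvex_semielliptic :
  quasiconvex (quadratic_integrand (Q := Q) A) -> semielliptic Q A.
Proof.
move=> [_ _ qc] f fi Dfi lf sf af.
have df := approx_differential_qdiff lf af.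
have [B [cB fB]] := sf; have [r r0 Br] := compact_enorm_bounded cB.
(* The support lies in the ball of radius r, and |c x| > r as soon as a
   coordinate of x has absolute value at least 1/2. *)
pose c := 2 * (r + 1); have c0 : 0 < c by rewrite mulr_gt0 // addr_gt0.
pose w (x : 'cV[R]_m) := f (c *: x).
have out (x : 'cV[R]_m) : (exists i, 2^-1 <= `|x i 0|) -> w x = dirac_sum (fun=> 0).
  move=> [i xi]; apply: fB => /Br; rewrite enormZ gtr0_norm //.
  apply/negP; rewrite -ltNge (@lt_le_trans _ _ (c * 2^-1)) //.
    by rewrite /c mulrAC mulfV ?mul1r ?ltrDl.
  by rewrite ler_pM2l // (le_trans xi) // enorm_entry.
have wcube x : ~ cube x -> w x = dirac_sum (fun=> 0).
  move=> nx; apply: out; apply: contrapT => H; apply: nx; apply/cubeP => i.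
  by rewrite leNgt; apply/negP => xi; apply: H; exists i; exact: ltW.
have lw : lipschitz_q w by exact: lipschitz_rescale.
have sw : compactly_supported w by exists cube; split=> //; exact: compact_box.
pose wi i (x : 'cV[R]_m) := fi i (c *: x).
pose Dwi i (x : 'cV[R]_m) := c *: Dfi i (c *: x).
have dw : \forall x \ae leb, qdiff_at w (wi^~ x) (Dwi^~ x) x.
  apply: filterS (ae_affine 0 c0 df) => x; rewrite /affine addr0.
  exact: qdiff_rescale.
have cont_w x : cube x -> forall e, 0 < e ->
    \forall y \near within cube (nbhs x), qdist (w y) (w x) < e.
  move=> _ e e0; have [K K0 wK] := lipschitz_q_gt0 lw.
  apply: cvg_within; apply/nbhs_eballP; exists (e / K); first by rewrite divr_gt0.
  by move=> y; rewrite ltr_pdivlMr // => yx; rewrite (le_lt_trans (wK _ _)) // mulrC.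
have eQ : Q = (\sum_(j < 1) Q)%N by rewrite big_ord1.
case: (posnP Q) => [Q0|Qpos].
  rewrite (_ : (fun x => _) = (fun=> 0%E)); first by rewrite integral0.
  by apply/funext => x; rewrite big1 // => i; have := ltn_ord i; move: (nat_of_ord i) => k; rewrite Q0.
have := qc 1%N (fun=> Q) (fun=> 0) (fun=> 0) eQ (fun _ => Qpos) _
  (fun=> w) (fun _ => wi) (fun _ => Dwi).
move=> /(_ _ _ _ _).
rewrite [quadratic_integrand _ _ _]big1 => [|i _]; last first.
  by rewrite -(scale0r 0) mdotZr mul0r.
move=> H; have {H} : (0 <= \int[leb]_(x in (cube : set E))
    (\sum_i mdot (A (Dwi i x)) (Dwi i x))%:E)%E.
  rewrite (eq_integral (fun x : E => (quadratic_integrand A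
     (fun i : 'I_Q => 0) (fun i : 'I_Q => Dwi (tagnat.sig2 (cast_ord eQ i)) (x : 'cV[R]_m)))%:E)); last first.
    move=> x _; congr EFin; rewrite /quadratic_integrand.
    rewrite (sum_blocks eQ (fun _ k => mdot (A (Dwi k x)) (Dwi k x))).
    by rewrite big_ord1.
  apply: H.
  - by move=> i j _; rewrite !ord1.
  - by move=> _; exact: lipschitz_sobolev dw.
  - move=> _; exists w; split=> //; first exact: aeW.
    move=> x [cx]; rewrite interior_cube => nx; rewrite out.
      by congr dirac_sum; apply/funext => i; rewrite mul0mx addr0.
    apply: contrapT => H; apply: nx => i; rewrite ltNge; apply/negP => xi.
    by apply: H; exists i.
  - move=> _; apply: qdiff_approx_differential.
    + exact: measurable_cube.
    + by move=> x _; exact: (af.1 (c *: x) I).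
    + exact: ae_interior_cube.
    + by apply: filterS dw.
set H := fun x => \sum_i mdot (A (Dfi i x)) (Dfi i x).
rewrite integral_cube_ae; first last.
- exact: (energy_supp A wcube dw).
- exact: (measurable_energy A lw dw).
have fbox x : ~ box (const_mx (- r)) (const_mx r) x -> f x = dirac_sum (fun=> 0).
  move=> nx; apply: fB => /Br xr; apply: nx => i.
  by rewrite !mxE -ler_norml (le_trans (enorm_entry _ _ _)).
have iH := energy_integrable A lf fbox df.
have -> : (\int[leb]_(x in [set: E]) (\sum_i mdot (A (Dwi i x)) (Dwi i x))%:E =
    \int[leb]_(x in [set: E]) ((c ^+ 2)%:E * (H (c *: (x : 'cV[R]_m)))%:E))%E.
  apply: eq_integral => x _; rewrite -EFinM; congr EFin; rewrite /H mulr_sumr.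
  by apply: eq_bigr => i _; rewrite /Dwi linearZ mdotZl mdotZr mulrA.
rewrite (@integral_scale _ _ c (fun x => ((c ^+ 2)%:E * (H x)%:E)%E)) //; last first.
  exact: integrableZl.
rewrite integralZl // pmule_rge0; last by rewrite lte_fin invr_gt0 exprn_gt0.
by rewrite pmule_rge0 // lte_fin exprn_gt0.
Qed.

End quasiconvex_semielliptic.

(** * Smooth bump functions *)

Section smooth1.
Context (R : realType).
Implicit Types (f g : R -> R).

(** Functions of class C^j on the line. As in of_class_C, continuity is asked
    for at every order; the derivatives are given by witnesses, so that the
    calculus rules apply to them directly. *)
Fixpoint smooth1 (j : nat) f : Prop :=
  continuous f /\
  if j is j'.+1 then exists2 g, (forall t, is_derive t (1 : R) f (g t)) & smooth1 j' g
  else True.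

Lemma smooth1_continuous j f : smooth1 j f -> continuous f.
Proof. by case: j => [|j] []. Qed.

Lemma smooth1W j f : smooth1 j.+1 f -> smooth1 j f.
Proof.
elim: j f => [|j IH] f [cf [g dg sg]]; first by split.
by split=> //; exists g => //; exact: IH.
Qed.

Lemma is_derive_continuous f g : (forall t, is_derive t (1 : R) f (g t)) -> continuous f.
Proof.
move=> df t; apply: differentiable_continuous; apply/derivable1_diffP.
exact: (@ex_derive _ _ _ _ _ _ _ (df t)).
Qed.

Lemma smooth1S j f g : (forall t, is_derive t (1 : R) f (g t)) -> smooth1 j g -> smooth1 j.+1 f.
Proof. by move=> df sg; split; [exact: is_derive_continuous df|exists g]. Qed.

Lemma smooth1_cst j (c : R) : smooth1 j (cst c).
Proof.
elim: j c => [|j IH] c; first by split=> // t; exact: cvg_cst.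
by apply: smooth1S (IH 0) => t; exact: is_derive_cst.
Qed.

Lemma smooth1D j f g : smooth1 j f -> smooth1 j g -> smooth1 j (fun t => f t + g t).
Proof.
elim: j f g => [|j IH] f g [cf Hf] [cg Hg].
  by split=> // t; exact: (cvgD (cf t) (cg t)).
move: Hf Hg => [f' df sf] [g' dg sg].
apply: smooth1S (IH _ _ sf sg) => t; exact: is_deriveD.
Qed.

Lemma smooth1M j f g : smooth1 j f -> smooth1 j g -> smooth1 j (fun t => f t * g t).
Proof.
elim: j f g => [|j IH] f g; first by move=> [cf _] [cg _]; split=> // t; exact: (cvgM (cf t) (cg t)).
move=> sf sg; have sf' := smooth1W sf; have sg' := smooth1W sg.
move: sf sg => [_ [f' df sf]] [_ [g' dg sg]].
apply: smooth1S (smooth1D (IH _ _ sf' sg) (IH _ _ sg' sf)).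
Qed.

Lemma smooth1_comp j f g : smooth1 j f -> smooth1 j g -> smooth1 j (fun t => f (g t)).
Proof.
elim: j f g => [|j IH] f g.
  by move=> [cf _] [cg _]; split=> // t; apply: (@continuous_comp _ _ _ g f); [exact: cg|exact: cf].
move=> sf sg; have sg' := smooth1W sg; move: sf sg => [_ [f' df sf]] [_ [g' dg sg]].
apply: smooth1S (smooth1M (IH _ _ sf sg') sg).
Qed.

Lemma smooth1_id j : smooth1 j (fun t : R => t).
Proof.
case: j => [|j]; first by split=> // t; exact: cvg_id.
exact: smooth1S (smooth1_cst j 1).
Qed.

(** The smooth functions t^(-k) exp(-1/t), extended by 0 to t <= 0. *)
Definition expk (k : nat) (t : R) : R := if 0 < t then t^-1 ^+ k * expR (- t^-1) else 0.

Lemma expk_ge0 k t : 0 <= expk k t.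
Proof.
by rewrite /expk; case: ifP => // t0; rewrite mulr_ge0 ?exprn_ge0 ?expR_ge0 // invr_ge0 ltW.
Qed.

Lemma expk_le k t : 0 < t -> expk k t <= k.+1`!%:R * t.
Proof.
move=> t0; rewrite /expk t0; have s0 : 0 < t^-1 by rewrite invr_gt0.
have f0 : 0 < k.+1`!%:R :> R by rewrite ltr0n fact_gt0.
have := expR_ge1Dxn k (ltW s0) => H.
have : t^-1 ^+ k.+1 / k.+1`!%:R <= expR t^-1 by lra.
rewrite ler_pdivrMr // exprSr -ler_pdivlMr // invrK => {}H.
by rewrite expRN ler_pdivrMr ?expR_gt0 // (le_trans H) // -mulrA mulrC.
Qed.

(** At 0 the difference quotients of expk k are the values of expk k.+1,
    which tend to 0 by expk_le. *)
Lemma is_derive_expk k t : is_derive t (1 : R) (expk k) (expk k.+2 t - k%:R * expk k.+1 t).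
Proof.
case: (ltgtP t 0) => t0.
- have z (l : nat) (u : R) : u <= 0 -> expk l u = 0 by rewrite /expk ltNge => ->.
  rewrite !z ?ltW // mulr0 subr0.
  apply: (@near_eq_is_derive _ _ _ (cst 0)) => //.
  near=> u; rewrite z // ltW //; near: u; exact: lt_nbhsl.
- have e (l : nat) (u : R) : 0 < u -> expk l u = u^-1 ^+ l * expR (- u^-1).
    by rewrite /expk => ->.
  rewrite !e //.
  apply: (@near_eq_is_derive R R R (fun t => t^-1 ^+ k * expR (- t^-1)) (expk k)).
    by near=> u; rewrite e //; near: u; exact: lt_nbhsr.
  have tn0 : t != 0 by rewrite gt_eqF.
  have dV : is_derive t (1 : R) (fun t : R => t^-1) (- t ^- 2).
    split; first exact: (@derivableV _ _ (id : R -> R)).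
    by rewrite (@deriveV _ _ (id : R -> R)) // derive_id /GRing.scale /= mulr1.
  have dN : is_derive t (1 : R) (fun t : R => - t^-1) (t ^- 2).
    by rewrite -[t ^- 2]opprK; exact: is_deriveN.
  have dX : is_derive t (1 : R) (fun t : R => t^-1 ^+ k) (k%:R * t^-1 ^+ k.-1 * (- t ^- 2)).
    have := is_deriveX k dV; rewrite (_ : (fun t : R => t^-1) ^+ k = (fun t => t^-1 ^+ k)) //.
    by apply/funext => u; rewrite exprfctE.
  have dE : is_derive t (1 : R) (fun t : R => expR (- t^-1)) (expR (- t^-1) * t ^- 2).
    exact: is_derive1_comp.
  have ident (z w : R) (l : nat) : z ^+ l * (w * z ^+ 2) + w * (l%:R * z ^+ l.-1 * - z ^+ 2) =
      z ^+ l.+2 * w - l%:R * (z ^+ l.+1 * w).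
    by case: l => [|l] /=; rewrite !exprS; ring.
  by apply: (is_derive_eq (is_deriveM dX dE)); rewrite /GRing.scale /= -!exprVn ident.
- subst t; rewrite /expk ltxx mulr0 subr0.
  have cv : h^-1 *: ((expk k \o shift 0) (h *: (1 : R)) - expk k 0) @[h --> (0:R)^'] --> (0 : R).
    apply/cvgrPdist_le => e e0.
    pose C : R := k.+2`!%:R; have C0 : 0 < C by rewrite ltr0n fact_gt0.
    have eC : 0 < e / C by rewrite divr_gt0.
    apply/nbhs_ballP; exists (e / C) => //= h; rewrite -ball_normE /ball_ /= sub0r normrN => he hn0.
    rewrite sub0r normrN addr0 [h *: 1]mulr1 [expk k 0]/expk ltxx subr0.
    have [h0|h0] := leP h 0; first by rewrite /expk ltNge h0 /= scaler0 normr0 ltW.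
    have -> : h^-1 *: expk k h = expk k.+1 h.
      by rewrite /expk h0 exprS -mulrA.
    rewrite ger0_norm ?expk_ge0 // (le_trans (expk_le _ h0)) // -/C.
    by rewrite mulrC -ler_pdivlMr // ltW // (le_lt_trans (ler_norm h)).
  split; first by apply/cvg_ex; exists 0.
  by apply/cvg_lim.
Unshelve. all: by end_near.
Qed.

Lemma smooth1_expk j k : smooth1 j (expk k).
Proof.
elim: j k => [|j IH] k.
  by split=> //; apply: is_derive_continuous; exact: is_derive_expk.
have sk : smooth1 j (fun t => expk k.+2 t + - k%:R * expk k.+1 t).
  exact: (smooth1D (IH k.+2) (smooth1M (smooth1_cst j (- k%:R)) (IH k.+1))).
apply: (smooth1S _ sk) => t; rewrite mulNr; exact: is_derive_expk.
Qed.

Lemma expk_le0 k t : t <= 0 -> expk k t = 0.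
Proof. by rewrite /expk ltNge => ->. Qed.

Lemma expk_gt0 k t : 0 < t -> 0 < expk k t.
Proof. by move=> t0; rewrite /expk t0 mulr_gt0 ?expR_gt0 // exprn_gt0 // invr_gt0. Qed.

Lemma expk0_le1 t : expk 0 t <= 1.
Proof.
rewrite /expk; case: ifP => // t0; rewrite mul1r -expR0 ler_expR oppr_le0 invr_ge0.
exact: ltW.
Qed.

Lemma expk0_lt t u : 0 < u -> t < u -> expk 0 t < expk 0 u.
Proof.
move=> u0 tu; have [t0|t0] := leP t 0; first by rewrite (expk_le0 _ t0) expk_gt0.
by rewrite /expk t0 u0 !mul1r ltr_expR ltrN2 ltf_pV2.
Qed.

Definition cutoff (t : R) : R := expk 0 1 - expk 0 (1 - t).

(** A smooth step: 0 for t <= 0 and constant for t >= 1. *)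
Definition stepf (t : R) : R := expk 0 (cutoff t).

(** The derivative of stepf, a nonnegative bump supported in [0, 1]. *)
Definition bumpf (t : R) : R := expk 2 (cutoff t) * expk 2 (1 - t).

Lemma smooth1_flip j : smooth1 j (fun t : R => 1 - t).
Proof.
have s := smooth1D (smooth1_cst j 1) (smooth1M (smooth1_cst j (-1)) (@smooth1_id j)).
by rewrite (_ : (fun t => _) = (fun t => cst 1 t + cst (-1) t * t)) //; apply/funext => t /=; rewrite mulN1r.
Qed.

Lemma smooth1_cutoff j : smooth1 j cutoff.
Proof.
have s := smooth1D (smooth1_cst j (expk 0 1))
  (smooth1M (smooth1_cst j (-1)) (smooth1_comp (@smooth1_expk j 0) (@smooth1_flip j))).
by rewrite (_ : cutoff = (fun t => cst (expk 0 1) t + cst (-1) t * expk 0 (1 - t))) //;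
  apply/funext => t /=; rewrite mulN1r.
Qed.

Lemma smooth1_stepf j : smooth1 j stepf.
Proof. exact: (smooth1_comp (@smooth1_expk j 0) (@smooth1_cutoff j)). Qed.

Lemma smooth1_bumpf j : smooth1 j bumpf.
Proof.
exact: (smooth1M (smooth1_comp (@smooth1_expk j 2) (@smooth1_cutoff j))
  (smooth1_comp (@smooth1_expk j 2) (@smooth1_flip j))).
Qed.

Lemma is_derive_stepf t : is_derive t (1 : R) stepf (bumpf t).
Proof.
have d0 (u : R) : is_derive u (1 : R) (expk 0) (expk 2 u).
  by have := is_derive_expk 0 u; rewrite mul0r subr0.
have d1 : is_derive t (1 : R) (fun t : R => 1 - t) (-1).
  rewrite -[-1]sub0r; exact: (@is_deriveB R R R (cst (1 : R)) id t 1 0 1).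
have d2 : is_derive t (1 : R) (fun t => expk 0 (1 - t)) (expk 2 (1 - t) * -1).
  exact: (@is_derive1_comp _ (expk 0)).
have d3 : is_derive t (1 : R) cutoff (expk 2 (1 - t)).
  rewrite (_ : expk 2 (1 - t) = 0 - expk 2 (1 - t) * -1); last by rewrite sub0r mulrN1 opprK.
  exact: (@is_deriveB R R R (cst (expk 0 1)) (fun t => expk 0 (1 - t)) t 1 0).
exact: (@is_derive1_comp _ (expk 0) cutoff).
Qed.

Lemma cutoff_le0 t : t <= 0 -> cutoff t <= 0.
Proof.
move=> t0; rewrite subr_le0; have [->|tn0] := eqVneq t 0; first by rewrite subr0.
apply/ltW/expk0_lt; first by lra.
by have : t < 0; [rewrite lt_neqAle tn0|lra].
Qed.

Lemma cutoff_gt0 t : 0 < t -> 0 < cutoff t.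
Proof. by move=> t0; rewrite subr_gt0 expk0_lt // gtrBl. Qed.

Lemma cutoff_le1 t : cutoff t <= 1.
Proof. by rewrite /cutoff; have := expk0_le1 1; have := expk_ge0 0 (1 - t); lra. Qed.

Lemma stepf_le0 t : t <= 0 -> stepf t = 0.
Proof. by move=> /cutoff_le0; exact: expk_le0. Qed.

Lemma stepf_ge1 t : 1 <= t -> stepf t = stepf 1.
Proof. by move=> t1; rewrite /stepf /cutoff !(@expk_le0 0 (1 - _)) //; lra. Qed.

Lemma stepf_ge0 t : 0 <= stepf t. Proof. exact: expk_ge0. Qed.

Lemma stepf_le1 t : stepf t <= 1. Proof. exact: expk0_le1. Qed.

Lemma bumpf_ge0 t : 0 <= bumpf t.
Proof. by rewrite mulr_ge0 // expk_ge0. Qed.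

Lemma bumpf_le0 t : t <= 0 -> bumpf t = 0.
Proof. by move=> /cutoff_le0 h; rewrite /bumpf expk_le0 // mul0r. Qed.

Lemma bumpf_ge1 t : 1 <= t -> bumpf t = 0.
Proof. by move=> h; rewrite /bumpf (@expk_le0 2 (1 - t)) ?mulr0 //; lra. Qed.

Lemma bumpf_le t : bumpf t <= 36.
Proof.
have [t0|t0] := leP t 0; first by rewrite bumpf_le0.
have [t1|t1] := leP 1 t; first by rewrite bumpf_ge1.
have c0 := cutoff_gt0 t0; have c1 := cutoff_le1 t.
have t10 : 0 < 1 - t by rewrite subr_gt0.
have h1 := expk_le 2 c0; have h2 := expk_le 2 t10.
have f6 : 3`!%:R = 6 :> R by [].
rewrite f6 in h1 h2.
rewrite (_ : 36 = 6 * 6); last by ring.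
by apply: ler_pM; rewrite ?expk_ge0 //; lra.
Qed.

Lemma bumpf_lower : exists beta delta, [/\ 0 < beta, 0 < delta &
  forall t, `|t - 2^-1| <= delta -> beta <= bumpf t].
Proof.
have b0 : 0 < bumpf 2^-1.
  by rewrite mulr_gt0 // expk_gt0 ?cutoff_gt0 ?invr_gt0 //; lra.
have cb : continuous bumpf by exact: smooth1_continuous (@smooth1_bumpf 0).
have b2 : bumpf 2^-1 / 2 < bumpf 2^-1 by lra.
have /nbhs_ballP[d /= d0 H] : nbhs (2^-1 : R) [set t | bumpf 2^-1 / 2 < bumpf t].
  exact: (cvgr_gt _ (@cb 2^-1) _ b2).
exists (bumpf 2^-1 / 2), (d / 2); split; [by rewrite divr_gt0|by rewrite divr_gt0|].
move=> t td; apply/ltW/H; rewrite -ball_normE /ball_ /= distrC.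
by rewrite (le_lt_trans td) //; lra.
Qed.

End smooth1.

Section smooth_multi.
Context (R : realType) (m : nat).
Implicit Types (phi psi : 'cV[R]_m -> R).

Lemma of_class_C_continuous j phi : of_class_C j phi -> continuous phi.
Proof. by case: j => [|j] []. Qed.

Lemma of_class_CW j phi : of_class_C j.+1 phi -> of_class_C j phi.
Proof.
elim: j phi => [|j IH] phi [cphi Hphi]; first by split.
by split=> // i; have [dphi sphi] := Hphi i; split=> //; exact: IH.
Qed.

Lemma of_class_CD j phi psi : of_class_C j phi -> of_class_C j psi ->
  of_class_C j (fun x => phi x + psi x).
Proof.
elim: j phi psi => [|j IH] phi psi [c1 H1] [c2 H2].
  by split=> // x; exact: (cvgD (c1 x) (c2 x)).
split=> [x|i]; first exact: (cvgD (c1 x) (c2 x)).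
have [d1 s1] := H1 i; have [d2 s2] := H2 i; split=> [x|]; first exact: derivableD.
rewrite (_ : partial i _ = (fun x => partial i phi x + partial i psi x)); first exact: IH.
by apply/funext => x; rewrite /partial deriveD.
Qed.

Lemma of_class_CM j phi psi : of_class_C j phi -> of_class_C j psi ->
  of_class_C j (fun x => phi x * psi x).
Proof.
elim: j phi psi => [|j IH] phi psi.
  by move=> [c1 _] [c2 _]; split=> // x; exact: (cvgM (c1 x) (c2 x)).
move=> h1 h2; have w1 := of_class_CW h1; have w2 := of_class_CW h2.
move: h1 h2 => [c1 H1] [c2 H2].
split=> [x|i]; first exact: (cvgM (c1 x) (c2 x)).
have [d1 s1] := H1 i; have [d2 s2] := H2 i; split=> [x|]; first exact: derivableM.
rewrite (_ : partial i _ = (fun x => phi x * partial i psi x + psi x * partial i phi x)).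
  exact: (of_class_CD (IH _ _ w1 s2) (IH _ _ w2 s1)).
by apply/funext => x; rewrite /partial deriveM.
Qed.

Lemma of_class_C_cst j (c : R) : of_class_C j (fun _ : 'cV[R]_m => c).
Proof.
elim: j c => [|j IH] c; first by split=> //; exact: cst_continuous.
split=> [|i]; first exact: cst_continuous.
split=> [x|]; first exact: derivable_cst.
by rewrite (_ : partial i _ = fun=> 0) //; apply/funext => x; rewrite /partial derive_cst.
Qed.

(** Directional derivatives only see the values of a function along a line. *)
Lemma is_derive_along phi x (e : 'cV[R]_m) (f : R -> R) t l :
  (forall h, phi (h *: e + x) = f (h + t)) -> is_derive t (1 : R) f l ->
  is_derive x e phi l.
Proof.
move=> pf [df dl].
have e1 : (fun h => h^-1 *: ((phi \o shift x) (h *: e) - phi x)) =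
    (fun h : R => h^-1 *: ((f \o shift t) (h *: (1 : R)) - f t)).
  apply/funext => h; have := pf 0; rewrite scale0r !add0r => ->.
  by rewrite /= /shift /= pf [h *: 1]mulr1.
split; first by rewrite /derivable e1.
by rewrite /derive e1.
Qed.

Lemma is_derive_coord (psi g : R -> R) k i (x : 'cV[R]_m) :
  (forall t, is_derive t (1 : R) psi (g t)) ->
  is_derive x (delta_mx i 0) (fun x : 'cV[R]_m => psi (x k 0)) (if i == k then g (x k 0) else 0).
Proof.
move=> dpsi; case: eqP => [->|/eqP ik].
  by apply: (is_derive_along (f := psi) (t := x k 0)) => // h; rewrite !mxE !eqxx mulr1.
apply: (is_derive_along (f := cst (psi (x k 0))) (t := 0)) => h /=.
by rewrite !mxE eq_sym (negPf ik) mulr0 add0r.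
Qed.

Lemma of_class_C_coord j (psi : R -> R) k : smooth1 j psi ->
  of_class_C j (fun x : 'cV[R]_m => psi (x k 0)).
Proof.
have cc (f : R -> R) : continuous f -> continuous (fun x : 'cV[R]_m => f (x k 0)).
  by move=> cf x; apply: (@continuous_comp _ _ _ (fun x : 'cV[R]_m => x k 0) f);
    [exact: coord_continuous|exact: cf].
elim: j psi => [|j IH] psi; first by move=> [cpsi _]; split=> //; exact: cc.
move=> [cpsi [g dg sg]]; split=> [|i]; first exact: cc.
have d x := is_derive_coord k i x dg; split=> [x|]; first exact: (@ex_derive _ _ _ _ _ _ _ (d x)).
rewrite (_ : partial i _ = (fun x => if i == k then g (x k 0) else 0)).
  by case: eqP => _; [exact: IH|exact: of_class_C_cst].
by apply/funext => x; rewrite /partial; exact: (@derive_val _ _ _ _ _ _ _ (d x)).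
Qed.

Lemma of_class_C_prod j (I : Type) (r : seq I) (P : pred I) (F : I -> 'cV[R]_m -> R) :
  (forall i, of_class_C j (F i)) -> of_class_C j (fun x => \prod_(i <- r | P i) F i x).
Proof.
move=> HF; elim: r => [|i r IH].
  rewrite (_ : (fun x => _) = fun=> 1); first exact: of_class_C_cst.
  by apply/funext => x; rewrite big_nil.
rewrite (_ : (fun x => _) = (fun x => (if P i then F i x else 1) * \prod_(i <- r | P i) F i x)).
  by apply: (of_class_CM _ IH); case: (P i); [exact: HF|exact: of_class_C_cst].
by apply/funext => x; rewrite big_cons; case: ifP => // _; rewrite mul1r.
Qed.

End smooth_multi.

(** * Bounded weak gradients give Lipschitz bounds *)

Section tube_test_functions.
Context (R : realType) (m : nat).
Notation E := (euclid R m).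
Variables (c : 'cV[R]_m) (i : 'I_m) (h e : R).
Hypotheses (h0 : 0 <= h) (e0 : 0 < e).

(** A smooth bump supported in the box with lower corner c and side e. *)
Definition cbump (y : 'cV[R]_m) : R := \prod_k bumpf ((y k 0 - c k 0) / e).

(** A test function whose i-th partial derivative is the difference between a
    cbump at c and its translate by h in direction i. *)
Definition tube (y : 'cV[R]_m) : R :=
  (stepf ((y i 0 - c i 0) / e) - stepf ((y i 0 - (c i 0 + h)) / e)) *
  \prod_(k | k != i) bumpf ((y k 0 - c k 0) / e).

Definition tube_box : set 'cV[R]_m := box c (c + const_mx e + h *: delta_mx i 0).

Lemma smooth1_affine j (a : R) : smooth1 j (fun t => (t - a) / e).
Proof.
have s := smooth1M (smooth1D (@smooth1_id R j) (smooth1_cst j (- a))) (smooth1_cst j e^-1).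
exact: s.
Qed.

Lemma cbump_class j : of_class_C j cbump.
Proof.
apply: (@of_class_C_prod _ _ j _ _ xpredT (fun k (y : 'cV[R]_m) => bumpf ((y k 0 - c k 0) / e))) => k.
apply: (@of_class_C_coord _ _ j (fun t => bumpf ((t - c k 0) / e))).
exact: (smooth1_comp (@smooth1_bumpf R j) (smooth1_affine j (c k 0))).
Qed.

Lemma tube_class j : of_class_C j tube.
Proof.
have s1 : smooth1 j (fun t => stepf ((t - c i 0) / e) - stepf ((t - (c i 0 + h)) / e)).
  have sn : smooth1 j (fun t => -1 * stepf ((t - (c i 0 + h)) / e)).
    exact: (smooth1M (smooth1_cst j (-1)) (smooth1_comp (@smooth1_stepf R j) (smooth1_affine j (c i 0 + h)))).
  have := smooth1D (smooth1_comp (@smooth1_stepf R j) (smooth1_affine j (c i 0))) sn.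
  by under eq_fun do rewrite mulN1r.
apply: (of_class_CM (of_class_C_coord i s1)).
apply: (@of_class_C_prod _ _ j _ _ (fun k => k != i)
  (fun k (y : 'cV[R]_m) => bumpf ((y k 0 - c k 0) / e))) => k.
apply: (@of_class_C_coord _ _ j (fun t => bumpf ((t - c k 0) / e))).
exact: (smooth1_comp (@smooth1_bumpf R j) (smooth1_affine j (c k 0))).
Qed.

Lemma partial_tube y : partial i tube y = e^-1 * (cbump y - cbump (y - h *: delta_mx i 0)).
Proof.
pose C := \prod_(k | k != i) bumpf ((y k 0 - c k 0) / e).
pose f t := (stepf ((t - c i 0) / e) - stepf ((t - (c i 0 + h)) / e)) * C.
have along s : tube (s *: delta_mx i 0 + y) = f (s + y i 0).
  rewrite /tube /f /C !mxE !eqxx mulr1; congr (_ * _); apply: eq_bigr => k ki.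
  by rewrite !mxE (negPf ki) mulr0 add0r.
have d_aff a t : is_derive t (1 : R) (fun t => (t - a) / e) e^-1.
  have d1 : is_derive t (1 : R) (fun t => t - a) 1.
    by rewrite -[1 in X in is_derive _ _ _ X]subr0; exact: (@is_deriveB R R R id (cst a) t 1 1 0).
  have d2 := @is_deriveM _ _ (fun t => t - a) (cst e^-1) t 1 1 0 d1 (is_derive_cst _ _ _).
  by apply: (is_derive_eq d2); rewrite /GRing.scale /= mulr0 add0r mulr1.
have d_step a t : is_derive t (1 : R) (fun t => stepf ((t - a) / e)) (bumpf ((t - a) / e) * e^-1).
  exact: (@is_derive1_comp _ (@stepf R) _ _ _ _ (is_derive_stepf _) (d_aff a t)).
have df t : is_derive t (1 : R) f
    ((bumpf ((t - c i 0) / e) * e^-1 - bumpf ((t - (c i 0 + h)) / e) * e^-1) * C).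
  have d3 := @is_deriveB R R R _ _ t 1 _ _ (d_step (c i 0) t) (d_step (c i 0 + h) t).
  have d4 := @is_deriveM _ _ _ (cst C) t 1 _ 0 d3 (is_derive_cst _ _ _).
  by apply: (is_derive_eq d4); rewrite /GRing.scale /= mulr0 add0r mulrC.
have d5 := is_derive_along along (df (y i 0)).
have bE z : cbump z = bumpf ((z i 0 - c i 0) / e) * \prod_(k | k != i) bumpf ((z k 0 - c k 0) / e).
  by rewrite /cbump (bigD1 i).
rewrite /partial (@derive_val _ _ _ _ _ _ _ d5) !bE.
rewrite !mxE !eqxx mulr1 -/C.
rewrite [X in _ = _ * (_ - _ * X)](_ : _ = C); last first.
  by apply: eq_bigr => k ki; rewrite !mxE (negPf ki) mulr0 subr0.
by rewrite (_ : y i 0 - h - c i 0 = y i 0 - (c i 0 + h)); ring.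
Qed.

Lemma cbump_eq0 y : ~ box c (c + const_mx e) y -> cbump y = 0.
Proof.
move=> ny; have /existsNP[k Hk] : ~ forall k, c k 0 <= y k 0 <= c k 0 + e.
  by move=> H; apply: ny => k; rewrite !mxE.
rewrite /cbump (bigD1 k) //=.
suff -> : bumpf ((y k 0 - c k 0) / e) = 0 by rewrite mul0r.
have [yc|yc] := leP (c k 0) (y k 0); last first.
  by rewrite bumpf_le0 // pmulr_lle0 ?invr_gt0 // subr_le0 ltW.
rewrite bumpf_ge1 // ler_pdivlMr // mul1r leNgt; apply/negP => ye; apply: Hk.
by rewrite yc /=; lra.
Qed.

Lemma tube_eq0 y : ~ tube_box y -> tube y = 0.
Proof.
move=> ny; have /existsNP[k Hk] : ~ forall k, c k 0 <= y k 0 <= c k 0 + e + h * (k == i)%:R.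
  by move=> H; apply: ny => k; rewrite !mxE eqxx andbT.
rewrite /tube; have [ki|ki] := eqVneq k i; last first.
  rewrite (bigD1 k) //=.
  suff -> : bumpf ((y k 0 - c k 0) / e) = 0 by rewrite mul0r mulr0.
  rewrite (negPf ki) mulr0 addr0 in Hk.
  have [yc|yc] := leP (c k 0) (y k 0); last first.
    by rewrite bumpf_le0 // pmulr_lle0 ?invr_gt0 // subr_le0 ltW.
  rewrite bumpf_ge1 // ler_pdivlMr // mul1r leNgt; apply/negP => ye; apply: Hk.
  by rewrite yc /=; lra.
rewrite ki eqxx mulr1 in Hk; have [yc|yc] := leP (c i 0) (y i 0); last first.
  have y1 : (y i 0 - c i 0) / e <= 0 by rewrite pmulr_lle0 ?invr_gt0 // subr_le0 ltW.
  have y2 : (y i 0 - (c i 0 + h)) / e <= 0.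
    by rewrite pmulr_lle0 ?invr_gt0 // subr_le0 (le_trans (ltW yc)) // lerDl.
  by rewrite !stepf_le0 // subrr mul0r.
have ye : c i 0 + e + h < y i 0 by rewrite ltNge; apply/negP => ye; apply: Hk; rewrite yc.
have y1 : 1 <= (y i 0 - c i 0) / e.
  by rewrite ler_pdivlMr // mul1r lerBrDl (le_trans _ (ltW ye)) // lerDl.
have y2 : 1 <= (y i 0 - (c i 0 + h)) / e.
  by rewrite ler_pdivlMr // mul1r lerBrDl addrAC ltW.
by rewrite (stepf_ge1 y1) (stepf_ge1 y2) subrr mul0r.
Qed.

Lemma cbump_ge0 y : 0 <= cbump y.
Proof. by apply: prodr_ge0 => k _; exact: bumpf_ge0. Qed.

Lemma prod_bumpf_le (P : pred 'I_m) (y : 'cV[R]_m) :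
  0 <= \prod_(k | P k) bumpf ((y k 0 - c k 0) / e) <= 36 ^+ m.
Proof.
apply/andP; split; first by apply: prodr_ge0 => k _; exact: bumpf_ge0.
have -> : 36 ^+ m = \prod_(k < m) (36 : R) by rewrite prodr_const card_ord.
rewrite big_mkcond /=; apply: ler_prod => k _.
by case: ifP => _; rewrite ?bumpf_ge0 ?bumpf_le //= ler01 ler1n.
Qed.

Lemma cbump_le y : cbump y <= 36 ^+ m.
Proof. by have /andP[_] := prod_bumpf_le xpredT y. Qed.

Lemma tube_abs_le y : `|tube y| <= 36 ^+ m.
Proof.
have /andP[p0 pm] := prod_bumpf_le (fun k => k != i) y.
rewrite normrM (ger0_norm p0) (le_trans _ pm) // ler_piMl //.
have H (a b : R) : 0 <= a -> a <= 1 -> 0 <= b -> b <= 1 -> `|a - b| <= 1.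
  by move=> *; rewrite ler_norml; apply/andP; split; lra.
by apply: H; rewrite ?stepf_ge0 ?stepf_le1.
Qed.

Lemma tube_box_volume : box_volume c (c + const_mx e + h *: delta_mx i 0) * e = (e + h) * e ^+ m.
Proof.
rewrite /box_volume (bigD1 i) //= !mxE !eqxx mulr1.
rewrite (eq_bigr (fun=> e)); last first.
  by move=> k ki; rewrite !mxE (negPf ki) mulr0 addr0 addrAC subrr add0r max_r // ltW.
rewrite (_ : c i 0 + e + h - c i 0 = e + h); last by ring.
rewrite max_r; last by rewrite addr_ge0 // ltW.
have -> : e ^+ m = e * \prod_(k < m | k != i) e.
  transitivity (\prod_(k < m) e); first by rewrite prodr_const card_ord.
  by rewrite (bigD1 i).
ring.
Qed.

Lemma tube_test : tube_box `<=` interior cube -> test_function (interior cube) tube.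
Proof.
move=> sub; split; first exact: tube_class.
exists tube_box; split=> //; [exact: compact_box|exact: tube_eq0].
Qed.

End tube_test_functions.

Section tube_estimate.
Context (R : realType) (m : nat).
Notation E := (euclid R m).
Variables (V : 'cV[R]_m -> R) (Dg : 'cV[R]_m -> 'cV[R]_m) (M Mv : R).
Hypothesis mV : measurable_fun [set: E] (V : E -> R).
Hypothesis VM : forall x, `|V x| <= Mv.
Hypothesis V0 : forall x, ~ cube x -> V x = 0.
Hypothesis VDg : weak_gradient V Dg.
Hypothesis mDg : forall i, measurable_fun (cube : set E) ((fun x => Dg x i 0) : E -> R).
Hypothesis DgM : forall i, \forall x \ae leb, cube x -> `|Dg x i 0| <= M.
Hypothesis M0 : 0 <= M.

Variables (c : 'cV[R]_m) (i : 'I_m) (h e w beta delta : R).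
Hypotheses (h0 : 0 <= h) (e0 : 0 < e) (w0 : 0 <= w).
Hypothesis sub : tube_box c i h e `<=` interior cube.
Let s : 'cV[R]_m := h *: delta_mx i 0.
Hypothesis osc1 : forall y, box c (c + const_mx e) y -> `|V y - V c| <= w.
Hypothesis osc2 : forall y, box c (c + const_mx e) y -> `|V (y + s) - V (c + s)| <= w.
Hypotheses (beta0 : 0 < beta) (delta0 : 0 < delta).
Hypothesis lower : forall t, `|t - 2^-1| <= delta -> beta <= bumpf t.

Let vol : R := box_volume c (c + const_mx e + h *: delta_mx i 0).
Let phi := tube c i h e.
Let eta := cbump c e.

Lemma continuous_phi : continuous phi.
Proof. exact: of_class_C_continuous (tube_class c i h e 0). Qed.

(** The weak gradient is tested against the tube. *)
Lemma weak_side_bound :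
  (`|\int[leb]_(x in [set: E]) (V x * partial i phi x)%:E| <= (M * 36 ^+ m * vol)%:E)%E.
Proof.
have tphi : test_function (interior cube) phi by exact: tube_test.
rewrite -integral_cubeE; last by move=> x /V0 ->; rewrite mul0r.
rewrite (VDg tphi i) abseN.
have mphi : measurable_fun (cube : set E) (phi : E -> R).
  exact/measurable_fun_continuous/continuous_phi.
have mDphi : measurable_fun (cube : set E) ((fun x => Dg x i 0 * phi x) : E -> R).
  exact: (measurable_funM (mDg i) mphi).
have emD : measurable_fun (cube : set E) ((fun x => (Dg x i 0 * phi x)%:E) : E -> \bar R).
  exact/measurable_EFinP.
apply: (le_trans (le_abse_integral _ (@measurable_cube R m) emD)).
pose bnd (x : E) : \bar R := (M * 36 ^+ m * \1_(tube_box c i h e : set E) x)%:E.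
have mb : measurable (tube_box c i h e : set E) by exact: measurable_box.
have mbnd : measurable_fun (cube : set E) bnd.
  apply/measurable_EFinP; apply: measurable_funM; first exact: measurable_cst.
  exact: measurable_indic.
have mabs : measurable_fun (cube : set E) (fun x : E => `|(Dg x i 0 * phi x)%:E|%E).
  exact: (measurableT_comp (@abse_measurable R setT) emD).
have C0 : 0 <= M * 36 ^+ m by rewrite mulr_ge0 // exprn_ge0.
have le1 : \forall x \ae leb, (cube : set E) x -> (`|(Dg x i 0 * phi x)%:E| <= bnd x)%E.
  apply: filterS (DgM i) => x Dx cx; rewrite abse_EFin lee_fin indicE.
  case: (boolP (x \in _)) => [_|/negP]; last first.
    by rewrite inE => nx; rewrite /phi (tube_eq0 h0 e0 nx) mulr0 normr0 mulr0.
  rewrite mulr1 normrM ler_pM ?Dx //; exact: tube_abs_le.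
have bnd0 (x : E) : (cube : set E) x -> (0 <= bnd x)%E by rewrite lee_fin mulr_ge0.
apply: (le_trans (@ae_ge0_le_integral _ E R leb cube (@measurable_cube R m) _ _
  (fun x _ => abse_ge0 _) mabs bnd0 mbnd le1)).
have mc := @measurable_cube R m.
rewrite /bnd; under eq_integral do rewrite EFinM.
have mi : measurable_fun (cube : set E) (EFin \o (\1_(tube_box c i h e : set E) : E -> R)).
  exact/measurable_EFinP/measurable_indic.
rewrite (ge0_integralZl_EFin (@leb R m) mc _ mi C0); last by move=> x _; rewrite /= lee_fin.
rewrite (integral_indic (@leb R m) mc mb) [in leRHS]EFinM; apply: lee_wpmul2l; first by rewrite lee_fin.
rewrite -[X in (_ <= X)%E](leb_box c (c + const_mx e + h *: delta_mx i 0)).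
by apply: le_lebesgue_outer => x [].
Qed.

Lemma integrable_V_bounded (g : 'cV[R]_m -> R) (C : R) (z : 'cV[R]_m) (a b : 'cV[R]_m) :
  measurable_fun [set: E] (g : E -> R) -> (forall x, `|g x| <= C) ->
  (forall x, ~ box a b x -> g x = 0) ->
  leb.-integrable [set: E] (EFin \o ((fun x => V (x + z) * g x) : E -> R)).
Proof.
move=> mg gC g0; apply: (@integrable_bounded_box _ _ a b (Mv * C)).
- have mVz : measurable_fun [set: E] ((fun x => V (x + z)) : E -> R).
    have := measurableT_comp mV (measurable_fun_affine z (@ltr01 R)).
    by apply: eq_measurable_fun => x _; rewrite /= /affine scale1r.
  exact: (measurable_funM mVz mg).
- by move=> x; rewrite normrM ler_pM.
- by move=> x /g0 ->; rewrite mulr0.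
Qed.

Local Notation Int f := (\int[leb]_(x in [set: E]) f x)%R.

Lemma eta_bounded x : `|eta x| <= 36 ^+ m.
Proof. by rewrite ger0_norm ?cbump_ge0 // cbump_le. Qed.

Lemma measurable_eta : measurable_fun [set: E] (eta : E -> R).
Proof.
exact: (measurable_fun_continuous (of_class_C_continuous (@cbump_class _ _ c _ 0))).
Qed.

Lemma integrable_eta : leb.-integrable [set: E] (EFin \o (eta : E -> R)).
Proof.
exact: (integrable_bounded_box measurable_eta eta_bounded (cbump_eq0 e0)).
Qed.

Lemma integral_eta_ge : (beta * (2 * delta)) ^+ m * e ^+ m <= Int eta.
Proof.
pose a : 'cV[R]_m := c + const_mx (e * (2^-1 - delta)).
pose b : 'cV[R]_m := c + const_mx (e * (2^-1 + delta)).
have mb : measurable (box a b : set E) by exact: measurable_box.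
have -> : (beta * (2 * delta)) ^+ m * e ^+ m = Int (fun x => beta ^+ m * \1_(box a b : set E) x).
  rewrite RintegralZl //; last first.
    by have := @integrable_box_cst R m a b 1; under eq_fun do rewrite mul1r.
  have -> : Int (\1_(box a b : set E) : E -> R) = box_volume a b.
    rewrite /Rintegral (integral_indic (@leb R m) measurableT mb) setIT.
    exact: (congr1 fine (leb_box a b)).
  rewrite /box_volume.
  rewrite (eq_bigr (fun=> 2 * delta * e)); first by rewrite prodr_const card_ord -!exprMn; congr (_ ^+ _); ring.
  move=> k _; rewrite !mxE (_ : _ - _ = 2 * delta * e); last by ring.
  by rewrite max_r // !mulr_ge0 // ltW.
apply: le_Rintegral => //.
- exact: integrable_box_cst.
- exact: integrable_eta.
move=> x _; rewrite indicE; case: (boolP (x \in _)) => [|_]; last first.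
  by rewrite mulr0 cbump_ge0.
rewrite inE mulr1 => xab.
have -> : beta ^+ m = \prod_(k < m) beta by rewrite prodr_const card_ord.
apply: ler_prod => k _; rewrite (ltW beta0) /=; apply: lower.
have := xab k; rewrite !mxE => /andP[x1 x2].
rewrite ler_norml; apply/andP; split.
  by rewrite lerBrDl ler_pdivlMr // lerBrDl mulrC.
by rewrite lerBlDl ler_pdivrMr // lerBlDl mulrC.
Qed.

(** By partial_tube, integrating V against the derivative of the tube
    compares the averages of V over two small boxes at c and at c + s; these
    averages differ from V c and V (c + s) by at most the oscillation w. By
    weak_side_bound the same integral is at most M times the volume of the
    tube. *)
Lemma tube_estimate :
  (`|V c - V (c + s)| - 2 * w) * (beta * (2 * delta)) ^+ m <= M * 36 ^+ m * (e + h).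
Proof.
have [neg|pos] := leP (`|V c - V (c + s)| - 2 * w) 0.
  rewrite (@le_trans _ _ 0) //.
    by rewrite mulr_le0_ge0 // exprn_ge0 // !mulr_ge0 // ltW.
  by rewrite !mulr_ge0 ?exprn_ge0 // addr_ge0 // ltW.
have i1 := integrable_V_bounded 0 measurable_eta eta_bounded (cbump_eq0 e0).
have i2 := integrable_V_bounded s measurable_eta eta_bounded (cbump_eq0 e0).
have i0 := integrable_eta.
pose etas (x : 'cV[R]_m) := eta (x - s).
have metas : measurable_fun [set: E] (etas : E -> R).
  have := measurableT_comp measurable_eta (measurable_fun_affine (- s) (@ltr01 R)).
  by apply: eq_measurable_fun => x _; rewrite /= /affine scale1r.
have etas0 x : ~ box (c + s) (c + const_mx e + s) x -> etas x = 0.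
  move=> nx; apply: (cbump_eq0 e0) => bx; apply: nx => k; have := bx k.
  by rewrite !mxE => /andP[b1 b2]; apply/andP; split; [rewrite -lerBrDr|rewrite -lerBlDr].
have i3 := integrable_V_bounded 0 metas (fun x => eta_bounded (x - s)) etas0.
have trans : Int (fun x : 'cV[R]_m => V x * etas x) = Int (fun x : 'cV[R]_m => V (x + s) * eta x).
  rewrite /Rintegral; congr fine.
  rewrite -(@integral_translate _ _ s (fun x => (V x * etas x)%:E)); last first.
    have := measurable_int _ i3; by under eq_fun do rewrite addr0.
  by apply: eq_integral => x _; rewrite /etas addrK.
have S1 : `|Int (fun x : 'cV[R]_m => V x * partial i phi x)| <= M * 36 ^+ m * vol.
  rewrite -lee_fin (le_trans _ weak_side_bound) // /Rintegral.
  have [/fineK <-//|] := boolP (\int[leb]_(x in [set: E]) (V x * partial i phi x)%:E \is a fin_num)%E.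
  by rewrite fin_numEn => /orP[|] /eqP ->; rewrite leey.
have S2 : Int (fun x : 'cV[R]_m => V x * partial i phi x) * e =
    Int (fun x : 'cV[R]_m => V x * eta x) - Int (fun x : 'cV[R]_m => V (x + s) * eta x).
  rewrite -trans -RintegralB //; last by move: i3; under eq_fun do rewrite addr0.
    have i13 : leb.-integrable [set: E] (EFin \o ((fun x => V x * eta x - V x * etas x) : E -> R)).
      have := integrableB (@measurableT _ E) i1 i3.
      by congr integrable; apply/funext => x; rewrite /= !addr0.
    rewrite mulrC -RintegralZl //; last first.
      have := integrableZl (@measurableT _ E) e^-1 i13.
      congr integrable; apply/funext => x /=; rewrite (partial_tube c i h e) -/eta -/(etas x).
      by rewrite -EFinM; congr EFin; ring.
    apply: eq_Rintegral => x _; rewrite (partial_tube c i h e) -/eta -/(etas x).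
    by rewrite mulrCA mulVKf ?gt_eqF // mulrBr.
  by move: i1; under eq_fun do rewrite addr0.
pose D := V c - V (c + s).
have S4 : `|Int (fun x : 'cV[R]_m => V x * eta x) - Int (fun x : 'cV[R]_m => V (x + s) * eta x)
    - D * Int eta| <= 2 * w * Int eta.
  have i1' : leb.-integrable [set: E] (EFin \o ((fun x => V x * eta x) : E -> R)).
    by move: i1; under eq_fun do rewrite addr0.
  have iD : leb.-integrable [set: E] (EFin \o ((fun x => D * eta x) : E -> R)).
    exact: (integrableZl (@measurableT _ E) D i0).
  have iw : leb.-integrable [set: E] (EFin \o ((fun x => 2 * w * eta x) : E -> R)).
    exact: (integrableZl (@measurableT _ E) (2 * w) i0).
  have i12 : leb.-integrable [set: E] (EFin \o ((fun x => V x * eta x - V (x + s) * eta x) : E -> R)).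
    exact: (integrableB (@measurableT _ E) i1' i2).
  have i12D : leb.-integrable [set: E]
      (EFin \o ((fun x => V x * eta x - V (x + s) * eta x - D * eta x) : E -> R)).
    exact: (integrableB (@measurableT _ E) i12 iD).
  rewrite -RintegralB // -RintegralZl // -RintegralB // -RintegralZl //.
  rewrite (le_trans (le_normr_Rintegral (@measurableT _ E) i12D)) //.
  apply: le_Rintegral => //; first exact: (integrable_abse i12D).
  move=> x _; have [bx|bx] := pselect (box c (c + const_mx e) x); last first.
    by rewrite /eta (cbump_eq0 e0 bx) !mulr0 !subr0 normr0.
  rewrite -!mulrBl normrM (ger0_norm (cbump_ge0 _ _ _)) ler_wpM2r ?cbump_ge0 //.
  rewrite (_ : _ - _ = (V x - V c) - (V (x + s) - V (c + s))); last by rewrite /D; ring.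
  by rewrite (le_trans (ler_normB _ _)) // mulr_natl mulr2n lerD // ?osc1 ?osc2.
have em : 0 < e ^+ m by rewrite exprn_gt0.
rewrite -(ler_pM2r em).
have Ie : 0 <= Int eta by apply: Rintegral_ge0 => x _; exact: cbump_ge0.
apply: (@le_trans _ _ ((`|V c - V (c + s)| - 2 * w) * Int eta)).
  by rewrite -[leLHS]mulrA; apply: ler_wpM2l; [exact: ltW|exact: integral_eta_ge].
have -> : M * 36 ^+ m * (e + h) * e ^+ m = M * 36 ^+ m * vol * e.
  by rewrite -[LHS]mulrA -(tube_box_volume c i h0 e0) mulrA.
rewrite mulrBl lerBlDr.
have -> : `|V c - V (c + s)| * Int eta = `|D * Int eta| by rewrite normrM (ger0_norm Ie).
rewrite -[D * _](subKr (Int (fun x : 'cV[R]_m => V x * partial i phi x) * e)) (le_trans (ler_normB _ _)) //.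
apply: lerD; last by rewrite S2.
by rewrite normrM (gtr0_norm e0) ler_pM2r.
Qed.

End tube_estimate.

Section coordinate_lipschitz.
Context (R : realType) (m : nat).
Notation E := (euclid R m).

Lemma enorm_corner (c y : 'cV[R]_m) e : 0 < e -> box c (c + const_mx e) y ->
  enorm (y - c) <= m%:R * e.
Proof.
move=> e0 by_; rewrite (le_trans (enorm_le_sum _)) //; apply: ler_sum_const => k.
rewrite big_ord_recl big_ord0 addr0; have := by_ k; rewrite !mxE => /andP[b1 b2].
by rewrite ger0_norm ?subr_ge0 // lerBlDl.
Qed.

(** The side e of the bumps tends to 0 in tube_estimate. *)
Lemma coordinate_lipschitz_bounded (V : 'cV[R]_m -> R) Dg (M Mv : R) (c : 'cV[R]_m) (i : 'I_m)
    (h beta delta : R) :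
  measurable_fun [set: E] (V : E -> R) -> (forall x, `|V x| <= Mv) ->
  (forall x, ~ cube x -> V x = 0) -> weak_gradient V Dg ->
  (forall i, measurable_fun (cube : set E) ((fun x => Dg x i 0) : E -> R)) ->
  (forall i, \forall x \ae leb, cube x -> `|Dg x i 0| <= M) -> 0 <= M ->
  0 <= h -> open_cube c -> open_cube (c + h *: delta_mx i 0) ->
  (forall w, 0 < w -> \forall y \near c, `|V y - V c| <= w) ->
  (forall w, 0 < w -> \forall y \near (c + h *: delta_mx i 0),
      `|V y - V (c + h *: delta_mx i 0)| <= w) ->
  0 < beta -> 0 < delta -> (forall t, `|t - 2^-1| <= delta -> beta <= bumpf t) ->
  `|V c - V (c + h *: delta_mx i 0)| * (beta * (2 * delta)) ^+ m <= M * 36 ^+ m * h.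
Proof.
move=> mV VM V0 VDg mDg DgM M0 h0 co cso cc ccs beta0 delta0 lower.
set s := h *: delta_mx i 0; set B := _ ^+ m; set A := M * _.
have B0 : 0 < B by rewrite exprn_gt0 // mulr_gt0 // mulr_gt0.
have A0 : 0 <= A by rewrite mulr_ge0 // exprn_ge0.
apply/ler_addgt0Pr => ep ep0.
(* On the supports of the bumps V oscillates by at most w. The side e is
   small with respect to mu to keep the tube in the cube, to ep to make the
   term e in e + h negligible, and to r1 and r2 to control the oscillation. *)
pose w := ep / (4 * B); have w0 : 0 < w by rewrite divr_gt0 // mulr_gt0.
have /nbhs_eballP[r1 r10 H1] := cc w w0.
have /nbhs_eballP[r2 r20 H2] := ccs w w0.
pose mu := \big[Num.min/1]_k (2^-1 - `|(c + s) k 0|).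
have mu0 : 0 < mu by apply/bigmin_gtP; split=> // k _; rewrite subr_gt0; exact: cso.
pose e := Num.min (mu / 2) (Num.min (ep / (2 * (A + 1))) (Num.min (r1 / m.+1%:R) (r2 / m.+1%:R))).
have A1 : 0 < A + 1 by rewrite ltr_wpDl.
have e0 : 0 < e by rewrite !lt_min !divr_gt0 // mulr_gt0.
have [eA eB eC eD] : [/\ e <= mu / 2, e <= ep / (2 * (A + 1)), e <= r1 / m.+1%:R & e <= r2 / m.+1%:R].
  by have := lexx e; rewrite {2}/e !le_min => /and4P[].
have me r : 0 < r -> e <= r / m.+1%:R -> m%:R * e < r.
  move=> r0; rewrite ler_pdivlMr // => er; rewrite (lt_le_trans _ er) // mulrC.
  by rewrite ltr_pM2l // ltr_nat.
have sub : tube_box c i h e `<=` interior cube.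
  rewrite interior_cube => y yt k; have := yt k; rewrite !mxE eqxx andbT => /andP[y1 y2].
  have h1 := co k; have : mu <= 2^-1 - `|(c + s) k 0| by apply: bigmin_le_cond.
  rewrite !mxE eqxx andbT => h2.
  have h3 := ler_norm (c k 0 + h * (k == i)%:R).
  move: h1; rewrite !ltr_norml => /andP[h1 _]; apply/andP; split; first exact: lt_le_trans h1 y1.
  rewrite (le_lt_trans y2) // addrAC -ltrBrDl.
  rewrite (@le_lt_trans _ _ (mu / 2)) // (@lt_le_trans _ _ mu) //.
    by rewrite gtr_pMr // invf_lt1 // ltr1n.
  by rewrite (le_trans h2) // lerB.
have osc1 y : box c (c + const_mx e) y -> `|V y - V c| <= w.
  by move=> yb; apply: H1; rewrite (le_lt_trans (enorm_corner e0 yb)) // me.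
have osc2 y : box c (c + const_mx e) y -> `|V (y + s) - V (c + s)| <= w.
  move=> yb; apply: H2; rewrite opprD addrACA subrr addr0.
  by rewrite (le_lt_trans (enorm_corner e0 yb)) // me.
have := tube_estimate mV VM V0 VDg mDg DgM M0 h0 e0 sub osc1 osc2 beta0 delta0 lower.
rewrite -/s -/B -/A mulrBl mulrDr => est.
have wB : 2 * w * B = ep / 2 by rewrite /w; field; rewrite gt_eqF.
have Ae : A * e <= ep / 2.
  rewrite (le_trans (ler_wpM2l A0 eB)) //.
  have -> : A * (ep / (2 * (A + 1))) = ep / 2 * (A / (A + 1)) by field; rewrite gt_eqF.
  by rewrite ger_pMr ?divr_gt0 // ler_pdivrMr // mul1r lerDl.
by rewrite wB in est; lra.
Qed.

End coordinate_lipschitz.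

Section weak_gradient_lipschitz.
Context (R : realType) (m : nat).
Notation E := (euclid R m).
Implicit Types (g v : 'cV[R]_m -> R).

Definition cube_continuous v : Prop := forall x, cube x -> forall e, 0 < e ->
  \forall y \near within cube (nbhs x), `|v y - v x| < e.

Lemma nbhs_interior_within (x : 'cV[R]_m) (A : set 'cV[R]_m) : open_cube x ->
  (\forall y \near within cube (nbhs x), A y) -> nbhs x (cube `&` A).
Proof.
move=> xo xA; have : nbhs x cube by have := xo; rewrite -interior_cube.
move=> /nbhs_eballP[r1 r10 H1]; move: xA => /nbhs_eballP[r2 r20 H2].
apply/nbhs_eballP; exists (Num.min r1 r2); first by rewrite lt_min r10.
move=> y; rewrite lt_min => /andP[y1 y2].
by split; [exact: H1|apply: H2 => //; exact: H1].
Qed.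

(** Away from the cube and where it is large, v is replaced by 0. The new
    function V is bounded, agrees with g almost everywhere on the cube, and
    agrees with v near both points. *)
Lemma coordinate_lipschitz : exists2 C, 0 < C & forall g Dg v (M : R), 0 <= M ->
  sobolev_real g Dg -> (forall i, \forall x \ae leb, cube x -> `|Dg x i 0| <= M) ->
  (\forall x \ae leb, cube x -> v x = g x) -> cube_continuous v ->
  forall x i h, 0 <= h -> open_cube x -> open_cube (x + h *: delta_mx i 0) ->
  `|v x - v (x + h *: delta_mx i 0)| <= C * M * h.
Proof.
have [beta [delta [beta0 delta0 lower]]] := bumpf_lower R.
have B0 : 0 < (beta * (2 * delta)) ^+ m by rewrite exprn_gt0 // mulr_gt0 // mulr_gt0.
exists (36 ^+ m / (beta * (2 * delta)) ^+ m); first by rewrite divr_gt0 // exprn_gt0.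
move=> g Dg v M M0 [[mg [Mg gMg]] LDg gDg] DgM vg cv x i h h0 xo xso.
pose s : 'cV[R]_m := h *: delta_mx i 0.
pose Mv := `|Mg| + `|v x| + `|v (x + s)| + 1.
pose V y := if `[< cube y /\ `|v y| <= Mv >] then v y else 0.
have Vg : \forall y \ae leb, cube y -> V y = g y.
  apply: filterS2 vg gMg => y vgy gy cy; rewrite /V asboolT ?(vgy cy) //; split=> //.
  rewrite (le_trans (gy cy)) // /Mv -!addrA (le_trans (ler_norm _)) // lerDl.
  by rewrite !addr_ge0.
have V0 y : ~ cube y -> V y = 0 by move=> nc; rewrite /V asboolF // => -[].
have VM y : `|V y| <= Mv.
  rewrite /V; case: ifPn => [/asboolP[]//|_]; rewrite normr0 /Mv !addr_ge0 //.
have mV : measurable_fun [set: E] (V : E -> R).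
  have mgc : measurable_fun [set: E] ((g : E -> R) \_ cube).
    exact: ((measurable_restrictT _ (@measurable_cube R m)).1 mg).
  apply: ae_measurable mgc; apply: filterS Vg => y Vgy _; rewrite patchE.
  by case: ifPn => [|/negP]; rewrite inE => cy; [rewrite Vgy|rewrite V0].
have VDg : weak_gradient V Dg.
  move=> phi tphi k; rewrite -(gDg phi tphi k).
  have mp : measurable_fun (cube : set E) (partial k phi : E -> R).
    exact: (measurable_fun_continuous (@test_partial_continuous _ _ _ tphi k)).
  have m1 : measurable_fun (cube : set E) ((fun y => (V y * partial k phi y)%:E) : E -> \bar R).
    by apply/measurable_EFinP; exact: (measurable_funM (measurable_funTS mV) mp).
  have m2 : measurable_fun (cube : set E) ((fun y => (g y * partial k phi y)%:E) : E -> \bar R).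
    by apply/measurable_EFinP; exact: (measurable_funM mg mp).
  apply: (@ae_eq_integral _ E R leb cube _ _ (@measurable_cube R m) m1 m2).
  by apply: filterS Vg => y Vgy cy; rewrite Vgy.
have near_V z : open_cube z -> `|v z| + 1 <= Mv ->
    forall w, 0 < w -> \forall y \near z, `|V y - V z| <= w.
  move=> zo zM w w0; have cz : cube z by apply/cubeP => k; exact: ltW.
  have w1 : 0 < Num.min w 1 by rewrite lt_min w0 ltr01.
  have VE y : cube y -> `|v y - v z| < 1 -> V y = v y.
    move=> cy yz; rewrite /V asboolT //; split=> //.
    rewrite (le_trans _ zM) // -{1}(subrK (v z) (v y)) (le_trans (ler_normD _ _)) //.
    by rewrite addrC lerD2l ltW.
  apply: filterS (nbhs_interior_within zo (cv z cz _ w1)) => y [cy].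
  rewrite lt_min => /andP[yw y1]; rewrite (VE y) // (VE z) ?subrr ?normr0 //.
  exact: ltW.
have x1 : `|v x| + 1 <= Mv.
  by rewrite /Mv lerD2r // -addrA addrCA lerDl addr_ge0.
have x2 : `|v (x + s)| + 1 <= Mv.
  by rewrite /Mv lerD2r // lerDr addr_ge0.
have cx : cube x by apply/cubeP => k; exact: ltW.
have cxs : cube (x + s) by apply/cubeP => k; exact: ltW.
have VE z : cube z -> `|v z| + 1 <= Mv -> V z = v z.
  by move=> cz zM; rewrite /V asboolT //; split=> //; rewrite (le_trans _ zM) // lerDl.
have := coordinate_lipschitz_bounded mV VM V0 VDg (fun i => (LDg i).1) DgM M0 h0 xo xso
  (near_V x xo x1) (near_V (x + s) xso x2) beta0 delta0 lower.
rewrite -/s (VE x) // (VE (x + s)) // -ler_pdivlMr // => /le_trans; apply.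
by rewrite le_eqVlt; apply/orP; left; apply/eqP; ring.
Qed.

(** The coordinates of the point are changed one after the other, which does
    not leave the cube. *)
Lemma open_cube_lipschitz v (K : R) : 0 <= K ->
  (forall x i h, 0 <= h -> open_cube x -> open_cube (x + h *: delta_mx i 0) ->
     `|v x - v (x + h *: delta_mx i 0)| <= K * h) ->
  forall x y : 'cV[R]_m, open_cube x -> open_cube y -> `|v x - v y| <= K * (m%:R * enorm (x - y)).
Proof.
move=> K0 vK.
have step1 (x y : 'cV[R]_m) i : open_cube x -> open_cube y -> (forall k, k != i -> x k 0 = y k 0) ->
    `|v x - v y| <= K * `|x i 0 - y i 0|.
  move=> xo yo xy.
  wlog yx : x y xo yo xy / x i 0 <= y i 0.
    move=> H; have [|/ltW] := leP (x i 0) (y i 0); first exact: H.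
    by move=> yx; rewrite distrC (distrC (x i 0)); apply: H => // k ki; rewrite xy.
  have e : y = x + (y i 0 - x i 0) *: delta_mx i 0.
    apply/matrixP => k j; rewrite ord1 !mxE eqxx andbT; case: eqP => [->|/eqP ki].
      by rewrite mulr1 addrC subrK.
    by rewrite mulr0 addr0 xy.
  have hy : 0 <= y i 0 - x i 0 by rewrite subr_ge0.
  have := vK x i _ hy xo; rewrite -e => /(_ yo)/le_trans; apply.
  by rewrite distrC ger0_norm.
have stepn (s : seq 'I_m) (x y : 'cV[R]_m) : open_cube x -> open_cube y ->
    (forall k, k \notin s -> x k 0 = y k 0) ->
    `|v x - v y| <= K * \sum_(k <- s) `|x k 0 - y k 0|.
  elim: s x => [|i s IH] x xo yo xy.
    rewrite (_ : x = y) ?subrr ?normr0 ?big_nil ?mulr0 //.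
    by apply/matrixP => k j; rewrite ord1 xy.
  pose x' : 'cV[R]_m := \col_k (if k == i then y k 0 else x k 0).
  have x'o : open_cube x' by move=> k; rewrite mxE; case: ifP.
  rewrite big_cons mulrDr -(subrKA (v x')) (le_trans (ler_normD _ _)) // lerD //.
    have := step1 x x' i xo x'o _; rewrite mxE eqxx; apply=> k /negPf ki.
    by rewrite mxE ki.
  rewrite (le_trans (IH x' x'o yo _)) //.
    move=> k ks; rewrite mxE; case: eqP => // /eqP ki; apply: xy.
    by rewrite inE negb_or ki.
  rewrite ler_wpM2l //; apply: ler_sum => k _; rewrite mxE; case: eqP => // _.
  by rewrite subrr normr0.
move=> x y xo yo; rewrite (le_trans (stepn (enum 'I_m) x y xo yo _)) //.
  by move=> k; rewrite mem_enum.
rewrite ler_wpM2l // big_enum /=; apply: ler_sum_const => k.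
by have := enorm_entry (x - y) k 0; rewrite !mxE.
Qed.

(** The points of the closed cube are approached along the segments to its
    centre, which run in the open cube. *)
Lemma cube_lipschitz v (K : R) : cube_continuous v -> 0 <= K ->
  (forall x y : 'cV[R]_m, open_cube x -> open_cube y -> `|v x - v y| <= K * enorm (x - y)) ->
  forall x y : 'cV[R]_m, cube x -> cube y -> `|v x - v y| <= K * enorm (x - y).
Proof.
move=> cv K0 vK x y cx cy; apply/ler_addgt0Pr => e e0.
have e2 : 0 < e / 2 by rewrite divr_gt0.
have scal_cube (z : 'cV[R]_m) t : cube z -> 0 < t < 1 -> open_cube (t *: z).
  move=> /cubeP cz /andP[t0 t1] k; rewrite !mxE normrM gtr0_norm //.
  have [z0|z0] := eqVneq `|z k 0| 0; first by rewrite z0 mulr0 invr_gt0.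
  rewrite (@lt_le_trans _ _ `|z k 0|) // gtr_pMl // lt_neqAle eq_sym z0.
  exact: normr_ge0.
have near1 (z : 'cV[R]_m) : cube z -> exists2 r, 0 < r & forall t, 0 < t < 1 -> 1 - t < r ->
    `|v (t *: z) - v z| < e / 2.
  move=> cz; have /nbhs_eballP[r r0 Hr] := cv z cz _ e2.
  exists (r / (enorm z + 1)); first by rewrite divr_gt0 // ltr_wpDl // enorm_ge0.
  move=> t t01; rewrite ltr_pdivlMr; last by rewrite ltr_wpDl // enorm_ge0.
  move=> tr; apply: Hr; last by apply/cubeP => k; apply/ltW/scal_cube.
  rewrite -[X in _ - X]scale1r -scalerBl enormZ distrC gtr0_norm; last first.
    by case/andP: t01 => _; rewrite subr_gt0.
  rewrite (le_lt_trans _ tr) // ler_wpM2l ?lerDl //.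
  by case/andP: t01 => _ /ltW; rewrite subr_ge0.
have [r1 r10 H1] := near1 x cx; have [r2 r20 H2] := near1 y cy.
pose u := Num.min 2^-1 (Num.min (r1 / 2) (r2 / 2)); pose t := 1 - u.
have u0 : 0 < u by rewrite !lt_min invr_gt0 ltr0n !divr_gt0.
have [uA uB uC] : [/\ u <= 2^-1, u <= r1 / 2 & u <= r2 / 2].
  by have := lexx u; rewrite {2}/u !le_min => /and3P[].
have t01 : 0 < t < 1 by apply/andP; rewrite /t; split; lra.
have ut : 1 - t = u by rewrite /t; ring.
have h1 : `|v (t *: x) - v x| < e / 2 by apply: H1 => //; rewrite ut; lra.
have h2 : `|v (t *: y) - v y| < e / 2 by apply: H2 => //; rewrite ut; lra.
have h3 := vK _ _ (scal_cube x t cx t01) (scal_cube y t cy t01).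
have h4 : K * enorm (t *: x - t *: y) <= K * enorm (x - y).
  rewrite ler_wpM2l // -scalerBr enormZ ler_piMl ?enorm_ge0 //.
  by case/andP: t01 => t0 t1; rewrite gtr0_norm // ltW.
have h5 := ler_distD (v (t *: x)) (v x) (v y).
have h6 := ler_distD (v (t *: y)) (v (t *: x)) (v y).
rewrite (distrC (v x) (v (t *: x))) in h5.
have key (p1 p2 p3 p4 p5 b : R) : p1 < e / 2 -> p2 < e / 2 -> p3 <= b ->
    p4 <= p1 + p5 -> p5 <= p3 + p2 -> p4 <= b + e by lra.
exact: key h1 h2 (le_trans h3 h4) h5 h6.
Qed.

End weak_gradient_lipschitz.


(** * Extension of boundary-value maps by zero *)

Section trace.
Context (R : realType) (m q n : nat).
Notation E := (euclid R m).
Implicit Types (w v : 'cV[R]_m -> qpoint R q n).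

(** The functions qdist (v x) T are Lipschitz with a constant that does not
    depend on T, and T may be the value of v at the second point. *)
Lemma trace_lipschitz w v : sobolev_q w ->
  (forall x, cube x -> forall e, 0 < e ->
     \forall y \near within cube (nbhs x), qdist (v y) (v x) < e) ->
  (\forall x \ae leb, cube x -> v x = w x) ->
  exists2 K, 0 <= K & forall x y : 'cV[R]_m, cube x -> cube y ->
    qdist (v x) (v y) <= K * enorm (x - y).
Proof.
move=> [_ [phi [[_ [M0 phiM]] _ wT]]] cv vw.
have [C C0 HC] := coordinate_lipschitz R m.
pose M := `|M0|; have M_ge0 : 0 <= M by exact: normr_ge0.
have CM0 : 0 <= C * M by rewrite mulr_ge0 // ltW.
exists (C * M * m%:R) => [|x y cx cy]; first by rewrite mulr_ge0.
have [Dg [sg gphi]] := wT (v y).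
pose vT z := qdist (v z) (v y).
have cvT : cube_continuous vT.
  move=> z cz e e0; move: (cv z cz e e0); apply: filterS => t.
  by apply: le_lt_trans; exact: qdist_lipl.
have DgM i : \forall x \ae leb, cube x -> `|Dg x i 0| <= M.
  apply: filterS2 phiM gphi => z zM zphi cz.
  rewrite (le_trans (enorm_entry _ _ _)) // (le_trans (zphi cz)) //.
  by rewrite (le_trans (ler_norm _)) // (le_trans (zM cz)) // ler_norm.
have vTw : \forall x \ae leb, cube x -> vT x = qdist (w x) (v y).
  by apply: filterS vw => z zw cz; rewrite /vT zw.
have h1 := open_cube_lipschitz CM0 (HC _ _ _ _ M_ge0 sg DgM vTw cvT).
have h2 : forall x y : 'cV[R]_m, open_cube x -> open_cube y ->
    `|vT x - vT y| <= C * M * m%:R * enorm (x - y).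
  by move=> a b oa ob; rewrite -mulrA; exact: h1.
have CMm : 0 <= C * M * m%:R by rewrite mulr_ge0.
have := cube_lipschitz cvT CMm h2 cx cy.
by rewrite /vT qdistxx subr0 ger0_norm ?qdist_ge0.
Qed.

End trace.

Section translation.
Context (R : realType) (q n : nat).
Implicit Types (P S : 'I_q -> 'cV[R]_n).

(** A matching of P and S is also one of the translated points. *)
Lemma qdist_translate P S c d :
  qdist (dirac_sum (fun i => P i - c)) (dirac_sum (fun i => S i - d)) <=
  qdist (dirac_sum P) (dirac_sum S) + q%:R * enorm (c - d).
Proof.
have [S' /dirac_sumP[s SS'] ->] := qdist_label P (dirac_sum S).
have -> : dirac_sum (fun i => S i - d) = dirac_sum (fun i => S' i - d).
  by apply/dirac_sumP; exists s => i; rewrite SS'.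
rewrite (le_trans (qdist_dirac_le _ _)) //.
have -> : (fun i => P i - c - (S' i - d)) = (fun i => (P i - S' i) + (d - c)).
  by apply/funext => i; apply/matrixP => k l; rewrite !mxE; ring.
rewrite (le_trans (fnormD _ _)) // lerD2l fnorm_le_const // => i.
by rewrite enorm_distC.
Qed.

End translation.

Section clamp.
Context (R : realType) (m : nat).

Lemma le_enorm (M N : 'cV[R]_m) : (forall i, `|M i 0| <= `|N i 0|) -> enorm M <= enorm N.
Proof.
move=> MN; rewrite /enorm ler_wsqrtr // /mdot; apply: ler_sum => i _.
rewrite !big_ord_recl !big_ord0 !addr0 -!expr2 -(real_normK (num_real (M i 0))).
by rewrite -(real_normK (num_real (N i 0))) lerXn2r ?nnegrE.
Qed.

(** The boundary point is found by truncating the coordinates of the exterior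
    point. *)
Lemma cube_boundary_point (x y : 'cV[R]_m) : cube x -> ~ cube y ->
  exists2 z, (cube `\` interior cube) z & enorm (x - z) <= enorm (x - y).
Proof.
move=> /cubeP cx ny; pose z : 'cV[R]_m := \col_i Num.max (- 2^-1) (Num.min (y i 0) 2^-1).
have [i yi] : exists i, 2^-1 < `|y i 0|.
  apply: contrapT => H; apply: ny; apply/cubeP => i; rewrite leNgt; apply/negP => yi.
  by apply: H; exists i.
have two : (- 2^-1 : R) <= 2^-1 by rewrite (@le_trans _ _ 0) ?oppr_le0 ?invr_ge0.
exists z.
  split; first by move=> k; rewrite !mxE le_max lexx ge_max two ge_min lexx orbT.
  rewrite interior_cube => /(_ i); rewrite mxE.
  have [y0|y0] := leP 0 (y i 0).
    rewrite ger0_norm // in yi; rewrite (min_idPr (ltW yi)) (max_idPr two) ger0_norm ?ltxx //.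
  rewrite ltr0_norm // ltrNr in yi.
  rewrite (min_idPl _) ?(le_trans (ltW yi)) // (max_idPl (ltW yi)) normrN.
  by rewrite ger0_norm ?ltxx.
apply: le_enorm => k; rewrite !mxE; have := cx k; rewrite ler_norml => /andP[xl xr].
have [y1|y1] := leP (y k 0) 2^-1.
  have [y2|y2] := leP (- 2^-1) (y k 0); first by [].
  by rewrite !ger0_norm; lra.
by rewrite (max_idPr two) !ler0_norm; lra.
Qed.

End clamp.

Section zero_extension.
Context (R : realType) (m q n : nat).
Notation E := (euclid R m).
Implicit Types (f : 'cV[R]_m -> qpoint R q n).

(** Between an interior and an exterior point one passes through the
    boundary, where f vanishes. *)
Lemma zero_extension_lipschitz f (K : R) : 0 <= K ->
  (forall x y : 'cV[R]_m, cube x -> cube y -> qdist (f x) (f y) <= K * enorm (x - y)) ->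
  (forall x, (cube `\` interior cube) x -> f x = dirac_sum (fun=> 0)) ->
  (forall x, ~ cube x -> f x = dirac_sum (fun=> 0)) -> lipschitz_q f.
Proof.
move=> K0 fK fb fout; exists K.
have mixed (x y : 'cV[R]_m) : cube x -> ~ cube y -> qdist (f x) (f y) <= K * enorm (x - y).
  move=> cx ny; have [z bz xz] := cube_boundary_point cx ny.
  by rewrite (fout y ny) -(fb z bz) (le_trans (fK x z cx bz.1)) // ler_wpM2l.
move=> x y; have [cx|nx] := pselect (cube x); have [cy|ny] := pselect (cube y).
- exact: fK.
- exact: mixed.
- by rewrite qdistC enorm_distC; exact: mixed.
- by rewrite !fout // qdistxx mulr_ge0 // enorm_ge0.
Qed.

(** The boundary values are subtracted from all sheets of the continuous
    representative v, and the result is extended by zero. On the set of full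
    measure where v and w agree the sheets are labelled as those of w. *)
Lemma boundary_extension (w : 'cV[R]_m -> qpoint R q n) wi Dwi (a : 'cV[R]_n) (L : 'M[R]_(n, m)) :
  sobolev_q w -> cube_boundary_values w (fun x => dirac_sum (fun=> a + L *m x)) ->
  approx_differential cube w wi Dwi ->
  exists f (g : 'I_q -> 'cV[R]_m -> 'cV[R]_n) (D : 'I_q -> 'cV[R]_m -> 'M[R]_(n, m)),
    [/\ lipschitz_q f, forall x, f x = dirac_sum (g^~ x),
        forall x, ~ cube x -> forall i, g i x = 0 /\ D i x = 0,
        \forall x \ae leb, qdiff_at f (g^~ x) (D^~ x) x
      & forall x, cube x -> forall i, D i x = Dwi i x - L].
Proof.
move=> sw [v [cv vw vb]] [ww aw].
have [K K0 vK] := trace_lipschitz sw cv vw.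
pose lab x := if `[< v x = w x >] then wi^~ x else qpoint_pts (v x).
have labE x : cube x -> dirac_sum (lab x) = v x.
  move=> cx; rewrite /lab; case: ifPn => [/asboolP ->|_]; last exact: qpoint_ptsK.
  by rewrite ww.
pose c x := a + L *m x.
pose g i x := if `[< cube x >] then lab x i - c x else 0.
pose D i x := if `[< cube x >] then Dwi i x - L else 0.
pose f x := dirac_sum (g^~ x).
have fin x : cube x -> f x = dirac_sum (fun i => lab x i - c x).
  by move=> cx; rewrite /f /g asboolT.
have fout x : ~ cube x -> f x = dirac_sum (fun=> 0) by move=> nx; rewrite /f /g asboolF.
have [B B0 LB] := fnorm_mulmx_le (fun _ : 'I_1 => L).
have cB x y : enorm (c x - c y) <= B * enorm (x - y).
  rewrite /c opprD addrACA subrr add0r -mulmxBr.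
  exact: le_trans (enorm_le_fnorm (fun _ : 'I_1 => L *m (x - y)) 0) (LB _).
have lf : lipschitz_q f.
  apply: (@zero_extension_lipschitz f (K + q%:R * B)) => //.
  - by rewrite addr_ge0 // mulr_ge0 // ltW.
  - move=> x y cx cy; rewrite (fin x cx) (fin y cy) (le_trans (qdist_translate _ _ _ _)) //.
    by rewrite !labE // mulrDl -mulrA lerD ?vK // ler_wpM2l.
  - move=> x bx; have cx := bx.1; rewrite (fin x cx); congr dirac_sum; apply/funext => i.
    have := vb x bx; rewrite -(labE x cx) => /dirac_sum_cst/(_ i) ->.
    exact: subrr.
exists f, g, D; split=> //.
- by move=> x nx i; rewrite /g /D asboolF.
- pose G := [set x | cube x -> v x = w x].
  have G0 : leb.-negligible (~` G : set E) by exact: vw.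
  have mG : measurable (G : set E).
    by rewrite -(setCK G); apply: measurableC; exact: (@leb_complete R m).
  have GF (F : set 'cV[R]_m) : leb (F `\` G : set E) = 0%E.
    have [N [mN N0 sN]] := G0; apply/eqP; rewrite eq_le measure_ge0 andbT -N0.
    by apply: le_lebesgue_outer => x [_ Gx]; exact: sN.
  apply: filterS3 aw vw (@ae_interior_cube R m) => x ax vwx ix.
  have [cx|nx] := pselect (cube x); last first.
    have gD : g^~ x = (fun=> 0) /\ D^~ x = (fun=> 0).
      by split; apply/funext => i; rewrite /g /D asboolF.
    rewrite gD.1 gD.2; split=> // [|e e0]; first exact: fout.
    have : nbhs x (~` cube).
      by apply: open_nbhs_nbhs; split=> //; rewrite openC; exact: closed_box.
    apply: filterS => y ny; rewrite fout // (_ : (fun=> _) = (fun=> 0)).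
      by rewrite qdistxx mulr_ge0 ?enorm_ge0 // ltW.
    by apply/funext => i; rewrite mul0mx addr0.
  have [[F [Fc dF HF]] PD] := ax cx.
  have gE i : g i x = wi i x - c x by rewrite /g /lab !asboolT //; exact: vwx.
  have DE i : D i x = Dwi i x - L by rewrite /D asboolT.
  apply: (@density_one_qdiff _ _ _ _ f (g^~ x) (D^~ x) x (F `&` G) lf); last 1 first.
  + move=> e e0; move: (HF e e0) => /nbhs_eballP[r r0 Hr].
    apply/nbhs_eballP; exists r => // y yx [Fy Gy].
    rewrite (le_trans _ (Hr y yx Fy)) //.
    have cy := Fc y Fy; rewrite (fin y cy).
    have -> : (fun i => g i x + D i x *m (y - x)) =
        (fun i => (wi i x + Dwi i x *m (y - x)) - c y).
      apply/funext => i; rewrite gE DE mulmxBl.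
      have -> : c y = c x + L *m (y - x) by rewrite /c -addrA -mulmxDr [x + _]addrC subrK.
      by rewrite [- (c x + _)]opprD addrACA.
    by rewrite (le_trans (qdist_translate _ _ _ _)) // subrr enorm0 mulr0 addr0 labE // Gy.
  + exact: density_one_setI.
  + by [].
  + by move=> i j; rewrite !gE !DE => /addIr/PD ->.
- by move=> x cx i; rewrite /D asboolT.
Qed.

End zero_extension.


(** * Sheets through the origin *)

Section disjoint_translates.
Context (R : realType) (m : nat).
Notation E := (euclid R m).
Implicit Types (X Z : set 'cV[R]_m).

Lemma leb_translate X z : leb ([set x | X (x + z)] : set E) = leb (X : set E).
Proof.
have := lebesgue_outer_affine z X (ltr01 : 0 < (1 : R)).
rewrite expr1n invr1 mul1e => e; apply: etrans e; congr (lebesgue_outer _).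
by apply/seteqP; split=> x; rewrite /= /affine scale1r.
Qed.

Lemma measurable_translate X z : measurable (X : set E) ->
  measurable ([set x | X (x + z)] : set E).
Proof.
move=> mX; rewrite (_ : [set x | _] = affine 1 z @^-1` X).
  exact: measurable_affine.
by apply/seteqP; split=> x; rewrite /= /affine scale1r.
Qed.

(** Infinitely many disjoint translates of X lie in a box of finite volume. *)
Lemma disjoint_translates_null X (a b : 'cV[R]_m) (z : nat -> 'cV[R]_m) :
  measurable (X : set E) -> (forall k x, X (x + z k) -> box a b x) ->
  (forall j k x, X (x + z j) -> X (x + z k) -> j = k) -> leb (X : set E) = 0%E.
Proof.
move=> mX Xb dX.
pose F k := [set x : 'cV[R]_m | X (x + z k)].
have mF k : measurable (F k : set E) by exact: measurable_translate.
have tF : trivIset setT (F : nat -> set E).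
  by apply/trivIsetP => j k _ _ jk; apply/seteqP; split=> // x [Xj Xk]; move: jk; rewrite (dX j k x) ?eqxx.
have sumF : (\sum_(0 <= k <oo) leb (F k : set E) <= (box_volume a b)%:E)%E.
  rewrite -leb_box -measure_semi_bigcup //; last exact: bigcupT_measurable.
  by apply: le_lebesgue_outer => x [k _]; exact: Xb.
have NX N : ((N%:R)%:E * leb (X : set E) <= (box_volume a b)%:E)%E.
  apply: le_trans sumF; apply: (@le_trans _ _ (\sum_(0 <= k < N) leb (F k : set E))%E).
    rewrite (eq_bigr (fun=> leb (X : set E))); last by move=> k _; exact: leb_translate.
    by rewrite mule_natl big_mkord sumr_const card_ord.
  by apply: nneseries_lim_ge.
have Xfin : leb (X : set E) \is a fin_num.
  rewrite ge0_fin_numE ?measure_ge0 // (le_lt_trans _ (ltry (box_volume a b))) //.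
  by have := NX 1%N; rewrite mul1e.
have : (0 <= leb (X : set E))%E := measure_ge0 (@leb R m) _.
have [c Xc] : exists c, leb (X : set E) = c%:E by exists (fine (leb (X : set E))); rewrite fineK.
move: NX; rewrite Xc => NX.
rewrite lee_fin le_eqVlt => /orP[/eqP <- //|c0]; exfalso.
pose N := Num.truncn (box_volume a b / c).
have := NX N.+1; rewrite -EFinM lee_fin -ler_pdivlMr // leNgt.
by rewrite truncnS_gt.
Qed.

End disjoint_translates.

Section zero_sheets.
Context (R : realType) (m q n : nat).
Notation E := (euclid R m).
Implicit Types (f : 'cV[R]_m -> qpoint R q n).

Definition zero_sheet f : set 'cV[R]_m := [set x | exists i, qpoint_pts (f x) i = 0].

Lemma zero_sheetP f P x : f x = dirac_sum P -> zero_sheet f x <-> exists i, P i = 0.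
Proof.
move=> fx; have := qpoint_ptsK (f x); rewrite {2}fx => /dirac_sumP[s fs].
split=> -[i Pi0]; first by exists (s i); rewrite -fs.
by exists (s^-1 i)%g; rewrite fs permKV.
Qed.

Lemma positive_min (P : 'I_q -> 'cV[R]_n) : exists2 d, 0 < d & forall i, P i != 0 -> d <= enorm (P i).
Proof.
exists (\big[Num.min/1]_(i | P i != 0) enorm (P i)).
  apply/bigmin_gtP; split=> // i Pi; rewrite lt_neqAle enorm_ge0 andbT eq_sym.
  by apply: contraNneq Pi => /enorm_eq0 ->.
by move=> i Pi; apply: bigmin_le_cond.
Qed.

(** Sheets at a positive distance from the origin stay away from it under
    small perturbations. *)
Lemma closed_zero_sheet f : lipschitz_q f -> closed (zero_sheet f).
Proof.
move=> /lipschitz_q_gt0[K K0 fK]; rewrite -openC openE => x nx.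
have [d d0 Pd] := positive_min (qpoint_pts (f x)).
apply/nbhs_eballP; exists (d / K); first by rewrite divr_gt0.
move=> y; rewrite ltr_pdivlMr // mulrC => yx.
have [S fy e] := qdist_label (qpoint_pts (f x)) (f y).
move/(zero_sheetP fy) => [i Si]; apply: nx.
exists i; apply/eqP; apply: contraT => /Pd.
rewrite leNgt => /negP[]; apply: le_lt_trans yx.
rewrite enorm_distC (le_trans _ (fK x y)) // -{2}(qpoint_ptsK (f x)) e.
have := enorm_le_fnorm (fun i => qpoint_pts (f x) i - S i) i.
by rewrite Si subr0.
Qed.

(** By the cluster condition, all the sheets through the origin have the same
    derivative and leave the origin along the axis at nonzero speed; the other
    sheets stay away from it. *)
Lemma zero_sheet_isolated f P D x i (k : 'I_m) : qdiff_at f P D x -> P i = 0 ->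
  D i *m (delta_mx k 0 : 'cV[R]_m) != 0 ->
  \forall t \near (0 : R), t != 0 -> ~ zero_sheet f (x + t *: delta_mx k 0).
Proof.
move=> [fx H PD] Pi0 Dik.
have [d d0 Pd] := positive_min P.
pose c := enorm (D i *m (delta_mx k 0 : 'cV[R]_m)).
have c0 : 0 < c.
  by rewrite lt_neqAle enorm_ge0 andbT eq_sym; apply: contraNneq Dik => /enorm_eq0 ->.
have [B B0 DB] := fnorm_mulmx_le D.
have c2 : 0 < c / 2 by rewrite divr_gt0.
have /nbhs_eballP[r r0 Hr] := H _ c2.
have Bc : 0 < B + c by rewrite addr_gt0.
apply/nbhs_ballP; exists (Num.min r (d / (B + c))); first by rewrite /= lt_min r0 divr_gt0.
move=> t; rewrite -ball_normE /= sub0r normrN lt_min => /andP[tr td] t0.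
have tpos : 0 < `|t| by rewrite normr_gt0.
have et : enorm (x + t *: delta_mx k 0 - x) = `|t|.
  by rewrite addrAC subrr add0r enormZ enorm_delta mulr1.
have {Hr} := Hr (x + t *: delta_mx k 0); rewrite et => /(_ tr).
rewrite [x + _]addrC addrK [_ + x]addrC => Ht.
have [S fy e] := qdist_label (fun i => P i + D i *m (t *: delta_mx k 0)) (f (x + t *: delta_mx k 0)).
rewrite qdistC e in Ht.
have Sj j : enorm (P j + D j *m (t *: delta_mx k 0) - S j) <= c / 2 * `|t|.
  exact: le_trans (enorm_le_fnorm (fun j => P j + D j *m (t *: delta_mx k 0) - S j) j) Ht.
move/(zero_sheetP fy) => [j Sj0]; have := Sj j; rewrite Sj0 subr0.
(* A sheet through the origin has moved by c |t| up to c |t| / 2; another one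
   started at distance at least d and has moved by at most (B + c) |t|. *)
have [Pj0|Pj] := eqVneq (P j) 0.
  rewrite Pj0 add0r (PD j i); last by rewrite Pj0 Pi0.
  rewrite -scalemxAr enormZ -/c mulrC ler_pM2r // => cc; move: cc c0; lra.
have := Pd j Pj; have := DB (t *: delta_mx k 0).
move/(le_trans (enorm_le_fnorm (fun i => D i *m (t *: delta_mx k 0)) j)).
rewrite enormZ enorm_delta mulr1.
have := enormB (P j + D j *m (t *: delta_mx k 0)) (D j *m (t *: delta_mx k 0)).
rewrite addrK; move: td; rewrite ltr_pdivlMr //.
have : c / 2 * `|t| <= c * `|t| by rewrite ler_pM2r // ler_pdivrMr // ler_pMr // ler1n.
move: (enorm _) (enorm (P j)) (enorm _) => e1 e2 e3; rewrite mulrDr.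
rewrite (mulrC `|t| B) (mulrC `|t| c); lra.
Qed.

End zero_sheets.

Section zero_sheets_flat.
Context (R : realType) (m q n : nat).
Notation E := (euclid R m).
Implicit Types (f : 'cV[R]_m -> qpoint R q n).

Let isolated f N (k : 'I_m) : set 'cV[R]_m :=
  [set x | [/\ cube x, zero_sheet f x & forall a b, (N <= a)%N -> (N <= b)%N -> a != b ->
     ~ zero_sheet f (x + (step R a k - step R b k))]].

Let measurable_isolated f N k : lipschitz_q f -> measurable (isolated f N k : set E).
Proof.
move=> lf.
pose G a b : set 'cV[R]_m := [set x | (N <= a)%N -> (N <= b)%N -> a != b ->
  ~ zero_sheet f (x + (step R a k - step R b k))].
have mZ : measurable (zero_sheet f : set E) by apply/measurable_closed/closed_zero_sheet.
have mG a b : measurable (G a b : set E).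
  have [H|H] := boolP [&& N <= a, N <= b & a != b]%N.
    rewrite (_ : G a b = ~` [set x | zero_sheet f (x + (step R a k - step R b k))]).
      exact/measurableC/measurable_translate.
    by case/and3P: H => Na Nb ab; apply/seteqP; split=> x /= Hx; [exact: Hx|].
  rewrite (_ : G a b = setT); first exact: measurableT.
  by apply/seteqP; split=> // x _ Na Nb ab; move: H; rewrite Na Nb ab.
rewrite (_ : isolated f N k = cube `&` (zero_sheet f `&` \bigcap_a \bigcap_b G a b)).
  apply: measurableI; first exact: measurable_cube.
  apply: measurableI => //.
  by apply: bigcapT_measurable => a; exact: bigcapT_measurable.
apply/seteqP; split=> [x [cx Zx H]|x [cx [Zx H]]]; split=> //.
  by split=> // a _ b _; exact: H.
by move=> a b; exact: (H a I b I).
Qed.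

Let isolated_null f N k : lipschitz_q f -> leb (isolated f N k : set E) = 0%E.
Proof.
move=> lf.
apply: (@disjoint_translates_null _ _ _ (const_mx (-2)) (const_mx 2) (fun j => - step R (N + j) k)).
- exact: measurable_isolated.
- by move=> j x [cx _ _]; apply: cube_big_box cx; exact: enorm_step_le1.
- move=> j l x [_ _ Hj] [_ Zl _]; apply/eqP; apply: contraT => jl; exfalso.
  apply: (Hj (N + j)%N (N + l)%N); rewrite ?leq_addr ?eqn_add2l //.
  by rewrite addrA subrK.
Qed.

(** At a point where a sheet crosses the origin with nonzero derivative, the
    zeros of the sheets are isolated along some axis; the translates of such a
    set by small steps along the axis are disjoint, so that it is a null set. *)
Lemma zero_sheet_flat f (P : 'I_q -> 'cV[R]_m -> 'cV[R]_n) (D : 'I_q -> 'cV[R]_m -> 'M[R]_(n, m)) :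
  lipschitz_q f -> (\forall x \ae leb, qdiff_at f (P^~ x) (D^~ x) x) ->
  \forall x \ae leb, cube x -> forall i, P i x = 0 -> D i x = 0.
Proof.
move=> lf df.
have iso k : \forall x \ae leb, forall N, ~ isolated f N k x.
  apply/ae_foralln => N; exists (isolated f N k); split.
  - exact: measurable_isolated.
  - exact: isolated_null.
  - by move=> x /contrapT.
have iso' : \forall x \ae leb, forall k N, ~ isolated f N k x by exact: filter_forall.
apply: filterS2 df iso' => x dfx Hx cx i Pi0.
have [fx _ _] := dfx.
apply/matrixP => a k; rewrite mxE -mulmx_delta.
have [->|Dik] := eqVneq (D i x *m (delta_mx k 0 : 'cV[R]_m)) 0; first by rewrite mxE.
exfalso.
have /nbhs_ballP[r /= r0 Hr] := zero_sheet_isolated dfx Pi0 Dik.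
have [N _ HN] := natSinv_near r0.
apply: (Hx k N); split=> //.
  by apply/(zero_sheetP fx); exists i.
move=> b c Nb Nc bc.
rewrite /step -scalerBl; apply: Hr.
  rewrite -ball_normE /= sub0r normrN.
  have [b1 c1] := (HN b Nb, HN c Nc); rewrite /= in b1 c1.
  have : 0 < b.+1%:R^-1 :> R by rewrite invr_gt0.
  have : 0 < c.+1%:R^-1 :> R by rewrite invr_gt0.
  move: b1 c1; move: (_^-1) (_^-1) => s t b1 c1 s0 t0.
  by rewrite ltr_norml; apply/andP; split; lra.
rewrite subr_eq0; apply: contra bc => /eqP/invr_inj/eqP.
by rewrite eqr_nat eqSS.
Qed.

End zero_sheets_flat.


(** * Semiellipticity for fewer sheets *)

Section padding.
Context (R : realType) (q r : nat).

Definition pad (V : nmodType) (P : 'I_q -> V) : 'I_(q + r) -> V :=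
  fun i => if fintype.split i is inl j then P j else 0.

Lemma pad_lshift (V : nmodType) (P : 'I_q -> V) j : pad P (lshift r j) = P j.
Proof. by rewrite /pad (unsplitK (inl j)). Qed.

Lemma pad_rshift (V : nmodType) (P : 'I_q -> V) j : pad P (rshift q j) = 0.
Proof. by rewrite /pad (unsplitK (inr j)). Qed.

(** The permutation s acts on the first q indices and fixes the others. *)
Lemma pad_perm (V : nmodType) (P : 'I_q -> V) (s : 'S_q) :
  exists t : 'S_(q + r), forall i, pad (P \o s) i = pad P (t i).
Proof.
pose h i := unsplit (match fintype.split i with inl j => inl (s j) | inr k => inr k end) : 'I_(q + r).
have hl j : h (lshift r j) = lshift r (s j) by rewrite /h (unsplitK (inl j)).
have hr j : h (rshift q j) = rshift q j by rewrite /h (unsplitK (inr j)).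
have inj_h : injective h.
  move=> i j; case: (split_ordP i) => i' ->; case: (split_ordP j) => j' ->; rewrite ?hl ?hr.
  - by move=> /lshift_inj/perm_inj ->.
  - by move=> /eqP; rewrite eq_lrshift.
  - by move=> /eqP; rewrite eq_rlshift.
  - by [].
exists (perm inj_h) => i; rewrite permE.
by case: (split_ordP i) => j ->; rewrite ?hl ?hr ?pad_lshift ?pad_rshift.
Qed.

Lemma qdist_pad (n : nat) (P S : 'I_q -> 'cV[R]_n) :
  qdist (dirac_sum (pad P)) (dirac_sum (pad S)) <= qdist (dirac_sum P) (dirac_sum S).
Proof.
have [S' /dirac_sumP[s SS'] ->] := qdist_label P (dirac_sum S).
have [t St] := pad_perm S' s.
have -> : dirac_sum (pad S) = dirac_sum (pad S').
  apply/dirac_sumP; exists t => i; rewrite -St; congr (pad _ _).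
  by apply/funext => j; exact: SS'.
rewrite (le_trans (qdist_dirac_le _ _)) // !fnormE ler_wsqrtr // big_split_ord /=.
rewrite [X in _ + X]big1 ?addr0 => [|j _]; last by rewrite !pad_rshift subrr enorm0 expr0n.
by apply: ler_sum => j _; rewrite !pad_lshift.
Qed.

End padding.

Arguments pad {q} r {V} P i.

Section fewer_sheets.
Context (R : realType) (m n q r : nat).
Notation E := (euclid R m).
Variable A : {linear 'M[R]_(n, m) -> 'M[R]_(n, m)}.
Implicit Types (f : 'cV[R]_m -> qpoint R q n).

(** The hypothesis on the zeros of P is the cluster condition between a sheet
    and the added zero sheets. *)
Lemma qdiff_pad f (f' : 'cV[R]_m -> qpoint R (q + r) n) (P : 'I_q -> 'cV[R]_n) (D : 'I_q -> 'M[R]_(n, m)) x :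
  (forall y, f' y = dirac_sum (pad r (qpoint_pts (f y)))) ->
  qdiff_at f P D x -> (forall i, P i = 0 -> D i = 0) -> qdiff_at f' (pad r P) (pad r D) x.
Proof.
move=> f'E [fx H PD] PD0; split.
- rewrite f'E; apply: qdist0_eq; apply/eqP; rewrite eq_le qdist_ge0 andbT.
  by rewrite (le_trans (qdist_pad _ _ _)) // qpoint_ptsK fx qdistxx.
- move=> e e0; move: (H e e0); apply: filterS => y; apply: le_trans.
  rewrite f'E (_ : (fun i => pad r P i + pad r D i *m (y - x)) =
    pad r (fun i => P i + D i *m (y - x))).
    by rewrite (le_trans (qdist_pad _ _ _)) // qpoint_ptsK.
  apply/funext => i; case: (split_ordP i) => j ->; rewrite ?pad_lshift ?pad_rshift //.
  by rewrite mul0mx addr0.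
- move=> i j; case: (split_ordP i) => i' ->; case: (split_ordP j) => j' ->;
    rewrite ?pad_lshift ?pad_rshift //; first exact: PD.
    exact: PD0.
  by move=> /esym/PD0.
Qed.

(** Zero sheets are added to f. By zero_sheet_flat the differential of f
    vanishes almost everywhere where a sheet of f meets them, as the cluster
    condition requires; the energy does not change. *)
Lemma semielliptic_fewer f (g : 'I_q -> 'cV[R]_m -> 'cV[R]_n) (D : 'I_q -> 'cV[R]_m -> 'M[R]_(n, m)) :
  semielliptic (q + r) A -> lipschitz_q f -> (forall x, f x = dirac_sum (g^~ x)) ->
  (forall x, ~ cube x -> forall i, g i x = 0 /\ D i x = 0) ->
  (\forall x \ae leb, qdiff_at f (g^~ x) (D^~ x) x) ->
  (0 <= \int[leb]_(x in [set: E]) (\sum_i mdot (A (D i x)) (D i x))%:E)%E.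
Proof.
move=> seA lf fg gD0 df.
pose f' x := dirac_sum (pad r (qpoint_pts (f x))).
have f'E y : f' y = dirac_sum (pad r (qpoint_pts (f y))) by [].
have fE x : f' x = dirac_sum (pad r (g^~ x)).
  apply: qdist0_eq; apply/eqP; rewrite eq_le qdist_ge0 andbT.
  by rewrite (le_trans (qdist_pad _ _ _)) // qpoint_ptsK fg qdistxx.
have [K K0 fK] := lipschitz_q_gt0 lf.
have lf' : lipschitz_q f'.
  exists K => x y; rewrite /f' (le_trans (qdist_pad _ _ _)) // !qpoint_ptsK.
  exact: fK.
have sf' : compactly_supported f'.
  exists cube; split=> [|x nx]; first exact: compact_box.
  rewrite fE; congr dirac_sum; apply/funext => i.
  by case: (split_ordP i) => j ->; rewrite ?pad_lshift ?pad_rshift // (gD0 x nx j).1.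
have af' : approx_differential setT f' (fun i x => pad r (g^~ x) i) (fun i x => pad r (D^~ x) i).
  apply: qdiff_approx_differential.
  - exact: measurableT.
  - by move=> x _; exact: fE.
  - by apply: aeW => x _; exact: filterT.
  - apply: filterS2 df (zero_sheet_flat lf df) => x dfx zx _.
    apply: (qdiff_pad f'E dfx) => i gi0.
    by have [cx|nx] := pselect (cube x); [exact: zx|exact: (gD0 x nx i).2].
have := seA _ _ _ lf' sf' af'.
under eq_integral => x _.
  rewrite big_split_ord /= [X in _ + X]big1 ?addr0 => [|j _]; last first.
    by rewrite pad_rshift linear0 -(scale0r 0) mdotZl mul0r.
  under eq_bigr => j _ do rewrite pad_lshift.
  over.
by [].
Qed.

End fewer_sheets.


(** * Semiellipticity implies quasiconvexity *)

Section integral_of_differential.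
Context (R : realType) (m q n : nat).
Notation E := (euclid R m).
Implicit Types (f : 'cV[R]_m -> qpoint R q n).

Lemma lipschitz_continuous (h : 'cV[R]_m -> R) (C : R) :
  (forall x y, `|h x - h y| <= C * enorm (x - y)) -> continuous h.
Proof.
move=> hC x; have FF := nbhs_filter x.
apply/cvgrPdist_le => e e0; apply/nbhs_eballP.
exists (e / (`|C| + 1)); first by rewrite divr_gt0 // ltr_wpDl.
move=> y; rewrite ltr_pdivlMr ?ltr_wpDl // => /ltW; apply: le_trans.
rewrite (le_trans (hC _ _)) // enorm_distC mulrC ler_wpM2l ?enorm_ge0 //.
by rewrite (le_trans (ler_norm C)) // lerDl.
Qed.

(** The sum of the sheets is a Lipschitz function with bounded support, so that
    its derivatives have vanishing integral. *)
Lemma sum_differential_entry f (P : 'I_q -> 'cV[R]_m -> 'cV[R]_n)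
    (D : 'I_q -> 'cV[R]_m -> 'M[R]_(n, m)) a k :
  lipschitz_q f -> (forall x, ~ cube x -> f x = dirac_sum (fun=> 0)) ->
  (forall x, ~ cube x -> forall i, D i x = 0) ->
  (\forall x \ae leb, qdiff_at f (P^~ x) (D^~ x) x) ->
  leb.-integrable [set: E] (EFin \o ((fun x => \sum_i D i x a k) : E -> R)) /\
  (\int[leb]_(x in [set: E]) (\sum_i D i x a k)%:E = 0)%E.
Proof.
move=> /lipschitz_q_gt0[K K0 fK] f0 D0 df.
pose g := sheet_sum f a; pose C := q%:R * K.
have C0 : 0 <= C by rewrite mulr_ge0 // ltW.
have gC (x y : 'cV[R]_m) : `|g x - g y| <= C * enorm (x - y).
  by rewrite (le_trans (sheet_sum_lip _ _ _ _)) // -mulrA ler_wpM2l.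
have cg : continuous g := lipschitz_continuous gC.
have g0 x : ~ cube x -> g x = 0.
  by move=> /f0 fx; rewrite /g (sheet_sumE a fx) big1 // => i _; rewrite mxE.
have [Mg Mg0 gM] := cube_bounded cg g0.
pose dq N (x : 'cV[R]_m) := N.+1%:R * (g (x + step R N k) - g x).
have dqC N x : `|dq N x| <= C.
  rewrite normrM ger0_norm // mulrC -ler_pdivlMr // (le_trans (gC _ _)) //.
  by rewrite addrAC subrr add0r enorm_step.
have dqcvg : \forall x \ae leb, dq^~ x @ \oo --> \sum_i D i x a k.
  by apply: filterS df => x dfx; exact: sheet_sum_dq_cvg dfx.
have cdq N : continuous (dq N).
  apply: (@lipschitz_continuous _ (N.+1%:R * (C + C))) => x y.
  rewrite (_ : dq N x - dq N y = N.+1%:R *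
    ((g (x + step R N k) - g (y + step R N k)) - (g x - g y))); last by rewrite /dq; ring.
  rewrite normrM ger0_norm // -mulrA ler_wpM2l // mulrDl (le_trans (ler_normB _ _)) //.
  rewrite lerD // (le_trans (gC _ _)) //.
  by rewrite (_ : x + step R N k - (y + step R N k) = x - y) // opprD addrACA subrr addr0.
have md : measurable_fun [set: E] ((fun x => \sum_i D i x a k) : E -> R).
  apply: (@measurable_ae_limit _ _ _ dq); first exact: measurableT.
    by move=> N; exact: measurable_fun_continuous.
  by apply: filterS dqcvg => x hx _.
have dC : \forall x \ae leb, `|\sum_i D i x a k| <= C.
  apply: filterS dqcvg => x hx; have hn : `|dq N x| @[N --> \oo] --> `|\sum_i D i x a k| by exact: cvg_norm hx.
  rewrite -(cvg_lim _ hn) //; apply: limr_le; first by apply/cvg_ex; eexists; exact: hn.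
  by apply: nearW => N; exact: dqC.
split.
  apply: (ae_bounded_box_integrable (a := const_mx (- 2^-1)) (b := const_mx 2^-1) md dC).
  by apply: aeW => x nx; rewrite big1 // => i _; rewrite D0 // mxE.
have supp N (x : 'cV[R]_m) : ~ box (const_mx (-2)) (const_mx 2) x ->
    g x = 0 /\ g (x + step R N k) = 0.
  move=> nx; split; apply: g0 => cx; apply: nx.
    by apply: (@cube_big_box _ _ x 0); rewrite ?enorm0 ?subr0.
  apply: (@cube_big_box _ _ x (- step R N k)); last by rewrite opprK.
  by rewrite enormN enorm_step_le1.
pose one : 'cV[R]_m -> R := cst 1.
have cone : continuous one by move=> x; exact: cst_continuous.
have oneM (x : 'cV[R]_m) : `|one x| <= 1 by rewrite /one normr1.
have done_ N (x : 'cV[R]_m) : `|N.+1%:R * (one x - one (x - step R N k))| <= C.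
  by rewrite /one /cst subrr mulr0 normr0.
have supp1 N (x : 'cV[R]_m) : ~ box (const_mx (-2)) (const_mx 2) x ->
    [/\ g x * one x = 0, g (x + step R N k) * one x = 0 & g x * one (x - step R N k) = 0].
  by move=> nx; have [-> ->] := supp N x nx; rewrite !mul0r.
have cvg1 (x : 'cV[R]_m) :
    (fun N => N.+1%:R * (one x - one (x - step R N k))) @ \oo --> (cst 0 : 'cV[R]_m -> R) x.
  by rewrite /one /cst; under eq_fun do rewrite subrr mulr0; exact: cvg_cst.
have H := integral_dq_parts cg cone gM oneM dqC done_ supp1 dqcvg cvg1.
transitivity (\int[leb]_(x in [set: E]) ((\sum_i D i x a k) * one x)%:E)%E.
  by apply: eq_integral => x _; rewrite mulr1.
rewrite H; under eq_integral do rewrite mulr0 oppr0.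
by rewrite integral0.
Qed.

(** A linear expression of the sum of the differentials is a combination of
    its entries. *)
Lemma sum_differential f (P : 'I_q -> 'cV[R]_m -> 'cV[R]_n)
    (D : 'I_q -> 'cV[R]_m -> 'M[R]_(n, m)) (N : 'M[R]_(n, m)) :
  lipschitz_q f -> (forall x, ~ cube x -> f x = dirac_sum (fun=> 0)) ->
  (forall x, ~ cube x -> forall i, D i x = 0) ->
  (\forall x \ae leb, qdiff_at f (P^~ x) (D^~ x) x) ->
  leb.-integrable [set: E] (EFin \o ((fun x => \sum_i mdot N (D i x)) : E -> R)) /\
  (\int[leb]_(x in [set: E]) (\sum_i mdot N (D i x))%:E = 0)%E.
Proof.
move=> lf f0 D0 df.
pose h (p : 'I_n * 'I_m) (x : E) : \bar R := ((N p.1 p.2)%:E * (\sum_i D i x p.1 p.2)%:E)%E.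
have ih p : leb.-integrable [set: E] (h p).
  have [i0 _] := sum_differential_entry p.1 p.2 lf f0 D0 df.
  exact: (integrableZl measurableT _ i0).
have hE : (fun x : E => (\sum_i mdot N (D i x))%:E) = (fun x => \sum_p h p x)%E.
  apply/funext => x; rewrite /h -(pair_bigA _ (fun a k => (N a k)%:E * (\sum_i D i x a k)%:E)%E) /=.
  under [RHS]eq_bigr => a _ do (under eq_bigr => k _ do rewrite -EFinM; rewrite sumEFin).
  rewrite sumEFin; congr EFin; rewrite /mdot exchange_big /=; apply: eq_bigr => a _.
  by rewrite exchange_big /=; apply: eq_bigr => k _; rewrite mulr_sumr.
rewrite [EFin \o _]hE hE; split.
  exact: integrable_sum.
rewrite integral_sum //; apply: big1 => p _.
have [i0 e0] := sum_differential_entry p.1 p.2 lf f0 D0 df.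
by rewrite (integralZl measurableT i0) e0 mule0.
Qed.

End integral_of_differential.


Section block_inequality.
Context (R : realType) (m n q r : nat).
Notation E := (euclid R m).
Variable A : {linear 'M[R]_(n, m) -> 'M[R]_(n, m)}.
Hypothesis symA : symmetric_map A.

(** The cross terms of the expansion are equal because A is symmetric. *)
Lemma quadratic_translate (D : 'I_q -> 'M[R]_(n, m)) L :
  \sum_i mdot (A (D i)) (D i) =
  \sum_i mdot (A (D i - L)) (D i - L) + \sum_i mdot (2 *: A L) (D i - L) + \sum_(i < q) mdot (A L) L.
Proof.
rewrite -!big_split /=; apply: eq_bigr => i _.
have := subrK L (D i); move: (D i - L) => M <-.
rewrite linearD mdotDl !mdotDr mdotZl (symA M L) (mdotC M).
by ring.
Qed.

(** For the extension by zero of w minus its boundary values, the first sum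
    of quadratic_translate is an energy and has nonnegative integral, and the
    second sum has vanishing integral. The function G is the sum of both. *)
Lemma block_inequality (w : 'cV[R]_m -> qpoint R q n) wi Dwi (a : 'cV[R]_n) (L : 'M[R]_(n, m)) :
  semielliptic (q + r) A ->
  sobolev_q w -> cube_boundary_values w (fun x => dirac_sum (fun=> a + L *m x)) ->
  approx_differential cube w wi Dwi ->
  exists G : 'cV[R]_m -> R,
    [/\ leb.-integrable [set: E] (EFin \o (G : E -> R)), forall x, ~ cube x -> G x = 0,
        forall x, cube x ->
          \sum_i mdot (A (Dwi i x)) (Dwi i x) = G x + \sum_(i < q) mdot (A L) L
      & (0 <= \int[leb]_(x in [set: E]) (G x)%:E)%E].
Proof.
move=> seA sw bw aw.
have [f [g [D [lf fg gD0 df DE]]]] := boundary_extension sw bw aw.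
have f0 x : ~ cube x -> f x = dirac_sum (fun=> 0).
  by move=> nx; rewrite fg; congr dirac_sum; apply/funext => i; exact: (gD0 x nx i).1.
have D0 x : ~ cube x -> forall i, D i x = 0 by move=> nx i; exact: (gD0 x nx i).2.
pose H x := \sum_i mdot (A (D i x)) (D i x).
pose T x := \sum_i mdot (2 *: A L) (D i x).
have iH : leb.-integrable [set: E] (EFin \o (H : E -> R)).
  exact: (energy_integrable A lf f0 df).
have [iT T0] : leb.-integrable [set: E] (EFin \o (T : E -> R)) /\
    (\int[leb]_(x in [set: E]) (T x)%:E = 0)%E.
  exact: sum_differential lf f0 D0 df.
have H0 : (0 <= \int[leb]_(x in [set: E]) (H x)%:E)%E.
  exact: semielliptic_fewer seA lf fg gD0 df.
exists (fun x => H x + T x); split.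
- have := integrableD measurableT iH iT; congr (leb.-integrable _ _).
- move=> x nx; rewrite /H /T !big1 ?addr0 // => i _; rewrite D0 //.
    by rewrite -(scale0r 0) mdotZr mul0r.
  by rewrite linear0 -(scale0r 0) mdotZl mul0r.
- move=> x cx; rewrite (quadratic_translate _ L) /H /T.
  by under [in RHS]eq_bigr do rewrite DE //; under [X in _ = _ + X + _]eq_bigr do rewrite DE //.
- under eq_integral do rewrite EFinD.
  by rewrite (integralD measurableT iH iT) T0 adde0.
Qed.

End block_inequality.

Section quadratic_Q_integrand.
Context (R : realType) (m n Q : nat).
Variable A : {linear 'M[R]_(n, m) -> 'M[R]_(n, m)}.

Lemma uncurried_quadratic_continuous :
  continuous (uncurried (quadratic_integrand (Q := Q) A)).
Proof.
have cadd : continuous (fun x : R * R => x.1 + x.2) by exact: add_continuous.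
apply: (continuous_big cadd) => i _ p.
have c2 : (p' : arguments R m n Q).2 @[p' --> p] --> p.2 by exact: cvg_snd.
have ci := cvg_comp _ _ c2 (@proj_continuous _ (fun=> 'M[R]_(n, m)) i p.2).
exact: (cvg_comp _ _ ci (@continuous_quadratic_form _ _ _ A (p.2 i))).
Qed.

(** The integrand is continuous. *)
Lemma quadratic_Q_integrand : Q_integrand (quadratic_integrand (Q := Q) A).
Proof.
split=> [B mB|s a M]; last first.
  by rewrite /quadratic_integrand [RHS](reindex_inj (@perm_inj _ s)).
have : (@RGenOpens.G R).-sigma.-measurable B by rewrite -RGenOpens.measurableE.
have sA : sigma_algebra setT (image_set_system setT
    (uncurried (quadratic_integrand (Q := Q) A)) <<s open>>).
  exact/sigma_algebra_image/smallest_sigma_algebra.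
have sub : @RGenOpens.G R `<=` image_set_system setT
    (uncurried (quadratic_integrand (Q := Q) A)) <<s open>>.
  move=> _ [x [y ->]]; rewrite /image_set_system /= setTI; apply: sub_sigma_algebra.
  apply: open_comp; last exact: interval_open.
  by move=> p _; exact: uncurried_quadratic_continuous.
move=> /(smallest_sub sA sub).
by rewrite /image_set_system /= setTI.
Qed.

Lemma quadratic_locally_bounded : locally_bounded (quadratic_integrand (Q := Q) A).
Proof.
move=> p; exists (`|uncurried (quadratic_integrand (Q := Q) A) p| + 1).
have FF := nbhs_filter p.
have /cvgrPdist_le/(_ 1 ltr01) := @uncurried_quadratic_continuous p.
apply: filterS => p' pp'.
rewrite -(subrK (uncurried (quadratic_integrand (Q := Q) A) p) (uncurried _ p')) addrC.
by rewrite (le_trans (ler_normD _ _)) // lerD2l distrC.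
Qed.

End quadratic_Q_integrand.

(** The blocks contribute to the energy additively, and the constants in
    block_inequality add up to the energy of the affine map because the cube
    has volume 1. *)
Lemma semielliptic_quasiconvex (R : realType) (m n Q : nat)
    (A : {linear 'M[R]_(n, m) -> 'M[R]_(n, m)}) : symmetric_map A ->
  semielliptic Q A -> quasiconvex (quadratic_integrand (Q := Q) A).
Proof.
move=> symA seA; split.
- exact: quadratic_Q_integrand.
- exact: quadratic_locally_bounded.
move=> J q a L eQ _ _ w wi Dwi sw bw aw /=.
have bG j : exists G : 'cV[R]_m -> R,
    [/\ leb.-integrable [set: euclid R m] (EFin \o (G : euclid R m -> R)),
        forall x, ~ cube x -> G x = 0,
        forall x, cube x -> \sum_i mdot (A (Dwi j i x)) (Dwi j i x) =
          G x + \sum_(i < q j) mdot (A (L j)) (L j)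
      & (0 <= \int[leb]_(x in [set: euclid R m]) (G x)%:E)%E].
  apply: (@block_inequality _ _ _ _ (Q - q j) A symA _ _ _ (a j)) (sw j) (bw j) (aw j).
  by rewrite subnKC // eQ (bigD1 j) //= leq_addr.
have {bG}[G bG] := choice bG.
pose c := \sum_j \sum_(i < q j) mdot (A (L j)) (L j).
have iG j : leb.-integrable [set: euclid R m] (EFin \o (G j : euclid R m -> R)).
  by have [] := bG j.
have iS : leb.-integrable [set: euclid R m]
    (fun x => \sum_j (EFin \o (G j : euclid R m -> R)) x)%E.
  exact: integrable_sum.
have mcube := @measurable_cube R m.
rewrite [quadratic_integrand _ _ _](sum_blocks eQ (fun j _ => mdot (A (L j)) (L j))) -/c.
rewrite (eq_integral (fun x : euclid R m =>
    (\sum_j (EFin \o (G j : euclid R m -> R)) x + cst c%:E x)%E)); last first.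
  move=> x /set_mem cx; rewrite /quadratic_integrand.
  rewrite (sum_blocks eQ (fun j k => mdot (A (Dwi j k x)) (Dwi j k x))).
  rewrite sumEFin -EFinD -big_split; congr EFin; apply: eq_bigr => j _.
  by have [_ _ GE _] := bG j; exact: GE.
have icst : leb.-integrable (cube : set (euclid R m)) (EFin \o (cst c : euclid R m -> R)).
  apply: measurable_bounded_integrable => //; last exact: bounded_cst.
  by rewrite [X in (X < _)%E]leb_cube ltry.
have iSc : leb.-integrable (cube : set (euclid R m))
    (fun x => \sum_j (EFin \o (G j : euclid R m -> R)) x)%E.
  exact: integrableS iS.
rewrite (integralD mcube iSc icst).
have -> : (\int[leb]_(x in (cube : set (euclid R m))) (EFin \o (cst c : euclid R m -> R)) x = c%:E)%E.
  by rewrite (integral_cst _ mcube c%:E) [X in (_ * X)%E]leb_cube mule1.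
rewrite leeDr //.
rewrite integral_cubeE; last first.
  by move=> x nx; rewrite big1 // => j _; have [_ G0 _ _] := bG j; rewrite /= G0.
by rewrite integral_sum // sume_ge0 // => j _; have [] := bG j.
Qed.

Theorem mainTheorem3 (R : realType) (m n Q : nat)
    (hm : (1 <= m)%N) (hn : (1 <= n)%N) (hQ : (1 <= Q)%N)
    (A : {linear 'M[R]_(n, m) -> 'M[R]_(n, m)}) (hA : symmetric_map A) :
  semielliptic Q A <-> quasiconvex (quadratic_integrand (Q := Q) A).
Proof.
by split; [exact: semielliptic_quasiconvex|exact: quasiconvex_semielliptic].
Qed.
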